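(* For every $D<\infty$ there exists a constant $C(D)$ such that for every connected infinite penny graph $G=(V,E,F)$ with $\deg(\sigma)\le D$ for all $\sigma\in F$, and for any $k\ge1$, $$\dim\mathcal{P}^{2k}(G)\le C(D)\,k^3.$$
   Context: Penny graphs: Let $\{B_i\}_{i=1}^\infty$ be a collection of pairwise disjoint open disks of radius $\frac12$ in $\mathbb{R}^2$, with boundary circles $C_i$ and centers $c_i$. Let $V=\{v_i\}_{i=1}^\infty$, and let $\{v_i,v_j\}\in E$ ($i\ne j$) iff $C_i$ and $C_j$ are tangent, i.e. $|c_i-c_j|=1$. The embedding $\phi$ is given by $\phi(v_i)=c_i$, $\phi(\{v_i,v_j\})=\overline{c_ic_j}$ (the straight segment). The set $F$ of faces corresponds to the connected components of the complement in $\mathbb{R}^2$ of the embedded image of $(V,E)$; for $\sigma\in F$, $\phi(\sigma)$ denotes the corresponding component. The facial degree $\deg(\sigma)\in\mathbb{N}\cup\{\infty\}$ is the number of interior angles (corners at embedded vertices, counted with multiplicity) of the polygonal domain $\phi(\sigma)$. The triple $G=(V,E,F)$ is called an infinite penny graph; it is connected if the graph $(V,E)$ is connected. $d$ is the combinatorial (shortest path) distance on $(V,E)$; $\Delta$ acts in the space variable by $\Delta u(x,t)=\sum_{y\sim x}(u(y,t)-u(x,t))$, the sum being over neighbors $y$ of $x$. An ancient solution to the heat equation is a function $u:V\times(-\infty,0]\to\mathbb{R}$ with $\partial_tu(x,t)=\Delta u(x,t)$ for all $x\in V$, $t\le0$ (one-sided derivative at $t=0$). Fix $x_0\in V$. $\mathcal{P}^k(G)$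 is the real vector space of ancient solutions $u$ for which there is a constant $C_u$ (depending on $u$) with $|u(x,t)|\le C_u(1+d(x,x_0)+\sqrt{|t|})^k$ for all $x\in V$, $t\le0$. This space does not depend on the choice of $x_0$. *)

(* Defs.v *)
From HB Require Import structures.
From mathcomp Require Import all_boot all_order all_algebra.
From mathcomp Require Import all_classical all_reals all_analysis.
Set Implicit Arguments.
Unset Strict Implicit.
Unset Printing Implicit Defensive.
Import Order.TTheory GRing.Theory Num.Theory.
Import numFieldTopology.Exports numFieldNormedType.Exports.
Local Open Scope classical_set_scope.
Local Open Scope ring_scope.

(* The norm that the library puts on [R * R] is the sup norm, hence a separate
   Euclidean distance; the two induce the same topology. *)
Definition edist (R : realType) (p q : R * R) : R :=
  Num.sqrt ((p.1 - q.1) ^+ 2 + (p.2 - q.2) ^+ 2).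

Definition open_disk (R : realType) (p : R * R) (r : R) : set (R * R) :=
  [set q | edist p q < r].

Definition segment (R : realType) (p q : R * R) : set (R * R) :=
  [set z | exists2 t : R, 0 <= t <= 1 &
    z = ((1 - t) * p.1 + t * q.1, (1 - t) * p.2 + t * q.2)].

(* The vertex v_i is represented by its index i : nat. *)
Record penny_graph (R : realType) := PennyGraph {
  center : nat -> R * R;
  disjoint_disks : trivIset [set: nat] (fun i => open_disk (center i) (1 / 2))
}.

Section PennyGraph.
Variables (R : realType) (G : penny_graph R).

Definition adj : rel nat :=
  fun i j => (i != j) && (edist (center G i) (center G j) == 1).

Definition is_walk (x y : nat) (p : seq nat) : Prop :=
  path adj x p /\ last x p = y.

Definition graph_connected : Prop :=
  forall x y : nat, exists p : seq nat, is_walk x y p.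

(* Junk value 0 when no walk joins x to y. *)
Definition gdist (x y : nat) : nat :=
  match pselect (exists n, `[< exists2 p, is_walk x y p & size p = n >]) with
  | left h => ex_minn h
  | right _ => 0%N
  end.

Definition embedded_graph : set (R * R) :=
  [set z | exists i, z = center G i] `|`
  [set z | exists i j, adj i j /\ segment (center G i) (center G j) z].

Definition components (A : set (R * R)) : set (set (R * R)) :=
  [set S | exists2 x, A x & S = connected_component A x].

Definition faces : set (set (R * R)) := components (~` embedded_graph).

(* Inside the disk B_i the embedded graph consists of c_i and of radii along the
   edges at v_i only: for an edge {v_j, v_k} not containing v_i, the point c_i
   is at distance at least 1 from c_j and c_k, hence at distance at least
   sqrt 3 / 2 > 1 / 2 from the segment between them. The interior angles of the
   face S at v_i are therefore the connected components (circular sectors) of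
   B_i `&` S; a face may have several of them at the same vertex. *)
Definition corners (S : set (R * R)) : set (nat * set (R * R)) :=
  [set a | components (open_disk (center G a.1) (1 / 2) `&` S) a.2].

Definition facial_degree (S : set (R * R)) : \bar R := counting (corners S).

(* At most 6 points at distance 1 from a center are centers, so the set of
   neighbors is finite and the finitely supported sum below has no junk case. *)
Definition laplacian (u : nat -> R -> R) (x : nat) (t : R) : R :=
  \sum_(y \in [set y | adj x y]) (u y t - u x t).

(* A function on V x (-oo, 0] is represented by its extension by 0 to V x R, so
   that equality and linear independence of representatives are those of the
   functions on V x (-oo, 0]. The derivative at t = 0 is the left one. *)
Definition ancient_solution (u : nat -> R -> R) : Prop :=
  [/\ forall x (t : R), 0 < t -> u x t = 0,
      forall x (t : R), t < 0 -> is_derive t (1 : R) (u x) (laplacian u x t) &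
      forall x, (h^-1 * (u x h - u x 0)) @[h --> (0 : R)^'-]
                  --> laplacian u x 0].

Definition ancient_poly (x0 : nat) (k : R) : set (nat -> R -> R^o) :=
  [set u | ancient_solution u /\ exists C : R, forall x (t : R), t <= 0 ->
    `|u x t| <= C * (1 + (gdist x x0)%:R + Num.sqrt `|t|) `^ k].

End PennyGraph.

Definition linearly_independent (R : realType) (V : lmodType R) (n : nat)
    (v : 'I_n -> V) : Prop :=
  forall a : 'I_n -> R, \sum_(i < n) a i *: v i = 0 -> forall i, a i = 0.

(* For W a linear subspace of V, this is its dimension in N U {+oo}. *)
Definition dimension (R : realType) (V : lmodType R) (W : set V) : \bar R :=
  ereal_sup [set n%:R%:E | n in [set n : nat |
    exists v : 'I_n -> V, (forall i, W (v i)) /\ linearly_independent v]].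

(* Main.v *)
(* The corners of a face S are finitely many and induce a connected subgraph: otherwise a
   cutoff function separating two groups of them, read modulo 1 and extended by 0 outside S,
   would be Lipschitz modulo 1 on the plane and hence lift to a real function; the lift is
   constant along the connected graph, which contradicts the jump of the cutoff on S. Hence,
   with facial degrees at most D, the graph is coarsely equivalent to the lattice Z^2, with
   constants depending on D only, and Poincare inequalities on squares can be pulled back
   from Z^2.

   For harmonic functions of growth 2K, the Gram determinants on balls of radii R (1+1/K)^j
   grow at most like E^(N j) for a constant E, N being the dimension; on the other hand, on
   the subspace of codimension C K^2 of functions with mean zero on squares of side eps R / K,
   the Poincare and Caccioppoli inequalities make each step grow by a large factor. This
   gives N <= C K^2.

   For an ancient solution u of growth 2K, a weighted energy argument with nested cutoffs
   bounds r^4 times the square sum of the Laplacian of u on a ball of radius r by the square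
   sum of u on the parabolic cylinder of size 8 r, so that the Laplacian to the power K+1
   annihilates u. The powers of the Laplacian filter the space of ancient solutions with
   K+1 quotients embedded in the space of harmonic functions of growth 2K. *)
Require Import Defs.
From mathcomp Require Import all_boot all_order all_algebra.
From mathcomp Require Import all_classical all_reals all_analysis.
From mathcomp Require Import perm zify ring lra.
Import Defs.
Set Implicit Arguments.
Unset Strict Implicit.
Unset Printing Implicit Defensive.
Import Order.TTheory GRing.Theory Num.Theory.
Import numFieldTopology.Exports numFieldNormedType.Exports.
Local Open Scope classical_set_scope.
Local Open Scope ring_scope.

(** * The Euclidean plane *)

(** The lift modulo 1 is the only place where the simple connectedness of the plane enters; it does
    the work of a Jordan curve argument. Having infinitely many vertices then excludes an unbounded
    face: its vertices are within [D] of one another, so it would contain the whole exterior of a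
    square, where other centers lie. The lattice is used because its squares subdivide exactly and
    have an elementary Poincare inequality.

    The ratio [1 + 1 / K] keeps [(1 + 1 / K) ^ (4 K + 2)] below [expR 6] uniformly in [K]; here
    [4 K] comes from products of two functions of growth [2 K], and 2 from the volume of balls. The
    price is an annulus of width [r / K], hence squares of that scale and of the order of [K ^ 2]
    mean conditions. Comparing determinants treats all scales at once, with no search for a scale of
    small growth.

    The power [K + 1] of the Laplacian is the first whose decay [r ^ (4 K + 4)] beats the growth
    [r ^ (4 K + 2)]. The cube is the product of [K + 1] layers with the order [K ^ 2] of each. *)

Section EuclideanPlane.
Variable R : realType.
Implicit Types (p q z c : R * R) (t e : R).

Lemma edist_ge0 p q : 0 <= edist p q.
Proof. exact: sqrtr_ge0. Qed.

Lemma edistC p q : edist p q = edist q p.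
Proof. by rewrite /edist; congr Num.sqrt; ring. Qed.

Lemma edistxx p : edist p p = 0.
Proof. by rewrite /edist !subrr expr0n addr0 sqrtr0. Qed.

Lemma edist_sqr p q : edist p q ^+ 2 = (p.1 - q.1) ^+ 2 + (p.2 - q.2) ^+ 2.
Proof. by rewrite sqr_sqrtr // addr_ge0 // sqr_ge0. Qed.

Lemma edist_le p q e :
  0 <= e -> (edist p q <= e) = ((p.1 - q.1) ^+ 2 + (p.2 - q.2) ^+ 2 <= e ^+ 2).
Proof. by move=> e0; rewrite -edist_sqr ler_pXn2r // nnegrE // edist_ge0. Qed.

Lemma edist_triangle q p z : edist p z <= edist p q + edist q z.
Proof.
rewrite edist_le ?addr_ge0 ?edist_ge0 //.
have h1 := edist_sqr p q; have h2 := edist_sqr q z.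
have n1 := edist_ge0 p q; have n2 := edist_ge0 q z.
set a := edist p q in h1 n1 *; set b := edist q z in h2 n2 *.
set x := p.1 - q.1 in h1; set y := p.2 - q.2 in h1.
set x' := q.1 - z.1 in h2; set y' := q.2 - z.2 in h2.
have -> : p.1 - z.1 = x + x' by rewrite /x /x'; ring.
have -> : p.2 - z.2 = y + y' by rewrite /y /y'; ring.
have cs : x * x' + y * y' <= a * b.
  have [l|l] := leP (x * x' + y * y') 0; first by apply: le_trans l _; rewrite mulr_ge0.
  rewrite -(@ler_pXn2r _ 2) // ?nnegrE ?mulr_ge0 // ?(ltW l) // exprMn h1 h2.
  rewrite -subr_ge0 (_ : _ - _ = (x * y' - y * x') ^+ 2) ?sqr_ge0 //; ring.
have -> : (a + b) ^+ 2 = a ^+ 2 + b ^+ 2 + 2 * (a * b) by ring.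
rewrite h1 h2; lra.
Qed.

Lemma coord1_le_edist p q : `|p.1 - q.1| <= edist p q.
Proof.
rewrite -(@ler_pXn2r _ 2) ?nnegrE ?edist_ge0 // edist_sqr real_normK ?num_real //.
by rewrite lerDl sqr_ge0.
Qed.

Lemma coord2_le_edist p q : `|p.2 - q.2| <= edist p q.
Proof.
rewrite -(@ler_pXn2r _ 2) ?nnegrE ?edist_ge0 // edist_sqr real_normK ?num_real //.
by rewrite lerDr sqr_ge0.
Qed.

Lemma edist_le_coord p q : edist p q <= `|p.1 - q.1| + `|p.2 - q.2|.
Proof.
rewrite edist_le ?addr_ge0 // [leRHS]sqrrD !real_normK ?num_real //.
by rewrite -addrA lerD2l lerDr mulrn_wge0 // mulr_ge0.
Qed.

Definition lerp p q t : R * R :=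
  ((1 - t) * p.1 + t * q.1, (1 - t) * p.2 + t * q.2).

Lemma lerp0 p q : lerp p q 0 = p.
Proof. by case: p => a b; rewrite /lerp /= subr0 !mul1r !mul0r !addr0. Qed.

Lemma lerp1 p q : lerp p q 1 = q.
Proof. by case: q => a b; rewrite /lerp /= subrr !mul1r !mul0r !add0r. Qed.

Lemma lerp_opp p q t : lerp p q (1 - t) = lerp q p t.
Proof. by rewrite /lerp; congr pair; ring. Qed.

Lemma edist_lerp p q t t' : edist (lerp p q t) (lerp p q t') = `|t - t'| * edist p q.
Proof.
rewrite /edist /lerp /= -sqrtr_sqr -sqrtrM ?sqr_ge0 //; congr Num.sqrt; ring.
Qed.

Lemma edist_lerpl p q t : edist (lerp p q t) p = `|t| * edist p q.
Proof. by rewrite -{2}[p](lerp0 p q) edist_lerp subr0. Qed.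

Lemma edist_lerp_scale (o p q : R * R) t :
  edist (lerp o p t) (lerp o q t) = `|t| * edist p q.
Proof.
rewrite /edist /lerp /= -sqrtr_sqr -sqrtrM ?sqr_ge0 //; congr Num.sqrt; ring.
Qed.

Lemma edist_lerp_le p q c t : 0 <= t <= 1 ->
  edist (lerp p q t) c <= (1 - t) * edist p c + t * edist q c.
Proof.
move=> /andP[t0 t1].
apply: le_trans (edist_triangle (lerp p c t) _ _) _.
have -> : edist (lerp p q t) (lerp p c t) = t * edist q c.
  by rewrite edist_lerp_scale ger0_norm.
rewrite addrC lerD2r.
have -> : edist (lerp p c t) c = (1 - t) * edist p c; last by [].
rewrite -{2}[c](lerp1 p c) edist_lerp distrC ger0_norm // subr_ge0 //.
Qed.

Lemma edist_lerp_lt p q c t e : 0 <= t <= 1 ->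
  edist p c < e -> edist q c < e -> edist (lerp p q t) c < e.
Proof.
move=> ht h1 h2; apply: le_lt_trans (edist_lerp_le _ _ _ ht) _.
case/andP: ht => t0 t1.
have [->|t'] := eqVneq t 0; first by rewrite subr0 mul0r mul1r addr0.
have tp : 0 < t by rewrite lt_neqAle eq_sym t'.
have -> : e = (1 - t) * e + t * e by ring.
by apply: ler_ltD; [apply: ler_wpM2l (ltW h1); rewrite subr_ge0 | rewrite ltr_pM2l].
Qed.

Lemma edist_lerp_le_max p q c t e : 0 <= t <= 1 ->
  edist p c <= e -> edist q c <= e -> edist (lerp p q t) c <= e.
Proof.
move=> ht h1 h2; apply: le_trans (edist_lerp_le _ _ _ ht) _.
case/andP: ht => t0 t1.
have -> : e = (1 - t) * e + t * e by ring.
by apply: lerD; apply: ler_wpM2l => //; rewrite subr_ge0.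
Qed.

(** Connectedness of the unit interval, packaged so that every continuation along a segment reduces
    to a local check. The supremum of the [t] such that [P] holds on the whole of [[0, t]] satisfies
    [P], and local constancy there would push past it if it were below 1. *)
Lemma unit_interval_ind (P : R -> Prop) :
  (forall t, 0 <= t <= 1 -> exists2 e, 0 < e &
     forall t', 0 <= t' <= 1 -> `|t - t'| < e -> (P t <-> P t')) ->
  P 0 -> P 1.
Proof.
move=> lc P0.
pose E := [set t : R | 0 <= t <= 1 /\ forall s, 0 <= s <= t -> P s].
have E0 : E 0.
  split; first by rewrite lexx ler01.
  by move=> s /le_anti <-.
have Eub : ubound E 1 by move=> t [/andP[]].
have hs : has_sup E by split; [exists 0 | exists 1].
set m := sup E.
have m0 : 0 <= m by apply: ub_le_sup; [exists 1 | exact: E0].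
have m1 : m <= 1 by apply: ge_sup; [exists 0|].
have [|e e0 lce] := lc m; first by rewrite m0.
have [t [/andP[t0 t1] Et] tm] := sup_adherent e0 hs.
have tlem : t <= m.
  apply: ub_le_sup; first by exists 1.
  by split=> //; rewrite t0.
rewrite -/m in tm.
have Pm : P m.
  apply: (proj2 (lce t _ _)); first by rewrite t0.
    by rewrite ger0_norm ?subr_ge0 //; lra.
  by apply: Et; rewrite lexx t0.
have Pn s : 0 <= s <= 1 -> `|m - s| < e -> P s by move=> s01 /(lce _ s01) <-.
have [m1'|m1'] := ltP m 1; last by have <- : m = 1 by apply/le_anti; rewrite m1 m1'.
pose m' := Num.min 1 (m + e / 2).
have mm' : m < m' by rewrite lt_min m1' /=; lra.
have m'1 : m' <= 1 by rewrite ge_min lexx.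
have m'e : m' <= m + e / 2 by rewrite ge_min lexx orbT.
have : E m'.
  split; first by rewrite m'1 (le_trans m0 (ltW mm')).
  move=> s /andP[s0 sm'].
  have [st|st] := leP s t; first by apply: Et; rewrite s0.
  apply: Pn; first by rewrite s0 (le_trans sm' m'1).
  by rewrite ltr_norml; apply/andP; split; lra.
move/(ub_le_sup (ex_intro _ 1 Eub)); rewrite -/m; lra.
Qed.

End EuclideanPlane.

(** * Local geometry of penny graphs *)

(** A duplicate-free list of maximal length among those contained in [P] exhausts [P]. *)
Lemma finite_list_of_bounded (T : eqType) (P : T -> Prop) (N : nat) :
  (forall s : seq T, uniq s -> (forall x, x \in s -> P x) -> (size s <= N)%N) ->
  exists s : seq T, [/\ uniq s, (size s <= N)%N & forall x, x \in s <-> P x].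
Proof.
move=> bnd.
pose Q n := `[< exists s : seq T, [/\ uniq s, forall x, x \in s -> P x & size s = n] >].
have exQ : exists n, Q n by exists 0%N; apply/asboolP; exists [::].
have ubQ n : Q n -> (n <= N)%N by move/asboolP=> [s [us Ps <-]]; exact: bnd.
have [n /asboolP[s [us Ps sn]] maxn] := ex_maxnP exQ ubQ.
exists s; split=> //; first exact: bnd.
move=> x; split; first exact: Ps.
move=> Px; apply: contrapT => /negP xs.
have : Q n.+1.
  apply/asboolP; exists (x :: s); split; rewrite /= ?xs ?sn //.
  by move=> y; rewrite inE => /orP[/eqP->|/Ps].
by move/maxn; rewrite ltnn.
Qed.

Definition in_box (a : int * int) (n : nat) (z : int * int) : bool :=
  [&& a.1 <= z.1, z.1 < a.1 + n%:Z, a.2 <= z.2 & z.2 < a.2 + n%:Z].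

Lemma box_packing (T : eqType) (f : T -> int * int) (a : int * int) (n : nat)
    (s : seq T) : injective f -> uniq s -> (forall x, x \in s -> in_box a n (f x)) ->
  (size s <= n * n)%N.
Proof.
move=> inj_f us sbox.
rewrite -(size_map f).
have -> : (n * n)%N =
    size [seq (a.1 + i%:Z, a.2 + j%:Z) | i <- iota 0 n, j <- iota 0 n].
  by rewrite size_allpairs size_iota.
apply: uniq_leq_size; first by rewrite map_inj_uniq.
move=> z /mapP[x xs ->]; case/and4P: (sbox _ xs) => h1 h2 h3 h4.
apply/allpairsP; exists (`|(f x).1 - a.1|%N, `|(f x).2 - a.2|%N) => /=.
rewrite !mem_iota /=; split; [lia|lia|].
by case: (f x) h1 h2 h3 h4 => y1 y2 /= *; congr pair; lia.
Qed.

Section PennyGeometry.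
Variables (R : realType) (G : penny_graph R).
Local Notation c := (center G).
Local Notation adj := (Defs.adj G).
Local Notation Gam := (embedded_graph G).
Implicit Types (i j k l : nat) (p q z : R * R) (t e : R).

Lemma center_dist i j : i != j -> 1 <= edist (c i) (c j).
Proof.
move=> ij; rewrite leNgt; apply/negP => lt1.
have := (@disjoint_disks R G) i j Logic.I Logic.I.
have h t : `|t| = 1 / 2 -> `|t| * edist (c i) (c j) < 1 / 2.
  by move=> ->; lra.
have : open_disk (c i) (1 / 2) `&` open_disk (c j) (1 / 2) !=set0.
  exists (lerp (c i) (c j) (1 / 2)); split; rewrite /open_disk /= edistC.
    by rewrite edist_lerpl h // ger0_norm //; lra.
  rewrite -{2}[c j](lerp1 (c i)) edist_lerp h //.
  rewrite (_ : 1 / 2 - 1 = - (1 / 2)) ?normrN ?ger0_norm //; lra.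
by move=> ne /(_ ne) /eqP; rewrite (negbTE ij).
Qed.

Lemma adjP i j : reflect (i != j /\ edist (c i) (c j) = 1) (adj i j).
Proof. by apply: (iffP andP) => [[? /eqP]|[? /eqP]]. Qed.

Lemma adj_sym : symmetric adj.
Proof. by move=> i j; rewrite /Defs.adj eq_sym edistC. Qed.

Lemma adj_dist i j : adj i j -> edist (c i) (c j) = 1.
Proof. by case/adjP. Qed.

Lemma touching_disks_adj i j z : i != j ->
  edist z (c i) <= 1 / 2 -> edist z (c j) <= 1 / 2 -> adj i j.
Proof.
move=> ij h1 h2; apply/adjP; split=> //; apply/le_anti; rewrite center_dist //.
by rewrite andbT; apply: le_trans (edist_triangle z _ _) _; rewrite (edistC _ z); lra.
Qed.

Lemma center_in_graph i : Gam (c i).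
Proof. by left; exists i. Qed.

Lemma edge_in_graph i j t : adj i j -> 0 <= t <= 1 -> Gam (lerp (c i) (c j) t).
Proof. by move=> ij t01; right; exists i, j; split=> //; exists t. Qed.

Lemma graphP z : Gam z ->
  (exists i, z = c i) \/ exists i j t, [/\ adj i j, 0 <= t <= 1 & z = lerp (c i) (c j) t].
Proof.
case=> [[i ->]|[i [j [ij [t t01 ->]]]]]; first by left; exists i.
by right; exists i, j, t.
Qed.

Lemma edist_edge i j t : adj i j -> 0 <= t <= 1 -> edist (lerp (c i) (c j) t) (c i) = t.
Proof. by move=> ij /andP[t0 _]; rewrite edist_lerpl adj_dist // mulr1 ger0_norm. Qed.

Lemma edist_edger i j t : adj i j -> 0 <= t <= 1 ->
  edist (lerp (c i) (c j) t) (c j) = 1 - t.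
Proof.
move=> ij /andP[t0 t1]; rewrite -[t in lerp _ _ t](subKr 1) lerp_opp.
by rewrite edist_edge 1?adj_sym // subr_ge0 t1 lerBlDr lerDl.
Qed.

Lemma edge_near_end i j t : adj i j -> 0 <= t <= 1 ->
  exists k, (k = i \/ k = j) /\ edist (lerp (c i) (c j) t) (c k) <= 1 / 2.
Proof.
move=> ij t01; have [th|th] := leP t (1 / 2).
  by exists i; split; [left|rewrite edist_edge].
by exists j; split; [right|rewrite edist_edger //; lra].
Qed.

Lemma graph_near_center z : Gam z -> exists i, edist z (c i) <= 1 / 2.
Proof.
case/graphP=> [[i ->]|[i [j [t [ij t01 ->]]]]]; first by exists i; rewrite edistxx; lra.
by have [k [_ hk]] := edge_near_end ij t01; exists k.
Qed.

Definition midpoint i j := lerp (c i) (c j) (1 / 2).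

(** Apollonius' formula for a median, the opposite side having length 1. *)
Lemma midpoint_center i j k : adj i j ->
  edist (c k) (midpoint i j) ^+ 2 =
  (edist (c k) (c i) ^+ 2 + edist (c k) (c j) ^+ 2) / 2 - 1 / 4.
Proof.
move=> ij; have h := edist_sqr (c i) (c j); rewrite adj_dist // expr1n in h.
have -> : 1 / 4 = ((c i).1 - (c j).1) ^+ 2 / 4 + ((c i).2 - (c j).2) ^+ 2 / 4 :> R.
  by rewrite -mulrDl -h.
by rewrite !edist_sqr /midpoint /lerp /=; field.
Qed.

(** Stewart's theorem. *)
Lemma edist_lerp_sqr p q m t :
  edist (lerp p q t) m ^+ 2 = (1 - t) * edist p m ^+ 2 + t * edist q m ^+ 2
    - t * (1 - t) * edist p q ^+ 2.
Proof. by rewrite !edist_sqr /lerp /=; ring. Qed.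

Lemma far_center i j k : adj i j -> k != i -> k != j ->
  3 / 4 <= edist (c k) (midpoint i j) ^+ 2.
Proof.
move=> ij ki kj; rewrite midpoint_center //.
have := center_dist ki; have := center_dist kj.
rewrite -(@ler_pXn2r _ 2) ?nnegrE ?edist_ge0 // expr1n => h1.
rewrite -(@ler_pXn2r _ 2) ?nnegrE ?edist_ge0 // expr1n => h2; lra.
Qed.

Lemma end_center i j : adj i j ->
  edist (c i) (midpoint i j) ^+ 2 = 1 / 4 /\ edist (c j) (midpoint i j) ^+ 2 = 1 / 4.
Proof.
move=> ij; rewrite !midpoint_center // !edistxx adj_dist // edistC adj_dist //.
by rewrite !expr0n !expr1n /=; split; lra.
Qed.

(* Near the midpoint of an edge the graph consists of that edge only: a point of another
   edge has squared distance at least 3/16 from the midpoint. *)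
Lemma graph_near_midpoint i j z : adj i j -> Gam z ->
  edist z (midpoint i j) <= 2 / 5 ->
  exists2 t, 0 <= t <= 1 & z = lerp (c i) (c j) t.
Proof.
move=> ij Gz; rewrite -(@ler_pXn2r _ 2) ?nnegrE ?edist_ge0 //; try lra.
move=> zm; have [mi mj] := end_center ij.
have {zm} zm : edist z (midpoint i j) ^+ 2 < 3 / 16 by apply: le_lt_trans zm _; lra.
case/graphP: Gz zm => [[k ->]|[k [l [t [kl t01 ->]]]]].
  have [->|ki] := eqVneq k i; first by exists 0; rewrite ?lexx ?ler01 ?lerp0.
  have [->|kj] := eqVneq k j; first by exists 1; rewrite ?lexx ?ler01 ?lerp1.
  by have := far_center ij ki kj; lra.
rewrite edist_lerp_sqr adj_dist // expr1n.
have near k' : edist (c k') (midpoint i j) ^+ 2 >= 1 / 4.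
  have [->|ki] := eqVneq k' i; first by rewrite mi.
  have [->|kj] := eqVneq k' j; first by rewrite mj.
  by have := far_center ij ki kj; lra.
have nk := near k; have nl := near l.
case/andP: (t01) => t0 t1.
have [kij|] := boolP ((k == i) || (k == j)); last first.
  rewrite negb_or => /andP[ki kj].
  have fk := far_center ij ki kj.
  have : (1 - t) * (3 / 4) + t * (1 / 4) <=
    (1 - t) * edist (c k) (midpoint i j) ^+ 2 + t * edist (c l) (midpoint i j) ^+ 2.
    by apply: lerD; apply: ler_wpM2l => //; lra.
  (* [(1 - t) * (3 / 4) + t / 4 - t * (1 - t)] equals [(t - 3 / 4) ^+ 2 + 3 / 16]; this is the
     origin of 3/16, and the radius 2/5 fits because its square is smaller. *)
  have := sqr_ge0 (t - 3 / 4); rewrite expr2; lra.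
have [lij|] := boolP ((l == i) || (l == j)); last first.
  rewrite negb_or => /andP[li lj].
  have fl := far_center ij li lj.
  have : (1 - t) * (1 / 4) + t * (3 / 4) <=
    (1 - t) * edist (c k) (midpoint i j) ^+ 2 + t * edist (c l) (midpoint i j) ^+ 2.
    by apply: lerD; apply: ler_wpM2l => //; lra.
  have := sqr_ge0 (t - 1 / 4); rewrite expr2; lra.
move=> _; case/adjP: kl => kl _.
case/orP: kij kl lij => /eqP -> kl /orP[] /eqP lE; rewrite ?lE ?eqxx // in kl *.
  by exists t.
by exists (1 - t); [rewrite subr_ge0 t1 lerBlDr lerDl t0|rewrite lerp_opp].
Qed.

(** A square of side 1/2 has diameter less than 1 and so contains at most one center. *)
Definition cell i : int * int := (Num.floor (2 * (c i).1), Num.floor (2 * (c i).2)).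

Lemma floor_eq_dist (x y : R) : Num.floor x = Num.floor y -> `|x - y| < 1.
Proof.
move=> fxy; have /andP[x1 x2] := floor_itv x; have /andP[y1 y2] := floor_itv y.
rewrite fxy intrD /= in x1 x2; rewrite intrD /= in y2.
by rewrite ltr_norml; apply/andP; split; lra.
Qed.

Lemma cell_inj : injective cell.
Proof.
move=> i j [/floor_eq_dist h1 /floor_eq_dist h2]; apply: contrapT => /eqP ij.
have := center_dist ij.
have := edist_sqr (c i) (c j); have := edist_ge0 (c i) (c j).
set d := edist _ _ => d0 dE d1.
rewrite -mulrBr normrM ger0_norm // in h1; rewrite -mulrBr normrM ger0_norm // in h2.
have k1 : ((c i).1 - (c j).1) ^+ 2 <= 1 / 4.
  rewrite -real_normK ?num_real // (_ : 1 / 4 = (1 / 2) ^+ 2); last by field.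
  by rewrite ler_pXn2r ?nnegrE //; lra.
have k2 : ((c i).2 - (c j).2) ^+ 2 <= 1 / 4.
  rewrite -real_normK ?num_real // (_ : 1 / 4 = (1 / 2) ^+ 2); last by field.
  by rewrite ler_pXn2r ?nnegrE //; lra.
have : 1 <= d ^+ 2 by rewrite exprn_ege1.
lra.
Qed.

Lemma floor_dist (x y : R) (n : nat) : `|x - y| <= n%:R ->
  `|Num.floor x - Num.floor y| <= n%:Z.
Proof.
have half (x' y' : R) : x' - y' <= n%:R -> Num.floor x' - Num.floor y' <= n%:Z.
  move=> h; have /andP[x1 _] := floor_itv x'; have /andP[_ y2] := floor_itv y'.
  rewrite intrD /= in y2.
  have : (Num.floor x')%:~R < (Num.floor y' + 1 + n%:Z)%:~R :> R.
    by rewrite !intrD /=; lra.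
  by rewrite ltr_int; lia.
rewrite ler_norml => /andP[h1 h2]; have := half x y h2.
have := half y x; rewrite ler_norml => /(_ ltac:(lra)); lia.
Qed.

Lemma cell_dist i j (n : nat) : edist (c i) (c j) <= n%:R ->
  `|(cell i).1 - (cell j).1| <= (2 * n)%:Z /\ `|(cell i).2 - (cell j).2| <= (2 * n)%:Z.
Proof.
move=> h; split; apply: floor_dist; rewrite -mulrBr normrM ger0_norm // natrM ler_pM2l //.
  exact: le_trans (coord1_le_edist _ _) h.
exact: le_trans (coord2_le_edist _ _) h.
Qed.

Lemma near_cell_box z i (n : nat) : edist z (c i) <= n%:R ->
  in_box (Num.floor (2 * z.1) - (2 * n)%:Z, Num.floor (2 * z.2) - (2 * n)%:Z) (4 * n + 1) (cell i).
Proof.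
move=> h.
have h1 : `|Num.floor (2 * z.1) - (cell i).1| <= (2 * n)%:Z.
  apply: floor_dist; rewrite -mulrBr normrM ger0_norm // natrM ler_pM2l //.
  exact: le_trans (coord1_le_edist _ _) h.
have h2 : `|Num.floor (2 * z.2) - (cell i).2| <= (2 * n)%:Z.
  apply: floor_dist; rewrite -mulrBr normrM ger0_norm // natrM ler_pM2l //.
  exact: le_trans (coord2_le_edist _ _) h.
case: (cell i) h1 h2 => x y /= h1 h2.
by apply/and4P; split=> /=; lia.
Qed.

Lemma ball_packing z (n : nat) (s : seq nat) : uniq s ->
  (forall i, i \in s -> edist z (c i) <= n%:R) ->
  (size s <= (4 * n + 1) * (4 * n + 1))%N.
Proof.
move=> us hs; apply: (box_packing cell_inj us) => i /hs; exact: near_cell_box.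
Qed.

Lemma ball_list z (n : nat) : exists s : seq nat,
  [/\ uniq s, (size s <= (4 * n + 1) * (4 * n + 1))%N &
      forall i, i \in s <-> edist z (c i) <= n%:R].
Proof. by apply: finite_list_of_bounded => s us hs; exact: ball_packing hs. Qed.

End PennyGeometry.

(** * Faces *)

Lemma uniform_positive (R : realType) (T : eqType) (s : seq T) (Q : T -> R -> Prop) :
  (forall x e e', Q x e -> 0 < e' -> e' <= e -> Q x e') ->
  (forall x, x \in s -> exists2 e, 0 < e & Q x e) ->
  exists2 e, 0 < e & forall x, x \in s -> Q x e.
Proof.
move=> mono; elim: s => [|x s IH] h; first by exists 1; rewrite ?ltr01.
have [|e e0 he] := IH; first by move=> y ys; apply: h; rewrite inE ys orbT.
have [|e' e'0 he'] := h x; first by rewrite mem_head.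
exists (Num.min e e'); first by rewrite lt_min e0.
move=> y; rewrite inE => /orP[/eqP->|/he hy].
  by apply: mono he' _ _; rewrite ?lt_min ?e0 // ge_min lexx orbT.
by apply: mono hy _ _; rewrite ?lt_min ?e0 // ge_min lexx.
Qed.

Lemma segment_positive_distance (R : realType) (p q z : R * R) :
  (forall t, 0 <= t <= 1 -> z <> lerp p q t) ->
  exists2 e, 0 < e & forall t, 0 <= t <= 1 -> e <= edist z (lerp p q t).
Proof.
move=> nz.
have pos t : 0 <= t <= 1 -> 0 < edist z (lerp p q t).
  move=> t01; rewrite lt_neqAle edist_ge0 andbT eq_sym; apply/eqP => d0.
  apply: (nz t t01); have := coord1_le_edist z (lerp p q t).
  have := coord2_le_edist z (lerp p q t); rewrite d0 !normr_le0 !subr_eq0.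
  by case: z {nz d0} => a b /= /eqP -> /eqP ->.
(* Replaces compactness of the segment. Near [t] the distance stays above [d / 2], so a lower bound
   on [[0, a]] extends to [[0, b]] for [a] and [b] close to [t]. *)
pose P t := exists2 e, 0 < e & forall s, 0 <= s <= t -> e <= edist z (lerp p q s).
suff : P 1 by [].
apply: (@unit_interval_ind R P); last first.
  exists (edist z (lerp p q 0)); first by apply: pos; rewrite lexx ler01.
  by move=> s /le_anti <-.
move=> t t01; have dt := pos t t01; set d := edist _ _ in dt.
have L0 : 0 < edist p q + 1 by rewrite ltr_wpDl ?edist_ge0.
pose e := d / 2 / (edist p q + 1).
have e0 : 0 < e by rewrite !divr_gt0.
exists e => //.
have near s : `|t - s| < e -> d / 2 <= edist z (lerp p q s).
  move=> hs; have := edist_triangle (lerp p q s) z (lerp p q t).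
  rewrite -/d [edist (lerp p q s) _]edist_lerp distrC.
  suff : `|t - s| * edist p q <= d / 2 by lra.
  apply: (@le_trans _ _ (e * (edist p q + 1))); last by rewrite divfK ?gt_eqF.
  by apply: ler_pM; rewrite ?edist_ge0 ?(ltW hs) // lerDl.
have step a b : `|t - a| < e -> `|t - b| < e -> P a -> P b.
  move=> ha hb [e' e'0 he']; exists (Num.min e' (d / 2)).
    by rewrite lt_min e'0 divr_gt0.
  move=> s /andP[s0 sb]; have [sa|sa] := leP s a.
    by rewrite ge_min he' ?s0.
  rewrite ge_min near ?orbT //.
  move: ha hb; rewrite !ltr_norml => /andP[? ?] /andP[? ?].
  by apply/andP; split; lra.
move=> t' _ ht'; split; apply: step => //; by rewrite subrr normr0.
Qed.

Lemma nbhs_edist (R : realType) (A : set (R * R)) (z : R * R) (e : R) : 0 < e ->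
  (forall w, edist z w < e -> A w) -> nbhs z A.
Proof.
move=> e0 h; apply/nbhs_ballP; exists (e / 2) => /=; first by rewrite divr_gt0.
case=> w1 w2 [/= h1 h2]; apply: h; apply: le_lt_trans (edist_le_coord _ _) _.
by rewrite [e]splitr; apply: ltrD.
Qed.

Lemma connected_locally_constant (R : realType) (S : set (R * R)) (P : R * R -> Prop) :
  connected S ->
  (forall z, S z -> exists2 e, 0 < e &
     forall w, S w -> edist z w < e -> (P z <-> P w)) ->
  forall z w, S z -> S w -> P z -> P w.
Proof.
move=> cS lc z w Sz Sw Pz.
pose U (Q : R * R -> Prop) := [set x | exists y e, [/\ edist y x < e,
  S y & forall v, S v -> edist y v < e -> Q v]].
have oU Q : open (U Q).
  rewrite openE => x [y [e [yx Sy hy]]].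
  apply: (@nbhs_edist _ _ _ (e - edist y x)); first by rewrite subr_gt0.
  move=> v xv; exists y, e; split=> //.
  by apply: le_lt_trans (edist_triangle x _ _) _; lra.
have SU Q : (forall z, S z -> exists2 e, 0 < e &
     forall w, S w -> edist z w < e -> (Q z <-> Q w)) ->
  forall x, S x -> U Q x <-> Q x.
  move=> lcQ x Sx; split; first by case=> y [e [yx Sy hy]]; exact: hy.
  move=> Qx; have [e e0 he] := lcQ x Sx.
  by exists x, e; split=> //; [rewrite edistxx|move=> v Sv /(he v Sv) <-].
have SP := SU P lc.
have SnP : forall x, S x -> U (fun v => ~ P v) x <-> ~ P x.
  apply: SU => x Sx; have [e e0 he] := lc x Sx.
  by exists e => // v Sv /(he v Sv) hv; rewrite hv.
have : S `&` U P = S.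
  apply: cS.
  - by exists z; split=> //; apply/SP.
  - by exists (U P).
  - exists (~` U (fun v => ~ P v)); first exact: open_closedC.
    apply/seteqP; split=> x [Sx Ux]; split=> //.
      by move=> /(SnP x Sx); apply; apply/SP.
    by apply/SP => //; apply: contrapT => nPx; apply: Ux; apply/SnP.
by move=> /seteqP[_ /(_ w Sw)[_ /SP]]; apply.
Qed.

Lemma lerp_segment_connected (R : realType) (p q : R * R) :
  connected [set lerp p q t | t in `[0, 1]].
Proof.
apply: connected_continuous_connected; first exact: segment_connected.
apply: continuous_subspaceT => t.
have d0 : 0 < edist p q + 1 by rewrite ltr_wpDl ?edist_ge0.
move=> A /nbhs_ballP[e /= e0 hA].
apply/nbhs_ballP; exists (e / (edist p q + 1)) => /=; first by rewrite divr_gt0.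
move=> s /= ts; apply: hA.
have : edist (lerp p q t) (lerp p q s) < e.
  rewrite edist_lerp; apply: (@le_lt_trans _ _ (`|t - s| * (edist p q + 1))).
    by rewrite ler_wpM2l // lerDl.
  by rewrite -ltr_pdivlMr.
by move=> h; split; apply: le_lt_trans h; [exact: coord1_le_edist|exact: coord2_le_edist].
Qed.

Section Faces.
Variables (R : realType) (G : penny_graph R).
Local Notation c := (center G).
Local Notation adj := (Defs.adj G).
Local Notation Gam := (embedded_graph G).
Implicit Types (i j k l : nat) (p q z : R * R) (t e : R) (S : set (R * R)).

Lemma graph_closed z : ~ Gam z -> exists2 e, 0 < e & forall w, edist z w < e -> ~ Gam w.
Proof.
move=> nG.
have [s [_ _ hs]] := ball_list G z 2.
(* Only edges with both ends within 2 of [z] can come within 1 of it, so a finite minimum suffices.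
   Pairs with equal entries give degenerate segments, which treats vertices like edges. *)
pose Q (ij : nat * nat) e := (ij.1 == ij.2) || adj ij.1 ij.2 ->
  forall t, 0 <= t <= 1 -> e <= edist z (lerp (c ij.1) (c ij.2) t).
have [||e e0 he] := @uniform_positive R _ [seq (i, j) | i <- s, j <- s] Q.
- by move=> x e e' h _ e'e a t t01; apply: le_trans e'e (h a t t01).
- case=> i j _; have [h|] := boolP ((i == j) || adj i j); last first.
    by move=> /negbTE h; exists 1; rewrite ?ltr01 // /Q /= h.
  have [|e e0 he] := @segment_positive_distance R (c i) (c j) z.
    move=> t t01 zE; apply: nG; rewrite zE; case/orP: h => [/eqP->|ij].
      rewrite (_ : lerp _ _ _ = c j); first exact: center_in_graph.
      by rewrite /lerp -!mulrDl subrK !mul1r; case: (c j).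
    exact: edge_in_graph.
  by exists e => // _; exact: he.
exists (Num.min e 1); first by rewrite lt_min e0 ltr01.
move=> w; rewrite lt_min => /andP[we w1] Gw.
have ins i j t : (i == j) || adj i j -> 0 <= t <= 1 -> w = lerp (c i) (c j) t ->
    edist w (c i) <= 1 -> edist w (c j) <= 1 -> False.
  move=> ij t01 wE wi wj; have := he (i, j).
  have inS k : edist w (c k) <= 1 -> k \in s.
    by move=> wk; apply/hs; apply: le_trans (edist_triangle w _ _) _; lra.
  rewrite allpairs_f ?inS // => /(_ erefl ij t t01).
  by rewrite -wE leNgt we.
case/graphP: Gw => [[i wE]|[i [j [t [ij t01 wE]]]]].
  by apply: (ins i i 0); rewrite ?eqxx ?lexx ?ler01 ?lerp0 // wE edistxx ler01.
case/andP: (t01) => t0 t1.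
apply: (ins i j t) => //; first by rewrite ij orbT.
  by rewrite wE edist_edge.
by rewrite wE edist_edger // gerBl.
Qed.

Definition face_of z : set (R * R) := connected_component (~` Gam) z.

Lemma face_of_face z : ~ Gam z -> faces G (face_of z).
Proof. by exists z. Qed.

Lemma face_of_self z : ~ Gam z -> face_of z z.
Proof. by move=> nz; apply: connected_component_refl. Qed.

Lemma face_eq S z : faces G S -> S z -> S = face_of z.
Proof. by case=> x _ ->; exact: same_connected_component. Qed.

Lemma face_compl S z : faces G S -> S z -> ~ Gam z.
Proof. by case=> x _ ->; exact: connected_component_sub. Qed.

Lemma face_connected S : faces G S -> connected S.
Proof. by case=> x _ ->; exact: component_connected. Qed.

Lemma face_segment S z w : faces G S -> S z ->
  (forall t, 0 <= t <= 1 -> ~ Gam (lerp z w t)) -> S w.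
Proof.
move=> fS Sz h; rewrite (face_eq fS Sz) /face_of.
have : [set lerp z w t | t in `[0, 1]] w by exists 1; rewrite ?lerp1 //= in_itv /= lexx ler01.
apply: connected_component_max; last exact: lerp_segment_connected.
  by exists 0; rewrite ?lerp0 //= in_itv /= lexx ler01.
by move=> x [t /=]; rewrite in_itv /= => t01 <-; exact: h.
Qed.

Lemma face_ball S z w e : faces G S -> S z -> (forall v, edist w v < e -> ~ Gam v) ->
  edist w z < e -> forall v, edist w v < e -> S v.
Proof.
move=> fS Sz nG wz v wv; apply: face_segment Sz _ => // t t01.
by apply: nG; rewrite edistC; apply: edist_lerp_lt => //; rewrite edistC.
Qed.

Lemma face_open S z : faces G S -> S z ->
  exists2 e, 0 < e & forall w, edist z w < e -> S w.
Proof.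
move=> fS Sz; have [e e0 he] := graph_closed (face_compl fS Sz).
by exists e => //; apply: face_ball Sz he _ => //; rewrite edistxx.
Qed.

Definition adherent S z := forall e, 0 < e -> exists2 w, S w & edist z w < e.

(** If no graph point of the segment were in the closure of [S], membership in [S] would be locally
    constant along the segment: [S] is open, and a point of its closure off the graph belongs to
    [S]. *)
Lemma face_exit S p q : faces G S -> S p -> ~ S q ->
  exists t, [/\ 0 <= t <= 1, Gam (lerp p q t) & adherent S (lerp p q t)].
Proof.
move=> fS Sp nSq; apply: contrapT => no.
have noe t : 0 <= t <= 1 -> adherent S (lerp p q t) -> S (lerp p q t).
  move=> t01 ad; apply: contrapT => nS.
  have [G1|/graph_closed[e e0 he]] := pselect (Gam (lerp p q t)).
    by apply: no; exists t.
  have [w Sw zw] := ad e e0; apply: nS.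
  by apply: face_ball Sw he zw _ _ => //; rewrite edistxx.
apply: nSq; rewrite -(lerp1 p q).
apply: (@unit_interval_ind R (fun t => S (lerp p q t))); last by rewrite lerp0.
have d0 : 0 < edist p q + 1 by rewrite ltr_wpDl ?edist_ge0.
have near e t t' : `|t - t'| < e / (edist p q + 1) ->
    edist (lerp p q t) (lerp p q t') < e.
  rewrite ltr_pdivlMr // edist_lerp => h; apply: le_lt_trans h.
  by rewrite ler_wpM2l // lerDl.
move=> t t01; have [St|nSt] := pselect (S (lerp p q t)).
  have [e e0 he] := face_open fS St.
  exists (e / (edist p q + 1)); first by rewrite divr_gt0.
  by move=> t' _ /near /he.
have [e [e0 he]] : exists e, 0 < e /\ forall w, S w -> ~ edist (lerp p q t) w < e.
  apply: contrapT => h; apply: nSt; apply: noe => // e e0.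
  apply: contrapT => h'; apply: h; exists e; split=> // w Sw zw.
  by apply: h'; exists w.
exists (e / (edist p q + 1)); first by rewrite divr_gt0.
by move=> t' _ /near zt; split=> // /he.
Qed.

Definition face_vertex S i := S `&` open_disk (c i) (1 / 2) !=set0.

Lemma face_vertexP S i : face_vertex S i <-> exists2 p, S p & edist p (c i) < 1 / 2.
Proof.
split=> [[p [Sp]]|[p Sp h]]; rewrite /open_disk /=.
  by rewrite edistC => h; exists p.
by exists p; split=> //; rewrite /open_disk /= edistC.
Qed.

(** Translating [p] by 1/8 parallel to the edge, towards [c i], cannot meet the graph: near the
    midpoint the graph is the edge alone, and a translate on the edge would put [p] on it too. The
    end point is within 1/10 + 3/8 < 1/2 of [c i]. *)
Lemma face_near_midpoint S i j p : faces G S -> adj i j -> S p ->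
  edist p (midpoint G i j) < 1 / 10 -> face_vertex S i.
Proof.
move=> fS ij Sp pm.
set m := midpoint G i j in pm.
pose q : R * R := (p.1 + ((c i).1 - m.1) / 4, p.2 + ((c i).2 - m.2) / 4).
have dm : edist (c i) m = 1 / 2.
  rewrite edistC /m /midpoint edist_edge //; apply/andP; split; lra.
have line t : lerp p q t = (p.1 + t * ((c i).1 - m.1) / 4, p.2 + t * ((c i).2 - m.2) / 4).
  rewrite /lerp /q /=; congr pair; by field.
have pqd : edist q p = 1 / 8.
  have -> : 1 / 8 = `|1 / 4| * edist (c i) m by rewrite dm ger0_norm //; lra.
  rewrite /edist /q /= -sqrtr_sqr -sqrtrM ?sqr_ge0 //; congr Num.sqrt; by field.
apply: (proj2 (face_vertexP S i)); exists q; last first.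
  have := edist_triangle (lerp m (c i) (1 / 4)) q (c i).
  have -> : edist q (lerp m (c i) (1 / 4)) = edist p m.
    rewrite /edist /lerp /q /=; congr Num.sqrt; by field.
  have -> : edist (lerp m (c i) (1 / 4)) (c i) = 3 / 8.
    rewrite -{2}[c i](lerp1 m) edist_lerp edistC dm.
    by rewrite (_ : 1 / 4 - 1 = - (3 / 4)) ?normrN ?ger0_norm //; lra.
  lra.
apply: (face_segment fS Sp) => t t01 Gq.
have [|s s01 sE] := graph_near_midpoint ij Gq.
  apply: le_trans (edist_triangle p _ _) _.
  have : `|t| * edist p q <= 1 / 8.
    by case/andP: t01 => t0 t1; rewrite edistC pqd ger0_norm //; lra.
  by rewrite edist_lerpl -/m; lra.
apply: (face_compl fS Sp).
have mE : m = ((1 - 1 / 2) * (c i).1 + 1 / 2 * (c j).1, (1 - 1 / 2) * (c i).2 + 1 / 2 * (c j).2) by [].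
have pE : p = lerp (c i) (c j) (s + t / 8).
  have := line t; rewrite sE mE /lerp /= => -[e1 e2].
  case: (p) e1 e2 => p1 p2 /= e1 e2; congr pair; lra.
rewrite pE; apply: edge_in_graph => //.
move: pm; rewrite pE /m /midpoint edist_lerp adj_dist // mulr1 ltr_norml => /andP[? ?].
by apply/andP; split; lra.
Qed.

(** A graph point lies in some open disk of radius 1/2 unless it is the midpoint of an edge; only
    that case needs [face_near_midpoint]. *)
Lemma adherent_face_vertex S z : faces G S -> Gam z -> adherent S z ->
  exists2 i, face_vertex S i & edist z (c i) <= 1 / 2.
Proof.
move=> fS Gz ad.
have inner i : edist z (c i) < 1 / 2 -> face_vertex S i.
  move=> zi; have [|w Sw zw] := ad (1 / 2 - edist z (c i)); first by rewrite subr_gt0.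
  apply: (proj2 (face_vertexP S i)); exists w => //.
  by apply: le_lt_trans (edist_triangle z _ _) _; rewrite (edistC w); lra.
case/graphP: Gz => [[i zE]|[i [j [t [ij t01 zE]]]]].
  by exists i; [apply: inner|]; rewrite zE edistxx; lra.
have di : edist z (c i) = t by rewrite zE edist_edge.
have dj : edist z (c j) = 1 - t by rewrite zE edist_edger.
have [th|th|th] := ltgtP t (1 / 2).
- by exists i; [apply: inner|]; rewrite di; lra.
- by exists j; [apply: inner|]; rewrite dj; lra.
have [|w Sw zw] := ad (1 / 10); first by lra.
exists i; last by rewrite di th.
apply: (face_near_midpoint fS ij Sw).
by rewrite edistC /midpoint -th -zE.
Qed.

End Faces.

(** * The vertices of a face are linked *)

Section ReductionModOne.
Variable R : realType.
Implicit Types (x y : R) (n : int).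

(** The representative of [x] modulo 1 nearest to 0; its absolute value is the distance from [x] to
    the integers. *)
Definition red x : R := x - (Num.floor (x + 1 / 2))%:~R.

Lemma red_bound x : `|red x| <= 1 / 2.
Proof.
have /andP[h1 h2] := floor_itv (x + 1 / 2); rewrite intrD /= in h2.
by rewrite /red ler_norml; apply/andP; split; lra.
Qed.

Lemma int_small n : `|n%:~R : R| < 1 -> n%:~R = 0 :> R.
Proof. by rewrite -intr_norm (ltr_int R _ 1) => h; have -> : n = 0 by lia. Qed.

Lemma red_unique x y n : x - y = n%:~R -> `|y| < 1 / 2 -> red x = y.
Proof.
move=> xy y2; have rb := red_bound x.
set m := n - Num.floor (x + 1 / 2).
have mE : red x - y = m%:~R.
  by rewrite /red /m intrD intrN /= -xy; ring.
apply/eqP; rewrite -subr_eq0 mE int_small // -mE.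
by apply: le_lt_trans (ler_normB _ _) _; lra.
Qed.

Lemma red_small x : `|x| < 1 / 2 -> red x = x.
Proof. by apply: (red_unique (n := 0)); rewrite subrr. Qed.

Lemma red_int n : red n%:~R = 0.
Proof. by apply: (red_unique (n := n)); rewrite ?subr0 ?normr0 //; lra. Qed.

Lemma red_le x n : `|red x| <= `|x - n%:~R|.
Proof.
have [h|h] := ltP `|x - n%:~R| (1 / 2); last exact: le_trans (red_bound x) h.
by rewrite (@red_unique x (x - n%:~R) n) // opprB addrC subrK.
Qed.

(* All four reductions are at most 1/8, so the two sides differ by an integer of absolute
   value less than 1. *)
Lemma red_square (a a' b b' : R) :
  `|red (b - a)| <= 1 / 8 -> `|red (b' - a')| <= 1 / 8 ->
  `|red (a' - a)| <= 1 / 8 -> `|red (b' - b)| <= 1 / 8 ->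
  red (b' - b) - red (a' - a) = red (b' - a') - red (b - a).
Proof.
move=> h1 h2 h3 h4; apply/eqP; rewrite -subr_eq0.
pose f x := Num.floor (x + 1 / 2).
set z := (X in X == 0).
have zE : z = (f (a' - a) + f (b' - a') - f (b' - b) - f (b - a))%:~R.
  by rewrite /z /red !(intrD, intrN) /f /=; ring.
suff z1 : `|z| < 1 by rewrite zE int_small // -zE.
rewrite /z.
apply: le_lt_trans (ler_normB _ _) _.
apply: le_lt_trans (lerD (ler_normB _ _) (ler_normB _ _)) _; lra.
Qed.

End ReductionModOne.

(** * Lifting Lipschitz functions modulo 1 to real functions on a ball *)

Section Potential.
Variable R : realType.
Implicit Types (p q z o : R * R) (theta psi : R * R -> R) (t rho L : R).

(** [psi] is a real lift on a ball of [theta] modulo 1. At distance [1 / (8 * L)] the reduced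
    increments of an [L]-Lipschitz [theta] are at most 1/8, the threshold of [red_square]. *)
Definition potential theta L o rho psi := forall p q,
  edist o p <= rho -> edist o q <= rho -> edist p q <= 1 / (8 * L) ->
  psi q - psi p = red (theta q - theta p).

(* The lift of theta mod 1 along the rays from o. *)
Lemma potential_exists theta L o rho : 0 < L ->
  (forall p q, `|red (theta p - theta q)| <= L * edist p q) ->
  exists psi, potential theta L o rho psi.
Proof.
move=> L0 lip.
have [rho0|rho0] := ltP rho 0.
  by exists theta => p q op; have := edist_ge0 o p; lra.
(* Cutting each ray into [n] pieces makes every radial increment at most 1/8. *)
have [n n0 hn] : exists2 n : nat, (0 < n)%N & rho * (8 * L) <= n%:R.
  exists (Num.Def.archi_bound (rho * (8 * L))).+1 => //.
  have h0 : 0 <= rho * (8 * L) by rewrite mulr_ge0 // mulr_ge0 // ltW.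
  by rewrite -[leRHS]natr1; apply: ler_wpDr => //; apply/ltW/archi_boundP.
have n0' : 0 < n%:R :> R by rewrite ltr0n.
pose s i : R := i%:R / n%:R.
pose x p i := theta (lerp o p (s i)).
exists (fun p => \sum_(0 <= i < n) red (x p i.+1 - x p i)) => p q op oq pq.
have radial z i : edist o z <= rho -> `|red (x z i.+1 - x z i)| <= 1 / 8.
  move=> oz; apply: le_trans (lip _ _) _; rewrite edist_lerp.
  have -> : `|s i.+1 - s i| = n%:R^-1.
    by rewrite /s -mulrBl -natrB // subSnn mul1r ger0_norm // invr_ge0.
  have h : edist o z * (8 * L) <= n%:R.
    by apply: le_trans hn; rewrite ler_wpM2r // mulr_ge0 // ltW.
  rewrite mulrCA ler_pdivrMl //; lra.
have cross i : (i <= n)%N -> `|red (x q i - x p i)| <= 1 / 8.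
  move=> ni; apply: le_trans (lip _ _) _; rewrite edist_lerp_scale.
  have s1 : `|s i| <= 1.
    by rewrite ger0_norm ?divr_ge0 // ler_pdivrMr // mul1r ler_nat.
  rewrite mulrCA -[leRHS]mul1r; apply: ler_pM => //.
    by rewrite mulr_ge0 ?edist_ge0 // ltW.
  move: pq; rewrite edistC ler_pdivlMr; lra.
(* The two rays and the short segments between them form [n] quadrilaterals. By [red_square] each
   radial difference is a difference of consecutive cross increments, and the sum telescopes to the
   outermost one, the innermost joining [o] to itself. *)
have -> : \sum_(0 <= i < n) red (x q i.+1 - x q i) -
    \sum_(0 <= i < n) red (x p i.+1 - x p i) =
    \sum_(0 <= i < n) (red (x q i.+1 - x p i.+1) - red (x q i - x p i)).
  rewrite -sumrB; apply: eq_big_nat => i /andP[_ ni].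
  by apply: red_square; rewrite ?radial ?cross // ltnW.
rewrite telescope_sumr // /x /s mul0r !lerp0 subrr divff ?gt_eqF // !lerp1.
by rewrite (red_int R 0) subr0.
Qed.

Lemma potential_mono theta L o rho rho' psi : rho <= rho' ->
  potential theta L o rho' psi -> potential theta L o rho psi.
Proof. by move=> le h p q op oq; apply: h; apply: le_trans le. Qed.

Lemma potential_segment theta L o rho psi p q : 0 < L ->
  potential theta L o rho psi -> edist o p <= rho -> edist o q <= rho ->
  (forall t, 0 <= t <= 1 -> exists n : int, theta (lerp p q t) = n%:~R) ->
  psi p = psi q.
Proof.
move=> L0 pot op oq th.
apply/esym; rewrite -{1}(lerp1 p q).
apply: (@unit_interval_ind R (fun t => psi (lerp p q t) = psi p)); last by rewrite lerp0.
have inb t : 0 <= t <= 1 -> edist o (lerp p q t) <= rho.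
  by move=> t01; rewrite edistC edist_lerp_le_max // edistC.
have d0 : 0 < edist p q + 1 by rewrite ltr_wpDl ?edist_ge0.
have e0 : 0 < 1 / (8 * L) by rewrite divr_gt0 // mulr_gt0.
move=> t t01; exists (1 / (8 * L) / (edist p q + 1)); first by rewrite divr_gt0.
move=> t' t'01; rewrite ltr_pdivlMr // => tt'.
have -> : psi (lerp p q t') = psi (lerp p q t); last by [].
apply/eqP; rewrite -subr_eq0 (pot _ _ (inb _ t01) (inb _ t'01)); last first.
  by rewrite edist_lerp; apply: le_trans (ltW tt'); rewrite ler_wpM2l // lerDl.
have [n ->] := th t t01; have [n' ->] := th t' t'01.
by rewrite -intrB red_int.
Qed.

End Potential.

Section FaceVertices.
Variables (R : realType) (G : penny_graph R).
Local Notation c := (center G).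
Local Notation adj := (Defs.adj G).
Implicit Types (i j k l : nat) (p q z : R * R) (t e : R) (S : set (R * R)) (A : seq nat).

(* Vanishes on the closed disks of A, equals 1 at distance at least [eta] from them. *)
Definition disk_cutoff (eta : R) A z : R :=
  foldr (fun i r => Num.min (Num.max 0 ((edist z (c i) - 1 / 2) / eta)) r) 1 A.

Lemma lip_min (a a' b b' L : R) : `|a - a'| <= L -> `|b - b'| <= L ->
  `|Num.min a b - Num.min a' b'| <= L.
Proof.
by rewrite !ler_norml => /andP[? ?] /andP[? ?]; apply/andP; case: (leP a b); case: (leP a' b'); split; lra.
Qed.

Lemma lip_max (a a' b b' L : R) : `|a - a'| <= L -> `|b - b'| <= L ->
  `|Num.max a b - Num.max a' b'| <= L.
Proof.
by rewrite !ler_norml => /andP[? ?] /andP[? ?]; apply/andP; case: (leP a b); case: (leP a' b'); split; lra.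
Qed.

Lemma disk_cutoff_lip eta A z w : 0 < eta ->
  `|disk_cutoff eta A z - disk_cutoff eta A w| <= eta^-1 * edist z w.
Proof.
move=> eta0; have L0 : 0 <= eta^-1 * edist z w by rewrite mulr_ge0 ?edist_ge0 // invr_ge0 ltW.
elim: A => [|i A IH] /=; first by rewrite subrr normr0.
apply: lip_min => //; apply: lip_max; first by rewrite subrr normr0.
rewrite -mulrBl normrM mulrC [`|eta^-1|]gtr0_norm ?invr_gt0 //.
apply: ler_wpM2l; first by rewrite invr_ge0 ltW.
have -> : edist z (c i) - 1 / 2 - (edist w (c i) - 1 / 2) = edist z (c i) - edist w (c i) by ring.
have h1 := edist_triangle w z (c i); have h2 := edist_triangle z w (c i).
rewrite (edistC w z) in h2.
by rewrite ler_norml; apply/andP; split; lra.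
Qed.

Lemma disk_cutoff_ge0 eta A z : 0 <= disk_cutoff eta A z.
Proof. by elim: A => [|i A IH] //=; rewrite le_min le_max lexx IH. Qed.

Lemma disk_cutoff0 eta A z i : 0 < eta -> i \in A -> edist z (c i) <= 1 / 2 ->
  disk_cutoff eta A z = 0.
Proof.
move=> eta0 iA zi; apply/le_anti; rewrite disk_cutoff_ge0 andbT.
elim: A iA => [|j A IH] //=; rewrite inE ge_min => /orP[/eqP<-|/IH ->]; last by rewrite orbT.
by rewrite ge_max lexx /= ler_pdivrMr // mul0r subr_le0 zi.
Qed.

Lemma disk_cutoff1 eta A z : 0 < eta ->
  (forall i, i \in A -> 1 / 2 + eta <= edist z (c i)) -> disk_cutoff eta A z = 1.
Proof.
move=> eta0; elim: A => [|j A IH] //= h.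
rewrite IH; last by move=> i iA; apply: h; rewrite inE iA orbT.
apply/min_idPr; rewrite le_max ler_pdivlMr // mul1r; apply/orP; right.
by have := h j (mem_head _ _); lra.
Qed.

(* The vertices of a face cannot be split into two non-adjacent parts: otherwise the cutoff
   of the first part on S, extended by 0, would be Lipschitz mod 1 and hence have a potential
   psi; psi is constant along the connected graph, psi minus the cutoff is constant on S, and
   the cutoff takes the values 0 and 1. *)
Lemma face_vertices_linked S (V : seq nat) (X : pred nat) i0 j0 :
  graph_connected G -> faces G S -> (forall i, face_vertex G S i -> i \in V) ->
  (forall i j, i \in V -> j \in V -> X i -> ~~ X j -> ~~ adj i j) ->
  face_vertex G S i0 -> face_vertex G S j0 -> X i0 -> X j0.
Proof.
move=> conn fS hV sep Vi0 Vj0 Xi0; apply: contrapT => /negP Xj0.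
pose A := [seq i <- V | X i]; pose B := [seq i <- V | ~~ X i].
pose Q (ij : nat * nat) e := 1 + e <= edist (c ij.1) (c ij.2).
(* Two distinct non-adjacent vertices have centers at distance greater than 1; finitely many pairs
   leave a uniform gap [eta] between the closed disks of the two parts. *)
have [||eta eta0 heta] := @uniform_positive R _ [seq (i, j) | i <- A, j <- B] Q.
- by move=> x e e' h e'0 e'e; apply: le_trans h; rewrite lerD2l.
- move=> _ /allpairsP[[i j] /= [iA jB ->]].
  move: iA jB; rewrite !mem_filter => /andP[Xi iV] /andP[Xj jV].
  have ij : i != j by apply: contraNneq Xj => <-.
  exists (edist (c i) (c j) - 1); last by rewrite /Q /= addrC subrK.
  rewrite subr_gt0 lt_neqAle center_dist // andbT eq_sym.
  by have := sep i j iV jV Xi Xj; rewrite /Defs.adj ij.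
pose phi := disk_cutoff eta A.
have phi0 i z : i \in V -> X i -> edist z (c i) <= 1 / 2 -> phi z = 0.
  by move=> iV Xi; apply: disk_cutoff0 => //; rewrite mem_filter Xi.
have phi1 j z : j \in V -> ~~ X j -> edist z (c j) <= 1 / 2 -> phi z = 1.
  move=> jV Xj zj; apply: disk_cutoff1 => // i iA.
  have jB : j \in B by rewrite mem_filter Xj.
  have /= := heta _ (allpairs_f (fun x y => (x, y)) iA jB); rewrite /Q /=.
  have := edist_triangle z (c i) (c j); rewrite (edistC _ z); lra.
have phiV i z : i \in V -> edist z (c i) <= 1 / 2 -> exists n : int, phi z = n%:~R.
  move=> iV zi; have [Xi|Xi] := boolP (X i); first by exists 0; rewrite (phi0 i).
  by exists 1; rewrite (phi1 i).
pose theta z := if `[< S z >] then phi z else 0.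
have thS z : S z -> theta z = phi z by move=> Sz; rewrite /theta asboolT.
have thN z : ~ S z -> theta z = 0 by move=> Sz; rewrite /theta asboolF.
(* A segment leaving [S] does so at a point of the closed disk of some vertex of the face, where the
   cutoff is an integer. Hence extending the cutoff by 0 preserves the Lipschitz bound modulo 1. *)
have cross p q : S p -> ~ S q -> exists n : int, `|phi p - n%:~R| <= eta^-1 * edist p q.
  move=> Sp Sq; have [t [t01 Gt At]] := face_exit fS Sp Sq.
  have [i Si zi] := adherent_face_vertex fS Gt At.
  have [n nE] := phiV i _ (hV _ Si) zi.
  exists n; rewrite -nE; apply: le_trans (disk_cutoff_lip _ _ _ eta0) _.
  apply: ler_wpM2l; first by rewrite invr_ge0 ltW.
  rewrite edistC edist_lerpl.
  by case/andP: t01 => t0 t1; rewrite ger0_norm // ler_piMl ?edist_ge0.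
pose L := eta^-1.
have L0 : 0 < L by rewrite invr_gt0.
have lip p q : `|red (theta p - theta q)| <= L * edist p q.
  have [Sp|Sp] := pselect (S p); have [Sq|Sq] := pselect (S q).
  - rewrite !thS //; apply: le_trans (red_le _ 0) _; rewrite subr0.
    exact: disk_cutoff_lip.
  - have [n hn] := cross p q Sp Sq.
    by rewrite thS // thN // subr0; apply: le_trans hn; exact: red_le.
  - have [n hn] := cross q p Sq Sp.
    rewrite (thN p) // thS // sub0r edistC; apply: le_trans hn.
    by apply: le_trans (red_le _ (- n)) _; rewrite intrN opprK addrC distrC.
  - by rewrite !thN // subr0 (red_int R 0) normr0 mulr_ge0 ?edist_ge0 // ltW.
have [a Sa ai] := (face_vertexP G S i0).1 Vi0.
have [b Sb bj] := (face_vertexP G S j0).1 Vj0.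
(* Nothing bounds [S] at this stage, so the radius depends on the point reached. Quantifying over
   all potentials keeps the claims compatible as the radius grows; a single ball large enough for
   both claims is taken at the end. *)
have [rS hS] : exists rho, forall psi, potential theta L a rho psi ->
    psi b - phi b = psi a - phi a.
  apply: (@connected_locally_constant R S (fun x => exists rho, forall psi,
    potential theta L a rho psi -> psi x - phi x = psi a - phi a) _ _ a) => //.
  - exact: face_connected fS.
  - have e0 : 0 < 1 / (8 * L) by rewrite divr_gt0 // mulr_gt0.
    move=> z Sz; exists (1 / (8 * L)) => // w Sw zw.
    have step x y : S x -> S y -> edist x y <= 1 / (8 * L) ->
      (exists rho, forall psi, potential theta L a rho psi -> psi x - phi x = psi a - phi a) ->
      exists rho, forall psi, potential theta L a rho psi -> psi y - phi y = psi a - phi a.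
      move=> Sx Sy xy [rho hrho].
      exists (Num.max rho (Num.max (edist a x) (edist a y))) => psi pot.
      rewrite -(hrho psi); last by apply: potential_mono pot; rewrite le_max lexx.
      have := pot x y; rewrite !le_max !lexx !orbT => /(_ isT isT xy).
      rewrite !thS // red_small; first by move=> h; rewrite -(subrK (psi x) (psi y)) h; ring.
      apply: le_lt_trans (disk_cutoff_lip _ _ _ eta0) _.
      rewrite -/L edistC; move: xy; rewrite ler_pdivlMr ?mulr_gt0 //; lra.
    by split; apply: step => //; rewrite 1?edistC ltW // edistC.
  - by exists 0.
have graph0 z : embedded_graph G z -> theta z = 0.
  by move=> Gz; apply: thN => /(face_compl fS).
have [w [pw lw]] := conn i0 j0.
have [rG hG] : exists rho, forall psi, potential theta L a rho psi ->
    psi (c i0) = psi (c j0).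
  rewrite -lw; move: (pw); clear - L0 graph0.
  elim: w i0 => [|k w IH] i /=; first by exists 0.
  case/andP=> ik /IH [rho hrho].
  exists (Num.max rho (Num.max (edist a (c i)) (edist a (c k)))) => psi pot.
  rewrite -(hrho psi); last by apply: potential_mono pot; rewrite le_max lexx.
  apply: (potential_segment L0 pot); rewrite ?le_max ?lexx ?orbT //.
  by move=> t t01; exists 0; rewrite graph0 //; exact: edge_in_graph.
pose rho := Num.max (Num.max rS rG) (Num.max (edist a b)
  (Num.max (edist a (c i0)) (edist a (c j0)))).
have [psi pot] := potential_exists a rho L0 lip.
have e1 : psi b - phi b = psi a - phi a.
  by apply: hS; apply: potential_mono pot; rewrite !le_max lexx.
have e2 : psi (c i0) = psi (c j0).
  by apply: hG; apply: potential_mono pot; rewrite !le_max lexx !orbT.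
have disk i z : i \in V -> edist z (c i) <= 1 / 2 -> exists n : int, theta z = n%:~R.
  move=> iV zi; have [Sz|Sz] := pselect (S z); first by rewrite thS //; exact: phiV zi.
  by exists 0; rewrite thN.
have toc i z : i \in V -> edist z (c i) <= 1 / 2 -> edist a z <= rho ->
    edist a (c i) <= rho -> psi z = psi (c i).
  move=> iV zi az ai'; apply: (potential_segment L0 pot) => // t t01.
  apply: disk iV _; apply: edist_lerp_le_max => //; rewrite edistxx; lra.
have rho0 : edist a a <= rho by rewrite edistxx !le_max edist_ge0 !orbT.
have e3 : psi a = psi (c i0).
  by apply: toc; [exact: hV|exact: ltW|exact: rho0|rewrite !le_max lexx !orbT].
have e4 : psi b = psi (c j0).
  by apply: toc; [exact: hV|exact: ltW| |]; rewrite !le_max lexx !orbT.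
have := phi0 i0 a (hV _ Vi0) Xi0 (ltW ai).
have := phi1 j0 b (hV _ Vj0) Xj0 (ltW bj).
move: e1; rewrite e3 e4 e2 => h eb ea; rewrite eb ea in h; lra.
Qed.

End FaceVertices.

(** * Bounded faces make the graph coarsely equivalent to the plane *)

Definition within (e : rel nat) (n x y : nat) : Prop :=
  exists p : seq nat, [/\ path e x p, last x p = y & (size p <= n)%N].

Lemma within_refl e x : within e 0 x x.
Proof. by exists [::]. Qed.

Lemma within_mono e n m x y : (n <= m)%N -> within e n x y -> within e m x y.
Proof. by move=> nm [p [pp lp sp]]; exists p; split=> //; exact: leq_trans sp nm. Qed.

Lemma within_adj (e : rel nat) x y : e x y -> within e 1 x y.
Proof. by move=> exy; exists [:: y]; rewrite /= exy. Qed.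

Lemma within_trans e n m x y z :
  within e n x y -> within e m y z -> within e (n + m) x z.
Proof.
move=> [p [pp lp sp]] [q [pq lq sq]]; exists (p ++ q).
by rewrite cat_path last_cat lp pp pq size_cat leq_add.
Qed.

(* Points of the list V linked by a chain of links of length m inside V are linked by at
   most #V of them, after removing loops. *)
Lemma within_chain (e : rel nat) (m : nat) (V : seq nat) x p :
  path (fun i j => `[< within e m i j >]) x p -> {subset p <= V} ->
  within e (size V * m) x (last x p).
Proof.
move=> pp pV; case/shortenP: pp => q pq uq subq.
have sq : (size q <= size V)%N.
  by apply: uniq_leq_size; [case/andP: uq | move=> i /subq /pV].
apply: (@within_mono _ (size q * m)); first by rewrite leq_mul2r sq orbT.
elim: q x pq {uq subq sq} => [|y q IH] x /=; first by exists [::].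
case/andP=> /asboolP xy /IH yq; rewrite mulSn; exact: within_trans xy yq.
Qed.

Section BoundedFaces.
Variables (R : realType) (G : penny_graph R) (D : nat).
Hypothesis conn : graph_connected G.
Hypothesis bounded_faces : forall S, faces G S -> (facial_degree G S <= D%:R%:E)%E.
Local Notation c := (center G).
Local Notation adj := (Defs.adj G).
Local Notation Gam := (embedded_graph G).
Local Notation within := (within adj).
Implicit Types (i j k l : nat) (p q z : R * R) (t e : R) (S : set (R * R)).

Lemma within_edist n i j : within n i j -> edist (c i) (c j) <= n%:R.
Proof.
case=> p [pp <-]; rewrite -(ler_nat R); apply: le_trans.
elim: p i pp => [|k p IH] i /=; first by rewrite edistxx.
case/andP=> ik /IH h; apply: le_trans (edist_triangle (c k) _ _) _.
by rewrite adj_dist // -natr1 addrC lerD2r.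
Qed.

(** Each vertex of the face contributes at least one corner, so the facial degree bounds the number
    of distinct vertices. *)
Lemma face_vertex_list S : faces G S -> exists V : seq nat,
  [/\ uniq V, (size V <= D)%N & forall i, i \in V <-> face_vertex G S i].
Proof.
move=> fS; apply: finite_list_of_bounded => s us hs.
have /choice[f hf] : forall i, exists a : nat * set (R * R),
    i \in s -> a.1 = i /\ corners G S a.
  move=> i; have [is_|is_] := boolP (i \in s); last by exists (i, set0).
  have [p [Sp Bp]] := hs i is_.
  exists (i, connected_component (open_disk (c i) (1 / 2) `&` S) p) => _.
  by split=> //; exists p.
have inj_f : {in s &, injective f}.
  by move=> i j /hf[fi _] /hf[fj _] fij; rewrite -fi fij fj.
have := bounded_faces fS; rewrite /facial_degree /counting.
case: asboolP => fin; last by [].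
rewrite lee_fin ler_nat; apply: leq_trans.
rewrite -(size_map f); apply: uniq_leq_size; first by rewrite map_inj_in_uniq.
move=> _ /mapP[i is_ ->]; rewrite in_fset_set // inE.
by have [] := hf i is_.
Qed.

(** The set of vertices reachable from [i] by walks inside the vertex list of the face cannot be
    separated from the rest of that list; removing loops then bounds the walk by the length of the
    list. *)
Lemma face_vertices_within S i j : faces G S ->
  face_vertex G S i -> face_vertex G S j -> within D i j.
Proof.
move=> fS Vi Vj; have [V [uV sV hV]] := face_vertex_list fS.
pose X k := `[< exists p : seq nat, [/\ path adj i p, last i p = k & {subset p <= V}] >].
have : X j.
  apply: (@face_vertices_linked R G S V X i j) => //.
  - by move=> k /hV.
  - move=> k l kV lV /asboolP[p [pp lp sp]] /asboolP nX; apply/negP => kl; apply: nX.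
    exists (rcons p l); rewrite rcons_path last_rcons pp lp kl; split=> //.
    by move=> x; rewrite mem_rcons inE => /orP[/eqP->|/sp].
  - by apply/asboolP; exists [::].
case/asboolP=> p [pp <- sp]; case/shortenP: pp => q pq uq subq.
exists q; split=> //; apply: leq_trans sV.
by apply: uniq_leq_size; [case/andP: uq | move=> k /subq /sp].
Qed.

Lemma centers_unbounded (n : nat) : exists k, n%:R < edist (c 0) (c k).
Proof.
apply: contrapT => no.
pose m := ((4 * n + 1) * (4 * n + 1))%N.
have := @ball_packing R G (c 0) n (iota 0 m.+1) (iota_uniq _ _).
rewrite size_iota ltnn => h; suff : false by []; apply: h => i _.
by rewrite leNgt; apply/negP => ni; apply: no; exists i.
Qed.

(** [f] is an affine function dominated by the distance to [c i]. Graph points in the closure of [S]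
    lie within [D + 1 / 2] of [c i], so a segment inside the half-plane [b < f] cannot leave [S]. *)
Lemma face_halfplane S i (b : R) (f : R * R -> R) p q : faces G S ->
  face_vertex G S i -> D%:R + 1 <= b ->
  (forall x y t, f (lerp x y t) = (1 - t) * f x + t * f y) ->
  (forall x, f x <= edist x (c i)) ->
  S p -> b < f p -> b < f q -> S q.
Proof.
move=> fS Vi Db lin fle Sp fp fq; apply: contrapT => Sq.
have [t [t01 Gt At]] := face_exit fS Sp Sq.
have [k Vk zk] := adherent_face_vertex fS Gt At.
have : b < f (lerp p q t).
  rewrite lin; case/andP: t01 => t0 t1.
  have -> : b = (1 - t) * b + t * b by ring.
  have [->|t'] := eqVneq t 0; first by rewrite subr0 !mul0r !mul1r !addr0.
  have tp : 0 < t by rewrite lt_neqAle eq_sym t'.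
  apply: ler_ltD; first by apply: ler_wpM2l; rewrite ?subr_ge0 // ltW.
  by rewrite ltr_pM2l.
have := fle (lerp p q t); have := edist_triangle (c k) (lerp p q t) (c i).
have := within_edist (face_vertices_within fS Vk Vi); lra.
Qed.

(** Excludes unbounded faces. The exterior of the box is a union of four half-planes, each meeting
    its neighbours; a point of [S] there would force the whole exterior into [S], although it
    contains centers. *)
Lemma face_in_box S i p : faces G S -> face_vertex G S i -> S p ->
  `|p.1 - (c i).1| <= D%:R + 1 /\ `|p.2 - (c i).2| <= D%:R + 1.
Proof.
move=> fS Vi Sp; set b : R := D%:R + 1.
pose f1 (x : R * R) := x.1 - (c i).1; pose f2 (x : R * R) := - (x.1 - (c i).1).
pose f3 (x : R * R) := x.2 - (c i).2; pose f4 (x : R * R) := - (x.2 - (c i).2).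
have half f : [\/ f = f1, f = f2, f = f3 | f = f4] -> forall x y, S x -> b < f x -> b < f y -> S y.
  move=> ff x y Sx fx fy; apply: (@face_halfplane S i b f x y) => //.
    by case: ff => -> u v t; rewrite /f1 /f2 /f3 /f4 /lerp /=; ring.
  move=> z; have h1 := coord1_le_edist z (c i); have h2 := coord2_le_edist z (c i).
  move: h1 h2; rewrite !ler_norml => /andP[? ?] /andP[? ?].
  by case: ff => ->; rewrite /f1 /f2 /f3 /f4; lra.
have H1 := half f1 (Or41 _ _ _ erefl); have H2 := half f2 (Or42 _ _ _ erefl).
have H3 := half f3 (Or43 _ _ _ erefl); have H4 := half f4 (Or44 _ _ _ erefl).
apply: contrapT => out.
(* Each of the three points below lies in two of the half-planes and carries membership in [S] from
   one to the other. *)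
pose corner (s s' : R) : R * R := ((c i).1 + s * (b + 1), (c i).2 + s' * (b + 1)).
pose pp := corner 1 1; pose mp := corner (- 1) 1; pose pm := corner 1 (- 1).
have pp1 : b < f1 pp by rewrite /f1 /pp /corner /=; lra.
have pp3 : b < f3 pp by rewrite /f3 /pp /corner /=; lra.
have mp2 : b < f2 mp by rewrite /f2 /mp /corner /=; lra.
have mp3 : b < f3 mp by rewrite /f3 /mp /corner /=; lra.
have pm1 : b < f1 pm by rewrite /f1 /pm /corner /=; lra.
have pm4 : b < f4 pm by rewrite /f4 /pm /corner /=; lra.
have outside x : ~ (`|x.1 - (c i).1| <= b /\ `|x.2 - (c i).2| <= b) ->
    [\/ b < f1 x, b < f2 x, b < f3 x | b < f4 x].
  move=> h; apply: contrapT => h'; apply: h.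
  have hn (u : R) : ~ b < u -> u <= b by move=> /negP; rewrite -leNgt.
  have k1 : f1 x <= b by apply: hn => ?; apply: h'; constructor 1.
  have k2 : f2 x <= b by apply: hn => ?; apply: h'; constructor 2.
  have k3 : f3 x <= b by apply: hn => ?; apply: h'; constructor 3.
  have k4 : f4 x <= b by apply: hn => ?; apply: h'; constructor 4.
  rewrite /f1 in k1; rewrite /f2 in k2; rewrite /f3 in k3; rewrite /f4 in k4.
  by rewrite !ler_norml; split; apply/andP; split; lra.
have Spp : S pp.
  have [h|h|h|h] := outside p out.
  - exact: H1 Sp h pp1.
  - exact: H3 (H2 _ _ Sp h mp2) mp3 pp3.
  - exact: H3 Sp h pp3.
  - exact: H1 (H4 _ _ Sp h pm4) pm1 pp1.
have Smp := H3 _ _ Spp pp3 mp3; have Spm := H1 _ _ Spp pp1 pm1.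
have [n hn] : exists n : nat, edist (c 0) (c i) + 2 * b <= n%:R.
  exists (Num.truncn (edist (c 0) (c i) + 2 * b)).+1.
  by apply/ltW; rewrite truncnS_gt.
have [k hk] := centers_unbounded n.
suff : S (c k) by move/(face_compl fS); apply; exact: center_in_graph.
have /outside[h|h|h|h] : ~ (`|(c k).1 - (c i).1| <= b /\ `|(c k).2 - (c i).2| <= b).
- move=> [h1 h2]; have := edist_le_coord (c k) (c i).
  by have := edist_triangle (c i) (c 0) (c k); rewrite (edistC (c i) (c k)); lra.
- exact: H1 Spp pp1 h.
- exact: H2 Smp mp2 h.
- exact: H3 Spp pp3 h.
- exact: H4 Spm pm4 h.
Qed.

Let rho : nat := (2 * (D + 1))%N.

Lemma face_vertex_dist S i p : faces G S -> face_vertex G S i -> S p ->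
  edist p (c i) <= rho%:R.
Proof.
move=> fS Vi Sp; have [h1 h2] := face_in_box fS Vi Sp.
apply: le_trans (edist_le_coord _ _) _; rewrite /rho natrM natrD; lra.
Qed.

(** Attaches vertices to every point of the plane, so that a straight segment, which runs through
    faces, can be traced by a chain of vertices. The closed disk makes both ends of an edge near
    vertices of its midpoint. *)
Definition near_vertex z i :=
  (Gam z /\ edist z (c i) <= 1 / 2) \/ (~ Gam z /\ face_vertex G (face_of G z) i).

Lemma near_vertex_exists z : exists i, near_vertex z i.
Proof.
have [Gz|nGz] := pselect (Gam z).
  by have [i zi] := graph_near_center Gz; exists i; left.
have fS := face_of_face nGz.
have nS : ~ face_of G z (c 0) by move/(face_compl fS); apply; exact: center_in_graph.
have [t [_ Gt At]] := face_exit fS (face_of_self nGz) nS.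
by have [i Vi _] := adherent_face_vertex fS Gt At; exists i; right.
Qed.

Lemma near_vertex_dist z i : near_vertex z i -> edist z (c i) <= rho%:R.
Proof.
case=> [[_ h]|[nG Vi]]; last exact: face_vertex_dist (face_of_face nG) Vi (face_of_self nG).
by apply: le_trans h _; rewrite /rho natrM natrD; have : 0 <= D%:R :> R by []; lra.
Qed.

Lemma near_vertex_within z i j : near_vertex z i -> near_vertex z j -> within D.+1 i j.
Proof.
case=> [[Gz zi]|[nGz Vi]] [[Gz' zj]|[nGz' Vj]] //.
  have [<-|ij] := eqVneq i j; first by apply: within_mono (within_refl _ _).
  by apply: within_mono (within_adj (touching_disks_adj ij zi zj)).
by apply: within_mono (face_vertices_within (face_of_face nGz) Vi Vj).
Qed.

Lemma near_vertex_local z : exists2 e, 0 < e &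
  forall w, edist z w < e -> exists i, near_vertex z i /\ near_vertex w i.
Proof.
have [Gz|nGz] := pselect (Gam z); last first.
  have fS := face_of_face nGz.
  have [e e0 he] := face_open fS (face_of_self nGz).
  exists e => // w /he Sw; have [i hi] := near_vertex_exists z.
  exists i; split=> //; right; split; first exact: face_compl fS Sw.
  by rewrite -(face_eq fS Sw); case: hi => [[]|[]].
have inner i : edist z (c i) < 1 / 2 -> exists2 e, 0 < e &
    forall w, edist z w < e -> exists i, near_vertex z i /\ near_vertex w i.
  move=> zi; exists (1 / 2 - edist z (c i)); first by rewrite subr_gt0.
  move=> w zw; exists i; split; first by left; split=> //; exact: ltW.
  have wi : edist w (c i) < 1 / 2.
    by apply: le_lt_trans (edist_triangle z _ _) _; rewrite (edistC w); lra.
  have [Gw|nGw] := pselect (Gam w); first by left; split=> //; exact: ltW.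
  right; split=> //; apply/face_vertexP; exists w => //; exact: face_of_self.
case/graphP: (Gz) => [[i zE]|[i [j [t [ij t01 zE]]]]].
  by apply: (inner i); rewrite zE edistxx; lra.
have di : edist z (c i) = t by rewrite zE edist_edge.
have dj : edist z (c j) = 1 - t by rewrite zE edist_edger.
have [th|th|th] := ltgtP t (1 / 2).
- by apply: (inner i); rewrite di; lra.
- by apply: (inner j); rewrite dj; lra.
(* No open disk contains the midpoint. Graph points around it belong to this edge and are near one
   of its ends, and the faces around it have [i] as a vertex. *)
have zm : z = midpoint G i j by rewrite zE /midpoint th.
exists (1 / 10); first lra.
move=> w zw; have [Gw|nGw] := pselect (Gam w).
  have [|s s01 wE] := graph_near_midpoint ij Gw; first by rewrite -zm edistC; lra.
  have [k [kij hk]] := edge_near_end ij s01.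
  exists k; split; left; split=> //; last by rewrite wE.
  by case: kij => ->; rewrite ?di ?dj; lra.
exists i; split; first by left; split=> //; rewrite di; lra.
right; split=> //; apply: (face_near_midpoint (face_of_face nGw) ij (face_of_self nGw)).
by rewrite -zm edistC.
Qed.

(** Near vertices along the segment from [c x] to [c y] form a chain with jumps of length at most
    [D.+1]. The chain stays among the centers within [n + rho] of [c x], so loop removal and the
    packing bound limit its length. *)
Lemma close_centers_within (n : nat) x y : edist (c x) (c y) <= n%:R ->
  within ((4 * (n + rho) + 1) * (4 * (n + rho) + 1) * D.+1) x y.
Proof.
move=> xy; have [V [_ sV hV]] := ball_list G (c x) (n + rho).
pose z t := lerp (c x) (c y) t.
have inV t i : 0 <= t <= 1 -> near_vertex (z t) i -> i \in V.
  move=> t01 zi; apply/hV; apply: le_trans (edist_triangle (z t) _ _) _.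
  rewrite natrD; apply: lerD; last exact: near_vertex_dist.
  rewrite edistC edist_lerpl; case/andP: t01 => t0 t1; rewrite ger0_norm //.
  by apply: le_trans xy; rewrite ler_piMl ?edist_ge0.
pose reach i := exists p : seq nat, [/\ path (fun i j => `[< within D.+1 i j >]) x p,
  last x p = i & {subset p <= V}].
pose P t := exists2 i, near_vertex (z t) i & reach i.
have near_end i : near_vertex (c i) i.
  by left; split; [exact: center_in_graph|rewrite edistxx; lra].
have step t i j : 0 <= t <= 1 -> near_vertex (z t) i -> near_vertex (z t) j ->
    reach i -> reach j.
  move=> t01 zi zj [p [pp lp sp]]; exists (rcons p j).
  rewrite rcons_path last_rcons pp lp; split=> //.
    by apply/asboolP; exact: near_vertex_within zi zj.
  by move=> k; rewrite mem_rcons inE => /orP[/eqP->|/sp //]; exact: inV zj.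
have : P 1.
  apply: (@unit_interval_ind R P); last first.
    by exists x; rewrite /z ?lerp0 //; exists [::].
  have d0 : 0 < edist (c x) (c y) + 1 by rewrite ltr_wpDl ?edist_ge0.
  move=> t t01; have [e e0 he] := near_vertex_local (z t).
  exists (e / (edist (c x) (c y) + 1)); first by rewrite divr_gt0.
  move=> t' t'01; rewrite ltr_pdivlMr // => tt'.
  have [|k [tk t'k]] := he (z t').
    by rewrite edist_lerp; apply: le_lt_trans tt'; rewrite ler_wpM2l // lerDl.
  split=> -[i zi ri]; exists k => //.
    exact: step t01 zi tk ri.
  exact: step t'01 zi t'k ri.
rewrite /P /z lerp1 => -[i yi ri].
have [p [pp <- sp]] : reach y.
  by apply: (step 1 i); rewrite ?lexx ?ler01 // /z lerp1.
apply: within_mono (within_chain pp sp).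
by rewrite leq_mul2r sV orbT.
Qed.

End BoundedFaces.

(* Vertices are placed injectively on the lattice Z^2 by [cell], and every lattice point is
   approximated by a vertex [site]; N bounds all distortions. *)
Record coarse_plane (e : rel nat) (N : nat) (cell : nat -> int * int)
    (site : int * int -> nat) : Prop := CoarsePlane {
  edge_sym : symmetric e;
  cell_injective : injective cell;
  cell_edge : forall x y, e x y ->
    `|(cell x).1 - (cell y).1| <= 2 /\ `|(cell x).2 - (cell y).2| <= 2;
  cell_site : forall z,
    `|(cell (site z)).1 - z.1| <= N%:Z /\ `|(cell (site z)).2 - z.2| <= N%:Z;
  site_step1 : forall z, within e N (site z) (site (z.1 + 1, z.2));
  site_step2 : forall z, within e N (site z) (site (z.1, z.2 + 1));
  site_cell : forall x, within e N x (site (cell x)) }.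

Lemma penny_coarse_plane (R : realType) (D : nat) : exists N : nat,
  forall G : penny_graph R, graph_connected G ->
  (forall S, faces G S -> (facial_degree G S <= D%:R%:E)%E) ->
  exists cell site, coarse_plane (adj G) N cell site.
Proof.
pose rho := (2 * (D + 1))%N; pose n := (2 * rho + 2)%N.
(* [n] exceeds the distance [2 * rho + 1] between the sites of two points at distance at most 1. The
   term [2 * n] makes [N] dominate the displacement [2 * rho] of cells as well. *)
pose N := ((4 * (n + rho) + 1) * (4 * (n + rho) + 1) * D.+1 + 2 * n)%N.
exists N => G conn bf; pose c := center G.
pose pt (z : int * int) : R * R := (z.1%:~R / 2, z.2%:~R / 2).
have /choice[site hs] : forall z, exists i, edist (pt z) (c i) <= rho%:R.
  move=> z; have [i hi] := near_vertex_exists G (pt z).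
  by exists i; exact: (near_vertex_dist conn bf hi).
have close x y : edist (c x) (c y) <= n%:R -> within (adj G) N x y.
  by move=> h; apply: within_mono (close_centers_within conn bf h); rewrite leq_addr.
have nE : n%:R = rho%:R + rho%:R + 2 :> R by rewrite /n natrD natrM; ring.
have sites z w : edist (pt z) (pt w) <= 1 -> within (adj G) N (site z) (site w).
  move=> zw; apply: close.
  have := edist_triangle (pt z) (c (site z)) (c (site w)).
  have := edist_triangle (pt w) (pt z) (c (site w)).
  have := hs z; have := hs w; rewrite (edistC (c (site z)) (pt z)) nE; lra.
have fl (x : R) : `|x - (Num.floor (2 * x))%:~R / 2| <= 1 / 2.
  have /andP[h1 h2] := floor_itv (2 * x); rewrite intrD /= in h2.
  by rewrite ler_norml; apply/andP; split; lra.
exists (@cell R G), site; split.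
- exact: adj_sym.
- exact: cell_inj.
- by move=> x y xy; apply: (@cell_dist R G x y 1); rewrite adj_dist.
- move=> z; have h1 := coord1_le_edist (pt z) (c (site z)).
  have h2 := coord2_le_edist (pt z) (c (site z)); have h := hs z.
  have fz (m : int) : m = Num.floor (2 * (m%:~R / 2) : R).
    by rewrite mulrC divfK // intrKfloor.
  have le : (2 * rho <= N)%N by rewrite /N /n; lia.
  split.
    rewrite distrC {1}(fz z.1); apply: le_trans (_ : (2 * rho)%:Z <= _); last by lia.
    apply: floor_dist; rewrite -mulrBr normrM ger0_norm // natrM ler_pM2l //.
    exact: le_trans h.
  rewrite distrC {1}(fz z.2); apply: le_trans (_ : (2 * rho)%:Z <= _); last by lia.
  apply: floor_dist; rewrite -mulrBr normrM ger0_norm // natrM ler_pM2l //.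
  exact: le_trans h.
- move=> z; apply: sites; apply: le_trans (edist_le_coord _ _) _ => /=.
  rewrite subrr normr0 addr0 intrD -mulrBl opprD addrA subrr sub0r.
  by rewrite mulN1r normrN ger0_norm //; lra.
- move=> z; apply: sites; apply: le_trans (edist_le_coord _ _) _ => /=.
  rewrite subrr normr0 add0r intrD -mulrBl opprD addrA subrr sub0r.
  by rewrite mulN1r normrN ger0_norm //; lra.
- move=> x; apply: close; apply: le_trans (edist_triangle (pt (cell G x)) _ _) _.
  have : edist (c x) (pt (cell G x)) <= 1.
    apply: le_trans (edist_le_coord _ _) _.
    by rewrite /pt /cell /=; have := fl (c x).1; have := fl (c x).2; rewrite /c; lra.
  have : 0 <= rho%:R :> R by [].
  have := hs (cell G x); rewrite nE; lra.
Qed.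

(** * Determinants of quadratic forms *)

Section QuadraticForms.
Variable R : realType.

Definition qform n (A : 'M[R]_n) (x : 'rV[R]_n) : R := (x *m A *m x^T) 0 0.

Definition posdef n (A : 'M[R]_n) := A^T = A /\ forall x, x != 0 -> 0 < qform A x.

Lemma qform_ge0 n (A : 'M[R]_n) x : posdef A -> 0 <= qform A x.
Proof.
case=> _ pA; have [->|/pA/ltW//] := eqVneq x 0.
by rewrite /qform !mul0mx mxE.
Qed.

Lemma qform_mul n m (E : 'M[R]_(m, n)) (A : 'M[R]_n) x :
  qform (E *m A *m E^T) x = qform A (x *m E).
Proof. by rewrite /qform trmx_mul !mulmxA. Qed.

Section Schur.
Variables (n : nat) (A : 'M[R]_(1 + n)).
Hypothesis pA : posdef A.
Let C := drsubmx A.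
Let b := ursubmx A.

Lemma posdef_tail_qform x : qform A (row_mx 0 x) = qform C x.
Proof.
rewrite /qform -{1}[A]submxK mul_row_block tr_row_mx mul_row_col.
by rewrite !mul0mx trmx0 !mulmx0 !add0r.
Qed.

Lemma posdef_tail : posdef C.
Proof.
case: pA => symA pos; split; first by rewrite trmx_drsub symA.
move=> x x0; rewrite -posdef_tail_qform; apply: pos.
by apply: contraNneq x0 => /(congr1 rsubmx); rewrite row_mxKr => ->; rewrite linear0.
Qed.

Hypothesis uC : C \in unitmx.

(** The minimiser of the form among vectors with first coordinate 1; the minimum is the Schur
    complement of the tail block. *)
Definition schur_vector : 'rV[R]_(1 + n) := row_mx 1%:M (- (b *m invmx C)).

Lemma schur_vector_mul :
  schur_vector *m A = row_mx (qform A schur_vector)%:M 0.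
Proof.
have e : schur_vector *m A = row_mx (ulsubmx A - b *m invmx C *m dlsubmx A) 0.
  rewrite /schur_vector -{1}[A]submxK mul_row_block !mul1mx -/C -/b.
  by rewrite !mulNmx (mulmxKV uC) subrr.
rewrite e; congr row_mx; rewrite /qform e /schur_vector tr_row_mx mul_row_col.
by rewrite mul0mx addr0 trmx1 mulmx1 [LHS]mx11_scalar.
Qed.

Lemma schur_det : \det A = qform A schur_vector * \det C.
Proof.
pose T : 'M[R]_(1 + n) := block_mx 1%:M (- (b *m invmx C)) 0 1%:M.
have dT : \det T = 1 by rewrite det_ublock !det1 mulr1.
have TA : T *m A = block_mx (qform A schur_vector)%:M 0 (dlsubmx A) C.
  have : T *m A = col_mx (schur_vector *m A) (row_mx 0 1%:M *m A).
    by rewrite -mul_col_mx.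
  move=> ->; rewrite schur_vector_mul block_mxEv; congr col_mx.
  by rewrite -{1}[A]submxK mul_row_block !mul0mx !mul1mx !add0r.
by rewrite -[LHS]mul1r -dT -det_mulmx TA det_lblock det_scalar1.
Qed.

Lemma schur_min (v : 'rV[R]_n) : qform A schur_vector <= qform A (row_mx 1%:M v).
Proof.
set y := schur_vector; pose w := v + b *m invmx C.
have -> : row_mx 1%:M v = y + row_mx 0 w.
  by rewrite /y /schur_vector add_row_mx addr0 /w addrCA addNr addr0.
have cross : y *m A *m (row_mx 0 w)^T = 0.
  by rewrite schur_vector_mul tr_row_mx mul_row_col trmx0 mulmx0 mul0mx addr0.
have cross' : row_mx 0 w *m A *m y^T = 0.
  by case: pA => symA _; apply: trmx_inj; rewrite !trmx_mul trmxK symA mulmxA cross trmx0.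
have -> : qform A (y + row_mx 0 w) = qform A y + qform C w.
  rewrite -posdef_tail_qform /qform mulmxDl linearD /= mulmxDl !mulmxDr cross cross'.
  by rewrite addr0 add0r mxE.
by rewrite lerDl qform_ge0 //; exact: posdef_tail.
Qed.

Lemma schur_pos : 0 < qform A schur_vector.
Proof.
case: pA => _; apply; apply/eqP => /(congr1 lsubmx); rewrite row_mxKl linear0.
by move/matrixP/(_ 0 0)/eqP; rewrite !mxE eqxx /= oner_eq0.
Qed.

End Schur.

Lemma posdef_det n (A : 'M[R]_n) : posdef A -> 0 < \det A.
Proof.
elim: n A => [|n IH] A pA; first by rewrite det_mx00.
have d := IH _ (posdef_tail (A := A) pA).
have uC : drsubmx (A : 'M[R]_(1 + n)) \in unitmx by rewrite unitmxE unitfE gt_eqF.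
by rewrite (schur_det uC) mulr_gt0 // schur_pos.
Qed.

(** By [schur_det] a determinant is a product of successive minima over vectors with leading
    coordinate 1. At each stage the minimum for [A] is at most the value of [A] at the minimiser for
    [B], to which the hypothesis on that tail applies. *)
Lemma det_le_prod n (A B : 'M[R]_n) (w : 'I_n -> R) : posdef A -> posdef B ->
  (forall i, 0 <= w i) ->
  (forall (i : 'I_n) (x : 'rV[R]_n), (forall j : 'I_n, (j < i)%N -> x 0 j = 0) ->
     qform A x <= w i * qform B x) ->
  \det A <= (\prod_i w i) * \det B.
Proof.
elim: n A B w => [|n IH] A B w pA pB w0 h; first by rewrite !det_mx00 big_ord0 mulr1.
have pCA := posdef_tail (A := A) pA; have pCB := posdef_tail (A := B) pB.
have dA := posdef_det pCA; have dB := posdef_det pCB.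
have uA : drsubmx (A : 'M[R]_(1 + n)) \in unitmx by rewrite unitmxE unitfE gt_eqF.
have uB : drsubmx (B : 'M[R]_(1 + n)) \in unitmx by rewrite unitmxE unitfE gt_eqF.
rewrite (schur_det uA) (schur_det uB) big_ord_recl mulrACA.
apply: ler_pM; [exact/ltW/(schur_pos pA)|exact: ltW| |].
  apply: le_trans (schur_min pA uA _) _.
  exact: h.
apply: IH => // i x x0; rewrite -!posdef_tail_qform; apply: h => j.
case: (@split_ordP 1 n j) => k -> jk.
  have : (row_mx 0 x : 'rV[R]_(1 + n)) 0 (lshift n k) = 0 by rewrite row_mxEl mxE.
  exact.
have : (row_mx 0 x : 'rV[R]_(1 + n)) 0 (rshift 1 k) = 0 by rewrite row_mxEr x0.
exact.
Qed.

Lemma det_le_codim N M (A B : 'M[R]_N) (W : 'M[R]_(N, M)) (eta : R) :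
  posdef A -> posdef B -> 0 < eta -> eta <= 1 ->
  (forall x, qform A x <= qform B x) ->
  (forall x, x *m W = 0 -> qform A x <= eta * qform B x) ->
  \det A <= eta ^+ (N - M) * \det B.
Proof.
move=> pA pB eta0 eta1 AB ABW.
pose K := kermx W; pose m := \rank K.
have mN : (m <= N)%N by exact: rank_leq_row.
have NMm : (N - M <= m)%N by rewrite /m /K mxrank_ker leq_sub2l // rank_leq_col.
(* The first [m] rows of [row_ebase K] span the kernel; reversing the order puts them last, where
   [det_le_prod] expects the subspace. The change of basis multiplies both determinants by the same
   positive square. *)
pose E := row_ebase K; pose s := perm (@rev_ord_inj N).
pose E' := row_perm s E.
have uE' : E' \in unitmx by rewrite /E' row_permE unitmx_mul unitmx_perm row_ebase_unit.
have inK (x : 'rV[R]_N) : (forall j : 'I_N, (j < N - m)%N -> x 0 j = 0) -> x *m E' *m W = 0.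
  move=> x0; apply/sub_kermxP; rewrite -/K.
  have -> : x *m E' = col_perm s^-1 x *m pid_mx m *m E.
    have -> : x *m E' = col_perm s^-1 x *m E.
      by rewrite /E' row_permE col_permE mulmxA invgK.
    congr (_ *m E); apply/rowP => j; rewrite [RHS]mxE (bigD1 j) //= big1 ?addr0.
      rewrite !mxE eqxx /=; have [jm|jm] := ltnP j m; first by rewrite mulr1.
      rewrite mulr0 x0 //.
      have -> : (s^-1)%g j = rev_ord j.
        by apply: (@perm_inj _ s); rewrite permKV permE rev_ordK.
      by rewrite /=; have := ltn_ord j; lia.
    by move=> i ij; rewrite !mxE val_eqE (negbTE ij) /= mulr0.
  rewrite -mulmxA; apply: mulmx_sub.
  have -> : pid_mx m *m E = invmx (col_ebase K) *m K.
    by rewrite -{2}(mulmx_ebase K) !mulmxA mulVmx ?col_ebase_unit // mul1mx.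
  exact: submxMl.
pose w (i : 'I_N) := if (N - m <= i)%N then eta else 1.
have pE (X : 'M[R]_N) : posdef X -> posdef (E' *m X *m E'^T).
  case=> sX pX; split; first by rewrite !trmx_mul trmxK sX mulmxA.
  move=> x x0; rewrite qform_mul pX //; apply: contraNneq x0 => e.
  by rewrite -(mulmxK uE' x) e mul0mx.
have := @det_le_prod N _ _ w (pE A pA) (pE B pB).
have prodw : \prod_i w i = eta ^+ m.
  rewrite (bigID (fun i : 'I_N => (N - m <= i)%N)) /=.
  rewrite [X in _ * X]big1 ?mulr1; last by move=> i /negbTE h; rewrite /w h.
  rewrite (eq_bigr (fun=> eta)); last by move=> i h; rewrite /w h.
  rewrite prodr_const; congr (_ ^+ _).
  rewrite -sum1_card.
  have -> : (\sum_(i in [pred i : 'I_N | N - m <= i]) 1 =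
             \sum_(0 <= i < N | N - m <= i) 1)%N by rewrite big_mkord.
  rewrite (big_cat_nat _ (n := (N - m)%N)) ?leq_subr //=.
  rewrite big_nat_cond big1 ?add0n; last by move=> i /andP[/andP[_ h1]]; lia.
  rewrite big_nat_cond (eq_bigl (fun i => (N - m <= i < N)%N)) -?big_nat.
    by rewrite sum_nat_const_nat muln1 subKn.
  by move=> i /=; case: (leqP (N - m) i); rewrite ?andbT ?andbF.
rewrite prodw !det_mulmx det_tr => h.
have {h} : \det E' * \det A * \det E' <= eta ^+ m * (\det E' * \det B * \det E').
  apply: h => [i|i x x0]; first by rewrite /w; case: ifP => _; rewrite ?ler01 // ltW.
  rewrite !qform_mul /w; case: ifP => h; last by rewrite mul1r AB.
  by apply: ABW; apply: inK => j jm; apply: x0; apply: leq_trans jm h.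
have dE : 0 < \det E' * \det E'.
  by rewrite -expr2 lt_neqAle sqr_ge0 andbT eq_sym sqrf_eq0 -unitfE -unitmxE.
have -> : \det E' * \det A * \det E' = \det E' * \det E' * \det A by ring.
have comm (u : R) : u * (\det E' * \det B * \det E') =
    \det E' * \det E' * (u * \det B) by ring.
rewrite comm.
rewrite ler_pM2l // => /le_trans; apply.
apply: ler_wpM2r; first exact/ltW/posdef_det.
by apply: ler_wiXn2l => //; exact: ltW.
Qed.

Lemma det_upper_bound N (A : 'M[R]_N) (a : R) : (forall i j, `|A i j| <= a) ->
  \det A <= (N`!)%:R * a ^+ N.
Proof.
move=> h; apply: le_trans (ler_norm _) _; apply: le_trans (ler_norm_sum _ _ _) _.
apply: (@le_trans _ _ (\sum_(s : 'S_N) a ^+ N)).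
  apply: ler_sum => s _; rewrite normrM normrX normrN1 expr1n mul1r normr_prod.
  rewrite -[X in a ^+ X]card_ord -prodr_const; apply: ler_prod => i _.
  by rewrite normr_ge0 h.
by rewrite sumr_const card_Sn mulr_natl.
Qed.

End QuadraticForms.

(** * Subspaces as row spaces, and linear independence on finite sets *)

Section Subspaces.
Variable R : realType.

Lemma subspace_matrix N (P : 'rV[R]_N -> Prop) : P 0 ->
  (forall a u v, P u -> P v -> P (a *: u + v)) ->
  exists A : 'M[R]_N, forall v, (v <= A)%MS <-> P v.
Proof.
move=> P0 PL.
pose Q n := `[< exists A : 'M[R]_N, \rank A = n /\ forall v : 'rV[R]_N, (v <= A)%MS -> P v >].
have exQ : exists n, Q n.
  by exists 0%N; apply/asboolP; exists 0; rewrite mxrank0; split=> // v; rewrite submx0 => /eqP ->.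
have ubQ n : Q n -> (n <= N)%N by move=> /asboolP[A [<- _]]; exact: rank_leq_row.
have [n /asboolP[A [rA PA]] maxn] := ex_maxnP exQ ubQ.
exists A => v; split; first exact: PA.
move=> Pv; apply: contrapT => /negP nvA.
have : Q (\rank (A + v)%MS).
  apply/asboolP; exists (A + v)%MS; split=> // u /sub_addsmxP[[u1 u2] ->] /=.
  rewrite [u2 *m v](_ : _ = u2 0 0 *: v); last first.
    by rewrite [u2]mx11_scalar mul_scalar_mx !mxE eqxx mulr1n.
  by rewrite addrC; apply: PL => //; apply: PA; exact: submxMl.
move/maxn; rewrite -rA leqNgt => /negP; apply.
by apply: rank_ltmx; rewrite /ltmx addsmxSl /= addsmx_sub submx_refl.
Qed.

(** The ranks of the truncated value matrices are bounded, and a truncation of maximal rank already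
    detects every relation. This makes Gram matrices on large balls positive definite. *)
Lemma free_on_finite_set N (f : 'I_N -> nat -> R) :
  (forall a : 'rV[R]_N, (forall x, \sum_i a 0 i * f i x = 0) -> a = 0) ->
  exists M : nat, forall a : 'rV[R]_N,
    (forall x, (x < M)%N -> \sum_i a 0 i * f i x = 0) -> a = 0.
Proof.
move=> free.
pose F M : 'M[R]_(N, M) := \matrix_(i, x) f i x.
pose Q n := `[< exists M, \rank (F M) = n >].
have exQ : exists n, Q n by exists (\rank (F 0%N)); apply/asboolP; exists 0%N.
have ubQ n : Q n -> (n <= N)%N by move=> /asboolP[M <-]; exact: rank_leq_row.
have [n /asboolP[M rM] maxn] := ex_maxnP exQ ubQ.
have FE M' (a : 'rV[R]_N) : (forall x, (x < M')%N -> \sum_i a 0 i * f i x = 0) <->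
    (a <= kermx (F M'))%MS.
  split=> [h|/sub_kermxP h x xM].
    apply/sub_kermxP/rowP => x; rewrite !mxE -[RHS](h x (ltn_ord x)).
    by apply: eq_bigr => i _; rewrite mxE.
  move/rowP/(_ (Ordinal xM)): h; rewrite !mxE => h; rewrite -[RHS]h.
  by apply: eq_bigr => i _; rewrite mxE.
exists M => a ha; apply: contrapT => a0; apply: a0; apply: free => x.
apply: contrapT => fx; have xM : (M <= x)%N.
  by rewrite leqNgt; apply/negP => /ha.
have : Q (\rank (F x.+1)) by apply/asboolP; exists x.+1.
move/maxn; rewrite -rM leqNgt => /negP; apply.
have lt : (kermx (F x.+1) < kermx (F M))%MS.
  rewrite /ltmx; apply/andP; split.
    apply/rV_subP => v /FE h; apply/FE => y yM; apply: h; lia.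
  apply/negP => sub; apply: fx; have /FE := ha => /submx_trans/(_ sub)/FE; exact.
have := rank_ltmx lt; rewrite !mxrank_ker.
have := rank_leq_row (F M); have := rank_leq_row (F x.+1); lia.
Qed.

End Subspaces.

(** * Sums over neighbours *)

Section TotalSums.
Variable R : realType.

(** Expresses that a sum over a possibly infinite set is at most [b] without series; it is applied
    to nonnegative functions. *)
Definition total_le (T : eqType) (f : T -> R) (b : R) : Prop :=
  forall s : seq T, uniq s -> \sum_(x <- s) f x <= b.

Lemma total_leD (T : eqType) (f g : T -> R) a b :
  total_le f a -> total_le g b -> total_le (fun x => f x + g x) (a + b).
Proof. by move=> hf hg s us; rewrite big_split lerD ?hf ?hg. Qed.

Lemma total_le_ge0 (T : eqType) (f : T -> R) b : total_le f b -> 0 <= b.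
Proof. by move=> /(_ [::] isT); rewrite big_nil. Qed.

Lemma total_le_comp (T U : eqType) (F : T -> U) (m : nat) (f : U -> R) b :
  (forall u, 0 <= f u) ->
  (forall u (s : seq T), uniq s -> (forall t, t \in s -> F t = u) -> (size s <= m)%N) ->
  total_le f b -> total_le (f \o F) (m%:R * b).
Proof.
move=> f0 hm hf s us.
have -> : \sum_(x <- s) (f \o F) x =
    \sum_(u <- undup (map F s)) (count (fun t => F t == u) s)%:R * f u.
  have -> : \sum_(x <- s) (f \o F) x = \sum_(x <- s) \sum_(u <- undup (map F s))
      (if F x == u then f u else 0).
    rewrite big_seq [RHS]big_seq; apply: eq_bigr => x xs.
    rewrite (bigD1_seq (F x)) ?undup_uniq ?mem_undup ?map_f //= eqxx big1 ?addr0 //.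
    by move=> u /negbTE; rewrite eq_sym => ->.
  rewrite exchange_big /=; apply: eq_bigr => u _.
  by rewrite -big_mkcond big_const_seq iter_addr_0 mulr_natl.
apply: (@le_trans _ _ (\sum_(u <- undup (map F s)) m%:R * f u)).
  apply: ler_sum => u _; apply: ler_wpM2r => //; rewrite ler_nat -size_filter.
  by apply: (hm u); [exact: filter_uniq | move=> t; rewrite mem_filter => /andP[/eqP]].
by rewrite -mulr_sumr ler_wpM2l // hf // undup_uniq.
Qed.

Lemma sum_subseq_le (T : eqType) (f : T -> R) (s t : seq T) :
  (forall x, 0 <= f x) -> uniq s -> uniq t -> {subset s <= t} ->
  \sum_(x <- s) f x <= \sum_(x <- t) f x.
Proof.
move=> f0 us ut st; rewrite [leRHS](bigID (mem s)) /=.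
have -> : \sum_(x <- t | x \in s) f x = \sum_(x <- s) f x.
  rewrite -big_filter; apply: perm_big; apply: uniq_perm => //; first exact: filter_uniq.
  by move=> x; rewrite mem_filter; case: (boolP (x \in s)) => // /st ->.
by rewrite lerDl sumr_ge0.
Qed.

Lemma total_le_supp (f : nat -> R) (M : nat) : (forall x, 0 <= f x) ->
  (forall x, (M <= x)%N -> f x = 0) -> total_le f (\sum_(x < M) f x).
Proof.
move=> f0 supp s us; rewrite (bigID (fun x => (x < M)%N)) /= [X in _ + X]big1 ?addr0.
  rewrite -big_filter -(big_mkord xpredT) /=.
  apply: sum_subseq_le; rewrite ?filter_uniq ?iota_uniq //.
  by move=> x; rewrite mem_filter mem_index_iota => /andP[].
by move=> x; rewrite -leqNgt => /supp.
Qed.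

Lemma total_le_prefix (f : nat -> R) (M : nat) b :
  total_le f b -> \sum_(x < M) f x <= b.
Proof. by move=> h; rewrite -(big_mkord xpredT) h // iota_uniq. Qed.

End TotalSums.

Section NeighbourSums.
Variables (R : realType) (e : rel nat) (N : nat) (cell : nat -> int * int)
  (site : int * int -> nat).
Hypothesis cp : coarse_plane e N cell site.
Implicit Types (x y z M : nat) (F : nat -> R) (H : nat -> nat -> R).

Lemma box_bound (a : int * int) (n : nat) :
  exists M, forall x, in_box a n (cell x) -> (x < M)%N.
Proof.
have [s [_ _ hs]] := @finite_list_of_bounded nat (fun x => in_box a n (cell x)) (n * n)
  (fun s us hs => box_packing (cell_injective cp) us hs).
exists (\max_(x <- s) x).+1 => x /hs xs; rewrite ltnS.
exact: (@leq_bigmax_seq _ s xpredT id x).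
Qed.

Lemma edge_box x y : e x y -> in_box ((cell x).1 - 2, (cell x).2 - 2) 5 (cell y).
Proof.
move=> /(cell_edge cp); case: (cell x) (cell y) => x1 x2 [y1 y2] /= [h1 h2].
by apply/and4P; split=> /=; lia.
Qed.

(** The 25 recurring in the estimates: neighbours have their cells in a 5 by 5 box. *)
Lemma degree_bound x (s : seq nat) : uniq s -> (forall y, y \in s -> e x y) ->
  (size s <= 25)%N.
Proof.
move=> us hs; apply: (box_packing (n := 5) (cell_injective cp) us) => y /hs.
exact: edge_box.
Qed.

Lemma neighbour_bound x : exists M, forall y, e x y -> (y < M)%N.
Proof.
have [M hM] := box_bound ((cell x).1 - 2, (cell x).2 - 2) 5.
by exists M => y /edge_box; exact: hM.
Qed.

Lemma neighbours_bound (s : seq nat) :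
  exists M, forall x y, x \in s -> e x y -> (y < M)%N.
Proof.
elim: s => [|x s [M hM]]; first by exists 0%N.
have [M' hM'] := neighbour_bound x.
exists (maxn M M') => x' y; rewrite inE leq_max => /orP[/eqP->|/hM h /h ->//].
by move=> /hM' ->; rewrite orbT.
Qed.

Definition nsum F x : R := \sum_(y \in [set y | e x y]) F y.

Lemma nsumE F x M : (forall y, e x y -> (y < M)%N) ->
  nsum F x = \sum_(y < M) (e x y)%:R * F y.
Proof.
move=> hM; rewrite /nsum (fsbigE [seq y <- iota 0 M | e x y]) /=.
- rewrite big_filter_cond -(big_mkord xpredT (fun y => (e x y)%:R * F y)).
  rewrite /index_iota subn0 [LHS]big_mkcond; apply: eq_bigr => y _.
  have -> : (y \in [set y | e x y]) = e x y by apply/idP/idP; rewrite inE.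
  by case: (e x y); rewrite ?mul1r ?mul0r.
- by rewrite filter_uniq // iota_uniq.
- by move=> y /=; rewrite mem_filter => /andP[].
- by move=> y /= exy; rewrite mem_filter exy mem_iota /= add0n hM.
Qed.

Lemma nsum_ge0 F x : (forall y, 0 <= F y) -> 0 <= nsum F x.
Proof.
move=> F0; have [M hM] := neighbour_bound x.
by rewrite (nsumE _ hM) sumr_ge0 // => y _; rewrite mulr_ge0.
Qed.

Lemma nsum_ge_term F x y : (forall y, 0 <= F y) -> e x y -> F y <= nsum F x.
Proof.
move=> F0 exy; have [M hM] := neighbour_bound x.
rewrite (nsumE _ hM) (bigD1 (Ordinal (hM _ exy))) //= exy mul1r lerDl.
by rewrite sumr_ge0 // => z _; rewrite mulr_ge0.
Qed.

(** Sum over the closed neighbourhood. The [n]-th iterate dominates the values of a nonnegative [F]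
    at all vertices reached in [n] steps, while totals grow by at most [26 ^ n], that is 1 + 25 for
    each iteration. *)
Definition spread F x := F x + nsum F x.

Lemma spread_ge F x : (forall y, 0 <= F y) -> F x <= spread F x.
Proof. by move=> F0; rewrite lerDl nsum_ge0. Qed.

Lemma spread_ge0 F x : (forall y, 0 <= F y) -> 0 <= spread F x.
Proof. by move=> F0; rewrite addr_ge0 // nsum_ge0. Qed.

Lemma sum_edges_le y (s : seq nat) : uniq s -> \sum_(x <- s) (e x y)%:R <= 25%:R :> R.
Proof.
move=> us; have -> : \sum_(x <- s) (e x y)%:R = (size [seq x <- s | e y x])%:R :> R.
  rewrite size_filter -sum1_count natr_sum [RHS]big_mkcond; apply: eq_bigr => x _.
  by rewrite (edge_sym cp); case: (e y x).
rewrite ler_nat; apply: (degree_bound (x := y)); first by rewrite filter_uniq.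
by move=> x; rewrite mem_filter => /andP[].
Qed.

Lemma degree_sum_le x M : \sum_(y < M) (e x y)%:R <= 25%:R :> R.
Proof.
have -> : \sum_(y < M) (e x y)%:R = \sum_(y <- iota 0 M) (e y x)%:R :> R.
  rewrite -(big_mkord xpredT (fun y => (e x y)%:R)) /index_iota subn0.
  by apply: eq_bigr => y _; rewrite (edge_sym cp).
exact: sum_edges_le (iota_uniq _ _).
Qed.

Lemma total_le_spread F b : (forall x, 0 <= F x) ->
  total_le F b -> total_le (spread F) (26%:R * b).
Proof.
move=> F0 hF; rewrite (_ : 26%:R * b = b + 25%:R * b); last by rewrite -addn1 natrD; ring.
apply: total_leD => // s us; have [M hM] := neighbours_bound s.
have -> : \sum_(x <- s) nsum F x = \sum_(y < M) F y * \sum_(x <- s) (e x y)%:R.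
  rewrite big_seq (eq_bigr (fun x => \sum_(y < M) (e x y)%:R * F y)); last first.
    by move=> x xs; apply: nsumE => y; exact: hM.
  rewrite -big_seq exchange_big /=; apply: eq_bigr => y _.
  by rewrite mulr_sumr; apply: eq_bigr => x _; rewrite mulrC.
apply: (@le_trans _ _ (\sum_(y < M) 25%:R * F y)).
  by apply: ler_sum => y _; rewrite mulrC ler_wpM2r // sum_edges_le.
by rewrite -mulr_sumr ler_wpM2l // total_le_prefix.
Qed.

Definition spread_iter n F := iter n spread F.

Lemma spread_iter_ge0 n F : (forall y, 0 <= F y) -> forall x, 0 <= spread_iter n F x.
Proof. by move=> F0; elim: n => //= n IH x; exact: spread_ge0. Qed.

Lemma spread_iter_ge n F x : (forall y, 0 <= F y) -> F x <= spread_iter n F x.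
Proof.
move=> F0; elim: n => //= n IH; apply: le_trans IH _.
by apply: spread_ge; exact: spread_iter_ge0.
Qed.

Lemma total_le_spread_iter n F b : (forall x, 0 <= F x) ->
  total_le F b -> total_le (spread_iter n F) (26%:R ^+ n * b).
Proof.
move=> F0 hF; elim: n => [|n IH]; first by rewrite mul1r.
rewrite exprS -mulrA; apply: total_le_spread => // x; exact: spread_iter_ge0.
Qed.

Definition grad2 (g : nat -> R) x := nsum (fun y => (g x - g y) ^+ 2) x.

Lemma grad2_ge0 g x : 0 <= grad2 g x.
Proof. by apply: nsum_ge0 => y; exact: sqr_ge0. Qed.

(** Each step of the walk costs a factor 2, from [(a + b) ^ 2 <= 2 a ^ 2 + 2 b ^ 2], and one spread
    moves the gradient seen at the next vertex back to [x]. *)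
Lemma within_grad2 n g x y : within e n x y ->
  (g x - g y) ^+ 2 <= 2 ^+ n * spread_iter n (grad2 g) x.
Proof.
elim: n x => [|n IH] x.
  by case=> -[|? ?] [] //= _ <- _; rewrite subrr expr0n mul1r grad2_ge0.
have g0 := grad2_ge0 g.
case=> [[|x1 p] [/= pp lp sp]].
  by rewrite -lp subrr expr0n mulr_ge0 ?exprn_ge0 //; exact: (spread_iter_ge0 n.+1).
case/andP: pp => xx1 pp.
have {}IH : (g x1 - g y) ^+ 2 <= 2 ^+ n * spread_iter n (grad2 g) x1.
  by apply: IH; exists p.
have h1 : (g x - g x1) ^+ 2 <= spread_iter n (grad2 g) x.
  apply: le_trans (spread_iter_ge n x g0).
  by apply: (nsum_ge_term (F := fun y => (g x - g y) ^+ 2)) => // z; exact: sqr_ge0.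
have h2 : spread_iter n (grad2 g) x1 <= nsum (spread_iter n (grad2 g)) x.
  by apply: nsum_ge_term => // z; exact: spread_iter_ge0.
have h3 : (g x - g y) ^+ 2 <= 2 * (g x - g x1) ^+ 2 + 2 * (g x1 - g y) ^+ 2.
  by have := sqr_ge0 (g x - g x1 - (g x1 - g y)); lra.
apply: le_trans h3 _; rewrite /= /spread -/(spread_iter n _) [2 ^+ n.+1]exprS -mulrA mulrDr.
have p1 : 1 <= 2 ^+ n :> R by rewrite exprn_ege1 //; lra.
have h4 : spread_iter n (grad2 g) x <= 2 ^+ n * spread_iter n (grad2 g) x.
  by rewrite ler_peMl // spread_iter_ge0.
have h5 : 2 ^+ n * spread_iter n (grad2 g) x1 <= 2 ^+ n * nsum (spread_iter n (grad2 g)) x.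
  by rewrite ler_wpM2l // exprn_ge0.
lra.
Qed.

(** Every undirected edge is counted in both orientations, hence the factor 2 in [energy_identity].
    Truncation at [M] is harmless once [M] bounds the neighbours of the support. *)
Definition esum2 M (H : nat -> nat -> R) : R := \sum_(x < M) \sum_(y < M) (e x y)%:R * H x y.

Lemma esum2_sym M H : esum2 M H = esum2 M (fun x y => H y x).
Proof.
rewrite /esum2 exchange_big /=; apply: eq_bigr => y _; apply: eq_bigr => x _.
by rewrite (edge_sym cp).
Qed.

Lemma esum2_le M H H' : (forall x y, (x < M)%N -> (y < M)%N -> e x y -> H x y <= H' x y) ->
  esum2 M H <= esum2 M H'.
Proof.
move=> h; apply: ler_sum => x _; apply: ler_sum => y _.
by case: (boolP (e x y)) => [exy|_]; rewrite ?mul0r // !mul1r h.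
Qed.

Lemma esum2_eq M H H' : (forall x y, e x y -> H x y = H' x y) ->
  esum2 M H = esum2 M H'.
Proof. by move=> h; apply/le_anti/andP; split; apply: esum2_le => x y _ _ /h ->. Qed.

Lemma esum2D M H H' : esum2 M (fun x y => H x y + H' x y) = esum2 M H + esum2 M H'.
Proof.
rewrite /esum2 -big_split; apply: eq_bigr => x _; rewrite -big_split.
by apply: eq_bigr => y _; rewrite mulrDr.
Qed.

Lemma esum2Z M a H : esum2 M (fun x y => a * H x y) = a * esum2 M H.
Proof.
rewrite /esum2 mulr_sumr; apply: eq_bigr => x _; rewrite mulr_sumr.
by apply: eq_bigr => y _; rewrite mulrCA.
Qed.

Lemma esum2_ge0 M H : (forall x y, 0 <= H x y) -> 0 <= esum2 M H.
Proof. by move=> h; apply: sumr_ge0 => x _; apply: sumr_ge0 => y _; rewrite mulr_ge0. Qed.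

Lemma esum2_left_le M (g : nat -> R) : (forall x, 0 <= g x) ->
  esum2 M (fun x _ => g x) <= 25%:R * \sum_(x < M) g x.
Proof.
move=> g0; rewrite mulr_sumr; apply: ler_sum => x _.
rewrite -mulr_suml ler_wpM2r //.
exact: degree_sum_le.
Qed.

Definition glap (h : nat -> R) x := nsum (fun y => h y - h x) x.

Lemma glap_sum M (phi h : nat -> R) :
  (forall x y, phi x != 0 -> e x y -> (y < M)%N) ->
  \sum_(x < M) phi x * glap h x = esum2 M (fun x y => phi x * (h y - h x)).
Proof.
move=> hM; apply: eq_bigr => x _.
have [->|px] := eqVneq (phi x) 0.
  by rewrite mul0r big1 // => y _; rewrite mul0r mulr0.
rewrite /glap (nsumE _ (hM x ^~ px)) mulr_sumr; apply: eq_bigr => y _.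
by rewrite mulrCA.
Qed.

(* With a = h x, b = h y, p = phi x, q = phi y:
   (a - b) (p^2 a - q^2 b) = (p a - q b)^2 - a b (p - q)^2. *)
Lemma energy_identity M (phi h : nat -> R) :
  (forall x y, phi x != 0 -> e x y -> (y < M)%N) ->
  2 * \sum_(x < M) phi x ^+ 2 * h x * glap h x =
  esum2 M (fun x y => h x * h y * (phi x - phi y) ^+ 2) -
  esum2 M (fun x y => (phi x * h x - phi y * h y) ^+ 2).
Proof.
move=> hM; rewrite (@glap_sum M (fun x => phi x ^+ 2 * h x)); last first.
  by move=> x y h0; apply: hM; apply: contraNneq h0 => ->; rewrite expr0n mul0r.
set S := esum2 _ _.
have -> : 2 * S = S + esum2 M (fun x y => phi y ^+ 2 * h y * (h x - h y)).
  by rewrite [X in _ + X](_ : _ = S); [ring | rewrite esum2_sym].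
rewrite /S -esum2D -[X in _ - X]mul1r -mulNr -esum2Z -esum2D.
by apply: esum2_eq => x y _; ring.
Qed.

(** The inequality of arithmetic and geometric means for [h x * h y], symmetrised over the two
    orientations. *)
Lemma energy_le M (phi h : nat -> R) :
  esum2 M (fun x y => h x * h y * (phi x - phi y) ^+ 2) <=
  esum2 M (fun x y => h x ^+ 2 * (phi x - phi y) ^+ 2).
Proof.
set S := esum2 M (fun x y => h x ^+ 2 * _).
have SE : S = 2^-1 * (S + esum2 M (fun x y => h y ^+ 2 * (phi y - phi x) ^+ 2)).
  by rewrite [X in _ + X](_ : _ = S); [field | rewrite esum2_sym].
rewrite SE /S -esum2D -esum2Z; apply: esum2_le => x y _ _ _.
rewrite -subr_ge0 (_ : _ - _ = 2^-1 * ((h x - h y) * (phi x - phi y)) ^+ 2); last by field.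
by rewrite mulr_ge0 ?sqr_ge0 // invr_ge0.
Qed.

End NeighbourSums.

(** * Poincare inequality *)

Section GridPoincare.
Variable R : realType.

Lemma sum_pair_differences (I : finType) (f : I -> R) :
  \sum_i \sum_j (f i - f j) ^+ 2 =
  2 * #|I|%:R * \sum_i f i ^+ 2 - 2 * (\sum_i f i) ^+ 2.
Proof.
have e1 : \sum_i \sum_(j : I) f i ^+ 2 = #|I|%:R * \sum_i f i ^+ 2.
  by rewrite mulr_sumr; apply: eq_bigr => i _; rewrite sumr_const mulr_natl.
have e2 : \sum_(i : I) \sum_j f j ^+ 2 = #|I|%:R * \sum_i f i ^+ 2.
  by rewrite sumr_const mulr_natl.
have e3 : \sum_i \sum_j f i * f j = (\sum_i f i) ^+ 2.
  rewrite expr2 mulr_suml; apply: eq_bigr => i _; by rewrite mulr_sumr.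
have -> : \sum_i \sum_j (f i - f j) ^+ 2 = \sum_i \sum_(j : I) f i ^+ 2 +
    \sum_(i : I) \sum_j f j ^+ 2 - 2 * \sum_i \sum_j f i * f j.
  rewrite mulr_sumr -big_split -sumrB; apply: eq_bigr => i _ /=.
  rewrite mulr_sumr -big_split -sumrB; apply: eq_bigr => j _ /=; ring.
rewrite e1 e2 e3; ring.
Qed.

Lemma sum_cauchy_schwarz (I : finType) (f : I -> R) :
  (\sum_i f i) ^+ 2 <= #|I|%:R * \sum_i f i ^+ 2.
Proof.
have : 0 <= \sum_i \sum_j (f i - f j) ^+ 2.
  by apply: sumr_ge0 => i _; apply: sumr_ge0 => j _; exact: sqr_ge0.
rewrite sum_pair_differences; lra.
Qed.

Lemma difference_le_increments (h : nat -> R) (s i j : nat) : (i < s)%N -> (j < s)%N ->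
  (h i - h j) ^+ 2 <= s%:R * \sum_(l < s) (h l.+1 - h l) ^+ 2.
Proof.
wlog ij : i j / (i <= j)%N => [hw|] si sj.
  case: (leqP i j) => [ij|/ltnW ji]; first exact: hw.
  by rewrite -sqrrN opprB; apply: hw.
pose a (l : 'I_s) := if (i <= l < j)%N then h l.+1 - h l else 0.
have -> : h i - h j = - \sum_l a l.
  have -> : \sum_l a l = \sum_(i <= l < j) (h l.+1 - h l).
    rewrite (big_nat_widenl _ 0) // (big_nat_widen _ _ s) 1?ltnW // big_mkord [RHS]big_mkcond /=.
    by apply: eq_bigr => l _; rewrite /a.
  by rewrite telescope_sumr // opprB.
rewrite sqrrN; apply: le_trans (sum_cauchy_schwarz a) _.
rewrite card_ord ler_wpM2l //; apply: ler_sum => l _; rewrite /a.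
by case: ifP => _ //; rewrite expr0n sqr_ge0.
Qed.

(** For mean zero, the square sum is a multiple of the sum of squared differences over all pairs of
    points; each difference is split along an L-shaped path through [(i', j)]. Increments reach one
    step outside the square, so that for a grid of squares each increment is counted once. *)
Lemma box_poincare (F : nat -> nat -> R) (s : nat) :
  \sum_(i < s) \sum_(j < s) F i j = 0 ->
  \sum_(i < s) \sum_(j < s) F i j ^+ 2 <= s%:R ^+ 2 *
  \sum_(i < s) \sum_(j < s) ((F i.+1 j - F i j) ^+ 2 + (F i j.+1 - F i j) ^+ 2).
Proof.
case: s => [|s']; first by move=> _; rewrite !big_ord0 mulr0.
set s := s'.+1 => mean0; have s0 : 0 < s%:R :> R by rewrite ltr0n.
pose f (z : 'I_s * 'I_s) := F z.1 z.2.
have fs : \sum_(i < s) \sum_(j < s) F i j ^+ 2 = \sum_z f z ^+ 2 by rewrite pair_big.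
have f0 : \sum_z f z = 0 by rewrite -[RHS]mean0 pair_big.
pose H (j : 'I_s) := \sum_(l < s) (F l.+1 j - F l j) ^+ 2.
pose V (i : 'I_s) := \sum_(l < s) (F i l.+1 - F i l) ^+ 2.
have step (z w : 'I_s * 'I_s) : (f z - f w) ^+ 2 <= 2 * s%:R * H z.2 + 2 * s%:R * V w.1.
  case: z w => [i j] [i' j']; rewrite /f /=.
  have h1 := difference_le_increments (fun l => F l j) (ltn_ord i) (ltn_ord i').
  have h2 := difference_le_increments (F i') (ltn_ord j) (ltn_ord j').
  rewrite -/(H j) /= in h1; rewrite -/(V i') /= in h2.
  by have := sqr_ge0 (F i j - F i' j - (F i' j - F i' j')); lra.
have : \sum_z \sum_w (f z - f w) ^+ 2 <=
    \sum_(z : 'I_s * 'I_s) \sum_(w : 'I_s * 'I_s) (2 * s%:R * H z.2 + 2 * s%:R * V w.1).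
  by apply: ler_sum => z _; apply: ler_sum => w _; exact: step.
rewrite sum_pair_differences f0 expr0n mulr0 subr0 card_prod card_ord natrM -fs.
have sc (I : finType) (c : R) : \sum_(i : I) c = #|I|%:R * c.
  by rewrite sumr_const mulr_natl.
have -> : \sum_(z : 'I_s * 'I_s) \sum_(w : 'I_s * 'I_s) (2 * s%:R * H z.2 + 2 * s%:R * V w.1) =
    2 * s%:R ^+ 4 * (\sum_j H j + \sum_i V i).
  have -> : \sum_(z : 'I_s * 'I_s) \sum_(w : 'I_s * 'I_s)
      (2 * s%:R * H z.2 + 2 * s%:R * V w.1) =
      \sum_(z : 'I_s * 'I_s) (s%:R * s%:R * (2 * s%:R * H z.2) +
        2 * s%:R * (s%:R * \sum_i V i)).
    apply: eq_bigr => z _; rewrite big_split /= sc card_prod card_ord natrM; congr (_ + _).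
    rewrite -mulr_sumr; congr (_ * _).
    rewrite -(pair_big xpredT xpredT (fun i (j : 'I_s) => V i)) /= mulr_sumr.
    by apply: eq_bigr => i _; rewrite sc card_ord.
  rewrite big_split /= sc card_prod card_ord natrM -!mulr_sumr.
  have -> : \sum_(z : 'I_s * 'I_s) H z.2 = s%:R * \sum_j H j.
    by rewrite -(pair_big xpredT xpredT (fun (i : 'I_s) j => H j)) /= sc card_ord.
  ring.
have -> : \sum_(i < s) \sum_(j < s) ((F i.+1 j - F i j) ^+ 2 + (F i j.+1 - F i j) ^+ 2) =
    \sum_j H j + \sum_i V i.
  rewrite /H [X in _ = X + _]exchange_big -big_split /=.
  by apply: eq_bigr => i _; rewrite big_split.
set A := \sum_(i < s) _; set B := _ + _.
have -> : 2 * (s%:R * s%:R) * A = (2 * s%:R ^+ 2) * A by ring.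
have -> : 2 * s%:R ^+ 4 * B = (2 * s%:R ^+ 2) * (s%:R ^+ 2 * B) by ring.
by rewrite ler_pM2l // mulr_gt0 // exprn_gt0.
Qed.

Lemma sum_blocks (H : nat -> R) (n s : nat) :
  \sum_(0 <= p < n * s) H p = \sum_(a < n) \sum_(i < s) H (a * s + i)%N.
Proof.
rewrite big_nat_mul big_mkord; apply: eq_bigr => a _.
rewrite -{1}[(a * s)%N]add0n big_addn mulSn addnK big_mkord.
by apply: eq_bigr => i _; rewrite addnC.
Qed.

Lemma sum_blocks2 (H : nat -> nat -> R) (n s : nat) :
  \sum_(0 <= p < n * s) \sum_(0 <= q < n * s) H p q =
  \sum_(a < n) \sum_(b < n) \sum_(i < s) \sum_(j < s) H (a * s + i)%N (b * s + j)%N.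
Proof.
rewrite sum_blocks; apply: eq_bigr => a _.
rewrite [RHS]exchange_big /=; apply: eq_bigr => i _.
by rewrite sum_blocks.
Qed.

Lemma grid_poincare (F : nat -> nat -> R) (n s : nat) :
  (forall a b : 'I_n, \sum_(i < s) \sum_(j < s) F (a * s + i)%N (b * s + j)%N = 0) ->
  \sum_(0 <= p < n * s) \sum_(0 <= q < n * s) F p q ^+ 2 <= s%:R ^+ 2 *
  \sum_(0 <= p < n * s) \sum_(0 <= q < n * s)
    ((F p.+1 q - F p q) ^+ 2 + (F p q.+1 - F p q) ^+ 2).
Proof.
move=> mean0; rewrite !sum_blocks2 mulr_sumr; apply: ler_sum => a _.
rewrite mulr_sumr; apply: ler_sum => b _.
have := @box_poincare (fun i j => F (a * s + i)%N (b * s + j)%N) s (mean0 a b).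
by under [X in _ <= _ * X -> _]eq_bigr do under eq_bigr do rewrite !addnS.
Qed.

End GridPoincare.

(** * Transfer of the Poincare inequality from the lattice to the graph *)

Section CoarsePoincare.
Variables (R : realType) (e : rel nat) (N : nat) (cell : nat -> int * int)
  (site : int * int -> nat).
Hypothesis cp : coarse_plane e N cell site.

(** The first summand pays for replacing [g x] by [g (site (cell x))], the second for the lattice
    inequality applied to [g \o site]. There [(2 N + 1) ^ 2] bounds the fibres of [site] and the
    inner 2 counts the lattice directions; the outer factors come from
    [(a + b) ^ 2 <= 2 a ^ 2 + 2 b ^ 2]. *)
Definition poincare_const : R :=
  2 * (2 ^+ N * 26%:R ^+ N) + 2 * (2 * (2 ^+ N * ((2 * N + 1) * (2 * N + 1))%:R * 26%:R ^+ N)).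

Definition grid_point (o : int * int) (p q : nat) : int * int := (o.1 + p%:Z, o.2 + q%:Z).

Lemma site_fibre u (s : seq (int * int)) : uniq s -> (forall z, z \in s -> site z = u) ->
  (size s <= (2 * N + 1) * (2 * N + 1))%N.
Proof.
move=> us hs.
apply: (@box_packing _ id ((cell u).1 - N%:Z, (cell u).2 - N%:Z) (2 * N + 1)) => // z zs.
have := cell_site cp z; rewrite hs //; case: (cell u) z {zs} => a b [z1 z2] /= [h1 h2].
by apply/and4P; split=> /=; lia.
Qed.

Lemma coarse_poincare (g : nat -> R) (b : R) (o : int * int) (n s M : nat) : (0 < s)%N ->
  total_le (grad2 e g) b ->
  (forall z, g (site z) != 0 -> in_box o (n * s) z) ->
  (forall a a' : 'I_n, \sum_(i < s) \sum_(j < s)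
     g (site (grid_point o (a * s + i) (a' * s + j))) = 0) ->
  \sum_(x < M) g x ^+ 2 <= poincare_const * s%:R ^+ 2 * b.
Proof.
move=> s0 hb supp mean0.
have b0 := total_le_ge0 hb.
have g20 := grad2_ge0 cp g.
have hS := total_le_spread_iter cp N g20 hb.
set T := spread_iter e N (grad2 e g) in hS.
have T0 x : 0 <= T x by apply: (spread_iter_ge0 cp).
pose m := (n * s)%N.
pose Z := [seq grid_point o p q | p <- index_iota 0 m, q <- index_iota 0 m].
have uZ : uniq Z.
  apply: allpairs_uniq; rewrite ?iota_uniq // => -[p q] [p' q'] _ _ [] /= h1 h2.
  by congr pair; lia.
have sumZ (H : int * int -> R) :
    \sum_(z <- Z) H z = \sum_(0 <= p < m) \sum_(0 <= q < m) H (grid_point o p q).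
  exact: big_allpairs_dep.
have hsite : total_le (T \o site) (((2 * N + 1) * (2 * N + 1))%:R * (26%:R ^+ N * b)).
  by apply: total_le_comp hS => // u t ut; exact: site_fibre.
have part1 : \sum_(x < M) (g x - g (site (cell x))) ^+ 2 <= 2 ^+ N * (26%:R ^+ N * b).
  apply: le_trans (_ : \sum_(x < M) 2 ^+ N * T x <= _).
    by apply: ler_sum => x _; exact: (within_grad2 cp g (site_cell cp x)).
  by rewrite -mulr_sumr ler_wpM2l ?exprn_ge0 //; exact: total_le_prefix hS.
pose F p q := g (site (grid_point o p q)).
have part2 : \sum_(x < M) g (site (cell x)) ^+ 2 <=
    \sum_(0 <= p < m) \sum_(0 <= q < m) F p q ^+ 2.
  rewrite -(sumZ (fun z => g (site z) ^+ 2)).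
  rewrite -(big_mkord xpredT (fun x => g (site (cell x)) ^+ 2)).
  rewrite -(big_map cell xpredT (fun z => g (site z) ^+ 2)).
  rewrite (bigID (in_box o m)) /= [X in _ + X]big1 ?addr0.
    rewrite -big_filter; apply: sum_subseq_le => //.
    - by move=> z; exact: sqr_ge0.
    - by rewrite filter_uniq // map_inj_uniq ?iota_uniq //; exact: cell_injective cp.
    - move=> z; rewrite mem_filter => /andP[/and4P[h1 h2 h3 h4] _].
      apply/allpairsP; exists (`|z.1 - o.1|%N, `|z.2 - o.2|%N) => /=.
      rewrite !mem_index_iota /grid_point; split; [lia|lia|].
      by case: z h1 h2 h3 h4 => z1 z2 /= *; congr pair; lia.
  move=> z nz; apply/eqP; rewrite sqrf_eq0; apply: contraNT nz; exact: supp.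
have part3 : \sum_(0 <= p < m) \sum_(0 <= q < m)
    ((F p.+1 q - F p q) ^+ 2 + (F p q.+1 - F p q) ^+ 2) <=
    2 * (2 ^+ N * (((2 * N + 1) * (2 * N + 1))%:R * (26%:R ^+ N * b))).
  pose H z := (g (site (z.1 + 1, z.2)) - g (site z)) ^+ 2 +
              (g (site (z.1, z.2 + 1)) - g (site z)) ^+ 2.
  have -> : \sum_(0 <= p < m) \sum_(0 <= q < m)
      ((F p.+1 q - F p q) ^+ 2 + (F p q.+1 - F p q) ^+ 2) = \sum_(z <- Z) H z.
    rewrite sumZ; apply: eq_bigr => p _; apply: eq_bigr => q _.
    rewrite /H /F /grid_point /=; congr ((g (site (_, _)) - _) ^+ 2 + (g (site (_, _)) - _) ^+ 2).
      by rewrite -addn1 PoszD addrA.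
    by rewrite -addn1 PoszD addrA.
  apply: le_trans (_ : \sum_(z <- Z) 2 * (2 ^+ N * (T \o site) z) <= _).
    apply: ler_sum => z _; rewrite /H.
    have h1 := within_grad2 cp g (site_step1 cp z).
    have h2 := within_grad2 cp g (site_step2 cp z).
    rewrite -/T -sqrrN opprB in h1; rewrite -/T -sqrrN opprB in h2.
    by rewrite /=; lra.
  rewrite -!mulr_sumr; apply: ler_wpM2l => //; apply: ler_wpM2l; first exact: exprn_ge0.
  exact: hsite.
have part4 := grid_poincare (F := F) mean0.
have sum2 : \sum_(x < M) g x ^+ 2 <=
    2 * \sum_(x < M) (g x - g (site (cell x))) ^+ 2 + 2 * \sum_(x < M) g (site (cell x)) ^+ 2.
  rewrite !mulr_sumr -big_split /=; apply: ler_sum => x _.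
  by have := sqr_ge0 (g x - g (site (cell x)) - g (site (cell x))); lra.
have s1 : 1 <= s%:R ^+ 2 :> R by rewrite exprn_ege1 // ler1n.
have A0 : 0 <= 2 ^+ N * (26%:R ^+ N * b) by rewrite !mulr_ge0 ?exprn_ge0.
have h1 : 2 ^+ N * (26%:R ^+ N * b) <= s%:R ^+ 2 * (2 ^+ N * (26%:R ^+ N * b)).
  by rewrite ler_peMl.
have h2 : \sum_(0 <= p < m) \sum_(0 <= q < m) F p q ^+ 2 <=
    s%:R ^+ 2 * (2 * (2 ^+ N * (((2 * N + 1) * (2 * N + 1))%:R * (26%:R ^+ N * b)))).
  by apply: le_trans part4 _; rewrite ler_wpM2l // exprn_ge0.
rewrite /poincare_const; lra.
Qed.

End CoarsePoincare.

(** * Balls and cutoffs *)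

(** What the estimates use of the distance [d] to [x0]: the first clause gives Lipschitz cutoffs,
    the second quadratic volume growth. *)
Definition coarse_radius (e : rel nat) (cell : nat -> int * int) (d : nat -> nat) (x0 : nat) :=
  (forall x y, e x y -> (d x <= (d y).+1)%N) /\
  (forall x, `|(cell x).1 - (cell x0).1| <= (2 * d x)%:Z /\
             `|(cell x).2 - (cell x0).2| <= (2 * d x)%:Z).

Lemma le_truncn_nat (R : realType) (r : R) (n : nat) : n%:R <= r -> (n <= Num.truncn r)%N.
Proof. by move=> h; rewrite truncn_ge_nat // (le_trans _ h). Qed.

Lemma truncn_le_self (R : realType) (r : R) : 0 <= r -> (Num.truncn r)%:R <= r.
Proof. by move=> r0; rewrite -truncn_ge_nat. Qed.

Section Balls.
Variables (R : realType) (e : rel nat) (N : nat) (cell : nat -> int * int)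
  (site : int * int -> nat) (d : nat -> nat) (x0 : nat).
Hypotheses (cp : coarse_plane e N cell site) (cr : coarse_radius e cell d x0).
Implicit Types (x y M : nat) (r w : R) (F h : nat -> R).

Lemma ball_box n x : (d x <= n)%N ->
  in_box ((cell x0).1 - (2 * n)%:Z, (cell x0).2 - (2 * n)%:Z) (4 * n + 1) (cell x).
Proof.
move=> dn; have [h1 h2] := cr.2 x.
by apply/and4P; case: (cell x) (cell x0) h1 h2 => a b [a' b'] /=; split=> /=; lia.
Qed.

Lemma ball_bound r : exists M, forall x, (d x)%:R <= r -> (x < M)%N.
Proof.
have [M hM] := box_bound cp ((cell x0).1 - (2 * Num.truncn r)%:Z, (cell x0).2 - (2 * Num.truncn r)%:Z)
  (4 * Num.truncn r + 1).
by exists M => x h; apply: hM; apply: ball_box; apply: le_truncn_nat.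
Qed.

Definition ballsum r F : R := \sum_(x \in [set x | (d x)%:R <= r]) F x.

Lemma ballsumE M r F : (forall x, (d x)%:R <= r -> (x < M)%N) ->
  ballsum r F = \sum_(x < M) if (d x)%:R <= r then F x else 0.
Proof.
move=> hM; rewrite /ballsum (fsbigE [seq x <- iota 0 M | (d x)%:R <= r]) /=.
- rewrite big_filter_cond -(big_mkord xpredT (fun x => if (d x)%:R <= r then F x else 0)).
  rewrite /index_iota subn0 [LHS]big_mkcond; apply: eq_bigr => x _.
  have -> : (x \in [set x | (d x)%:R <= r]) = ((d x)%:R <= r) by apply/idP/idP; rewrite inE.
  by rewrite andbb.
- by rewrite filter_uniq // iota_uniq.
- by move=> x /=; rewrite mem_filter => /andP[].
- by move=> x /= dx; rewrite mem_filter dx mem_iota /= add0n hM.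
Qed.

Lemma ballsum_le r r' F F' : r <= r' -> (forall x, 0 <= F' x) ->
  (forall x, (d x)%:R <= r -> F x <= F' x) -> ballsum r F <= ballsum r' F'.
Proof.
move=> rr F'0 FF'; have [M hM] := ball_bound r'.
rewrite (@ballsumE M) => [|x /le_trans/(_ rr)/hM //]; rewrite (@ballsumE M) //.
apply: ler_sum => x _; case: ifP => [dx|_]; last by case: ifP.
by rewrite (le_trans dx rr) FF'.
Qed.

Lemma ballsum_ge0 r F : (forall x, 0 <= F x) -> 0 <= ballsum r F.
Proof.
move=> F0; have [M hM] := ball_bound r; rewrite (@ballsumE M) //.
by apply: sumr_ge0 => x _; case: ifP.
Qed.

Lemma ballsum_card r c : 1 <= r -> 0 <= c -> ballsum r (fun=> c) <= 25%:R * r ^+ 2 * c.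
Proof.
move=> r1 c0; have [M hM] := ball_bound r; rewrite (@ballsumE M) //.
rewrite -(big_mkord xpredT (fun x => if (d x)%:R <= r then c else 0)) -big_mkcond /=.
rewrite -big_filter big_const_seq count_predT iter_addr_0 -[c *+ _]mulr_natl ler_wpM2r //.
have tr : (Num.truncn r)%:R <= r by apply: truncn_le_self; lra.
apply: (@le_trans _ _ ((4 * Num.truncn r + 1) * (4 * Num.truncn r + 1))%:R).
  rewrite ler_nat; apply: (box_packing (cell_injective cp)).
    by rewrite filter_uniq // iota_uniq.
  by move=> x; rewrite mem_filter => /andP[h _]; apply: ball_box; exact: le_truncn_nat.
rewrite natrM natrD natrM -expr2; have -> : 25%:R * r ^+ 2 = (5%:R * r) ^+ 2 by ring.
by rewrite ler_pXn2r ?nnegrE //; lra.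
Qed.

Definition cutoff r w x : R := Num.max 0 (Num.min 1 ((r + w - (d x)%:R) / w)).

Lemma cutoff_ge0 r w x : 0 <= cutoff r w x.
Proof. by rewrite le_max lexx. Qed.

Lemma cutoff_le1 r w x : cutoff r w x <= 1.
Proof. by rewrite ge_max ler01 ge_min lexx. Qed.

Lemma cutoff_in r w x : 0 < w -> (d x)%:R <= r -> cutoff r w x = 1.
Proof.
move=> w0 dr; rewrite /cutoff min_l ?max_r ?ler01 // ler_pdivlMr //; lra.
Qed.

Lemma cutoff_out r w x : 0 < w -> r + w <= (d x)%:R -> cutoff r w x = 0.
Proof.
move=> w0 dr; rewrite /cutoff max_l // ge_min; apply/orP; right.
by rewrite ler_pdivrMr // mul0r subr_le0.
Qed.

Lemma edge_radius x y : e x y -> (d x)%:R <= (d y)%:R + 1 :> R.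
Proof. by move=> /cr.1; rewrite natr1 ler_nat. Qed.

Lemma cutoff_lip r w x y : 0 < w -> e x y -> (cutoff r w x - cutoff r w y) ^+ 2 <= (w ^+ 2)^-1.
Proof.
move=> w0 exy; rewrite -exprVn -real_normK ?num_real // ler_pXn2r ?nnegrE ?invr_ge0 ?(ltW w0) //.
have w1 : 0 <= w^-1 by rewrite invr_ge0 ltW.
apply: lip_max; first by rewrite subrr normr0.
apply: lip_min; first by rewrite subrr normr0.
rewrite -mulrBl normrM [`|w^-1|]ger0_norm //; apply: ler_piMl => //.
have h1 := edge_radius exy; have h2 : (d y)%:R <= (d x)%:R + 1 :> R.
  by apply: edge_radius; rewrite (edge_sym cp).
by rewrite ler_norml; apply/andP; split; lra.
Qed.

(* Cutoffs are locally constant outside the ball of radius r' >= r + w + 1. *)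
Lemma cutoff_grad_le r w r' x y : 0 < w -> r + w + 1 <= r' -> e x y ->
  (cutoff r w x - cutoff r w y) ^+ 2 <= if (d x)%:R <= r' then (w ^+ 2)^-1 else 0.
Proof.
move=> w0 rr exy; case: ifP => [_|/negbT]; first exact: cutoff_lip.
rewrite -ltNge => dx; have := edge_radius exy.
by move=> h; rewrite !cutoff_out // ?subrr ?expr0n //; lra.
Qed.

Lemma grad_ballsum_le M r w r' h : 0 < w -> r + w + 1 <= r' ->
  (forall x, (d x)%:R <= r' -> (x < M)%N) ->
  esum2 e M (fun x y => h x ^+ 2 * (cutoff r w x - cutoff r w y) ^+ 2) <=
  25%:R / w ^+ 2 * ballsum r' (fun x => h x ^+ 2).
Proof.
move=> w0 rr hM.
pose g x := (w ^+ 2)^-1 * (if (d x)%:R <= r' then h x ^+ 2 else 0).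
have wi : 0 <= (w ^+ 2)^-1 by rewrite invr_ge0 exprn_ge0 // ltW.
apply: le_trans (_ : esum2 e M (fun x _ => g x) <= _).
  apply: esum2_le => x y _ _ exy; have := cutoff_grad_le w0 rr exy; rewrite /g.
  case: ifP => _ hh; last by rewrite mulr0 mulr_ge0_le0 ?sqr_ge0.
  by rewrite mulrC ler_wpM2r // sqr_ge0.
apply: le_trans (esum2_left_le cp _ _) _.
  by move=> x; rewrite mulr_ge0 //; case: ifP => _; rewrite ?sqr_ge0.
by rewrite -mulrA ler_wpM2l // (ballsumE _ hM) -mulr_sumr.
Qed.

Lemma cutoff_support M r w r' x y : 0 < w -> r + w + 1 <= r' ->
  (forall x, (d x)%:R <= r' -> (x < M)%N) -> cutoff r w x != 0 -> e x y -> (y < M)%N.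
Proof.
move=> w0 rr hM cx exy; apply: hM.
have : (d x)%:R < r + w by rewrite ltNge; apply: contraNN cx => /(cutoff_out w0) ->.
have : (d y)%:R <= (d x)%:R + 1 :> R by apply: edge_radius; rewrite (edge_sym cp).
lra.
Qed.

(** Caccioppoli inequality. Harmonicity kills the left side of [energy_identity], so the energy of
    the truncated function is exactly the term containing the gradient of the cutoff. *)
Lemma harmonic_cutoff_energy r w r' h : 0 < w -> r + w + 1 <= r' ->
  (forall x, glap e h x = 0) ->
  total_le (grad2 e (fun x => cutoff r w x * h x))
    (25%:R / w ^+ 2 * ballsum r' (fun x => h x ^+ 2)).
Proof.
move=> w0 rr harm; set g := fun x => _.
have [M0 hM0] := ball_bound (r' + 1).
have hM x : (d x)%:R <= r' -> (x < M0)%N by move=> h0; apply: hM0; lra.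
have g0 x : r' - 1 <= (d x)%:R -> g x = 0.
  by move=> dx; rewrite /g cutoff_out ?mul0r //; lra.
have far x y : r' < (d x)%:R -> e x y -> (g x - g y) ^+ 2 = 0.
  move=> dx exy; have := edge_radius exy => h1.
  by rewrite !g0 ?subrr ?expr0n //; lra.
have row x : grad2 e g x = \sum_(y < M0) (e x y)%:R * (g x - g y) ^+ 2.
  have [dx|dx] := leP ((d x)%:R : R) r'.
    rewrite /grad2 (@nsumE _ _ _ _ M0) // => y exy; apply: hM0.
    have := edge_radius (etrans (edge_sym cp _ _) exy); lra.
  rewrite [RHS]big1 => [|y _]; last first.
    by case: (boolP (e x y)) => [/(far _ _ dx) ->|_]; rewrite ?mulr0 ?mul0r.
  have [M hM'] := neighbour_bound cp x.
  rewrite /grad2 (nsumE _ hM') big1 // => y _.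
  by case: (boolP (e x y)) => [/(far _ _ dx) ->|_]; rewrite ?mulr0 ?mul0r.
have zero x : (M0 <= x)%N -> grad2 e g x = 0.
  move=> xM; have dx : r' < (d x)%:R.
    by rewrite ltNge; apply/negP => /hM; rewrite ltnNge xM.
  rewrite row big1 // => y _.
  by case: (boolP (e x y)) => [/(far _ _ dx) ->|_]; rewrite ?mulr0 ?mul0r.
have := total_le_supp (grad2_ge0 cp g) zero.
rewrite (eq_bigr _ (fun (x : 'I_M0) _ => row x)) => tot s us; apply: le_trans (tot s us) _.
rewrite -/(esum2 e M0 (fun x y => (g x - g y) ^+ 2)).
have sup x y : cutoff r w x != 0 -> e x y -> (y < M0)%N by exact: (cutoff_support w0 rr hM).
have := energy_identity cp h sup.
rewrite big1 ?mulr0 => [|x _]; last by rewrite harm mulr0.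
move/esym/eqP; rewrite subr_eq0 => /eqP <-.
apply: le_trans (energy_le cp _ _ _) _; exact: grad_ballsum_le.
Qed.

End Balls.

(** * Harmonic functions of polynomial growth *)

Section HarmonicDimension.
Variables (R : realType) (e : rel nat) (N : nat) (cell : nat -> int * int)
  (site : int * int -> nat) (d : nat -> nat) (x0 : nat).
Hypotheses (cp : coarse_plane e N cell site) (cr : coarse_radius e cell d x0).
Implicit Types (r w : R) (h : nat -> R).
Local Notation ballsum := (ballsum (R := R) d).
Local Notation P := (poincare_const R N).

Definition box_site (T : nat) (p q : nat) : nat :=
  site (grid_point ((cell x0).1 - T%:Z, (cell x0).2 - T%:Z) p q).

(** Poincare for the truncated function followed by Caccioppoli. A lattice point whose site lies in
    the support of the cutoff is within [2 * r' + N] of the cell of [x0] in each coordinate, which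
    explains the half-side [T]. *)
Lemma scale_step h r w r' (n s T M : nat) : (0 < s)%N -> 0 < w -> r + w + 1 <= r' ->
  2 * r' + N%:R <= T%:R -> (2 * T + 1 <= n * s)%N ->
  (forall x, glap e h x = 0) ->
  (forall a a' : 'I_n, \sum_(i < s) \sum_(j < s)
     (cutoff d r w (box_site T (a * s + i) (a' * s + j)) *
      h (box_site T (a * s + i) (a' * s + j))) = 0) ->
  ballsum r (fun x => h x ^+ 2) <=
  P * s%:R ^+ 2 * (25%:R / w ^+ 2 * ballsum r' (fun x => h x ^+ 2)).
Proof.
move=> s0 w0 rr hT hns harm mean0.
have hb := harmonic_cutoff_energy cp cr w0 rr harm.
have [M0 hM0] := ball_bound cp cr r.
pose o := ((cell x0).1 - T%:Z, (cell x0).2 - T%:Z).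
have := @coarse_poincare R e N cell site cp _ _ o n s M0 s0 hb.
move=> /(_ _ mean0) hp; apply: le_trans (hp _); last first.
  move=> z; rewrite mulf_eq0 negb_or => /andP[cz _].
  have dz : (2 * d (site z) + N <= T)%N.
    rewrite -(ler_nat R) natrD natrM; apply: le_trans hT; rewrite lerD2r ler_pM2l //.
    have : (d (site z))%:R < r + w.
      by rewrite ltNge; apply: contraNN cz => /(cutoff_out w0) ->.
    lra.
  have [h1 h2] := cell_site cp z; have [h3 h4] := cr.2 (site z).
  move: dz h1 h2 h3 h4; rewrite /in_box /o.
  move: (d (site z)) (cell (site z)) (cell x0) => D [a b] [a' b'] /= *.
  by apply/and4P; split; lia.
rewrite (ballsumE _ hM0); apply: ler_sum => x _; case: ifP => [dx|_]; last exact: sqr_ge0.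
by rewrite cutoff_in // mul1r.
Qed.

Section Family.
Variables (m : nat) (f : 'I_m -> nat -> R).
Hypothesis harm : forall i x, glap e (f i) x = 0.

Definition combination (a : 'rV[R]_m) x : R := \sum_i a 0 i * f i x.

Lemma combination_harmonic a x : glap e (combination a) x = 0.
Proof.
have [M hM] := neighbour_bound cp x.
rewrite /glap (nsumE _ hM).
transitivity (\sum_i a 0 i * glap e (f i) x); last first.
  by rewrite big1 // => i _; rewrite harm mulr0.
rewrite /glap; under [RHS]eq_bigr do rewrite (nsumE _ hM) mulr_sumr.
rewrite exchange_big /=; apply: eq_bigr => y _.
rewrite /combination -sumrB mulr_sumr; apply: eq_bigr => i _; ring.
Qed.

Definition gram r : 'M[R]_m := \matrix_(i, k) ballsum r (fun x => f i x * f k x).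

Lemma gram_qform r a : qform (gram r) a = ballsum r (fun x => combination a x ^+ 2).
Proof.
have [M hM] := ball_bound cp cr r; rewrite (ballsumE _ hM) /qform mxE.
transitivity (\sum_k \sum_i \sum_(x < M)
    (if (d x)%:R <= r then a 0 i * f i x * (a 0 k * f k x) else 0)).
  apply: eq_bigr => k _; rewrite !mxE mulr_suml; apply: eq_bigr => i _.
  rewrite !mxE (ballsumE _ hM) mulr_sumr mulr_suml; apply: eq_bigr => x _.
  by case: ifP => _; rewrite ?mulr0 ?mul0r //; ring.
under eq_bigr do rewrite exchange_big /=.
rewrite exchange_big /=; apply: eq_bigr => x _.
case: ifP => _; last by rewrite big1 // => k _; rewrite big1.
rewrite /combination expr2 mulr_sumr; apply: eq_bigr => k _.
by rewrite mulr_suml.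
Qed.

Lemma gram_posdef r (M : nat) : (forall x, (x < M)%N -> (d x)%:R <= r) ->
  (forall a, (forall x, (x < M)%N -> combination a x = 0) -> a = 0) -> posdef (gram r).
Proof.
move=> hM free; split.
  by apply/matrixP => i k; rewrite !mxE; apply: eq_fsbigr => x _; rewrite mulrC.
move=> a a0; rewrite gram_qform lt_neqAle (ballsum_ge0 cp cr) ?andbT //; last first.
  by move=> x; exact: sqr_ge0.
rewrite eq_sym; apply: contraNN a0 => /eqP q0; apply/eqP; apply: free => x xM.
have [M' hM'] := ball_bound cp cr r.
move: q0; rewrite (ballsumE _ hM').
have xM' := hM' _ (hM _ xM).
move/psumr_eq0P => /(_ _ (Ordinal xM') isT) /=.
rewrite hM // => q0; apply/eqP; rewrite -sqrf_eq0 q0 // => i _.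
by case: ifP => _; rewrite ?sqr_ge0.
Qed.

Lemma gram_le r r' a : r <= r' -> qform (gram r) a <= qform (gram r') a.
Proof.
move=> rr; rewrite !gram_qform; apply: (ballsum_le cp cr) => // x; exact: sqr_ge0.
Qed.

(** Its kernel consists of the combinations to which the Poincare inequality applies, and its width
    [n * n] bounds the codimension. *)
Definition mean_matrix r w (n s T : nat) : 'M[R]_(m, n * n) :=
  \matrix_i mxvec (\matrix_(a < n, a' < n) \sum_(u < s) \sum_(v < s)
    (cutoff d r w (box_site T (a * s + u) (a' * s + v)) *
     f i (box_site T (a * s + u) (a' * s + v)))).

Lemma mean_matrix_kernel r w (n s T : nat) (x : 'rV[R]_m) :
  x *m mean_matrix r w n s T = 0 -> forall a a' : 'I_n,
  \sum_(u < s) \sum_(v < s)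
     (cutoff d r w (box_site T (a * s + u) (a' * s + v)) *
      combination x (box_site T (a * s + u) (a' * s + v))) = 0.
Proof.
move=> xW a a'; move/rowP/(_ (mxvec_index a a')): xW; rewrite [RHS]mxE => xW.
rewrite -[RHS]xW mxE.
transitivity (\sum_i \sum_(u < s) \sum_(v < s) x 0 i *
    (cutoff d r w (box_site T (a * s + u) (a' * s + v)) *
     f i (box_site T (a * s + u) (a' * s + v)))); last first.
  apply: eq_bigr => i _; rewrite !mxE mxvecE mxE mulr_sumr.
  by apply: eq_bigr => u _; rewrite mulr_sumr.
rewrite [RHS]exchange_big /=; apply: eq_bigr => u _.
rewrite [RHS]exchange_big /=; apply: eq_bigr => v _.
rewrite /combination mulr_sumr; apply: eq_bigr => i _; ring.
Qed.

(** Bounds the growth of the Gram entries from one scale to the next: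
    [(1 + 1 / K) ^ (6 K) <= expR 6] and [4 K + 2 <= 6 K]. *)
Let E : R := expR 6.

Lemma gram_det_step (K b0 : nat) r : (0 < K)%N -> 440 * E * P <= b0%:R ->
  1 <= r -> N%:R + 1 <= r -> 40 * E * P * K%:R <= r ->
  posdef (gram r) -> posdef (gram (r * (1 + K%:R^-1))) ->
  \det (gram r) <= ((2 * E)^-1 ^+ 2) ^+ (m - (b0 * K) * (b0 * K)) *
                   \det (gram (r * (1 + K%:R^-1))).
Proof.
move=> K0 hb0 r1 rN rK pA pB.
have E1 : 1 <= E by rewrite /E; apply: le_trans (expR_ge1Dx _); lra.
have P1 : 1 <= P.
  have h26 : 1 <= 2 ^+ N * 26%:R ^+ N :> R.
    by rewrite -exprMn exprn_ege1 //; lra.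
  have : 0 <= 2 * (2 ^+ N * ((2 * N + 1) * (2 * N + 1))%:R * 26%:R ^+ N) :> R.
    by rewrite !mulr_ge0 ?exprn_ge0.
  by rewrite /poincare_const; lra.
have EP1 : 1 <= E * P by rewrite -[leLHS]mulr1 ler_pM.
have K1 : 1 <= K%:R :> R by rewrite ler1n.
have K0' : 0 < K%:R :> R by lra.
have Kne : K%:R != 0 :> R by rewrite gt_eqF.
have Ene : E != 0 by rewrite gt_eqF //; lra.
have Pne : P != 0 by rewrite gt_eqF //; lra.
have rne : r != 0 by rewrite gt_eqF //; lra.
set r' := r * _ in pB *.
(* [w] is half the width of the annulus, the other half absorbing the 1 in [r + w + 1]. The 20 makes
   [P * q ^+ 2 * (25 / w ^+ 2)] equal to [(2 * E)^-1 ^+ 2 / P]. The side [s] is at least [q / 2]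
   because [q >= 2], and 440 = 11 * 40 because the box has side at most [11 * r]. *)
pose w := r / (2 * K%:R); pose q := r / (20 * (E * P) * K%:R).
have c0 : 0 < 20 * (E * P) * K%:R by rewrite !mulr_gt0 //; lra.
have q2 : 2 <= q.
  rewrite /q ler_pdivlMr //; apply: le_trans rK.
  by rewrite (_ : 2 * _ = 40 * E * P * K%:R) //; ring.
pose s := Num.truncn q.
have sq : s%:R <= q by apply: truncn_le_self; lra.
have qs : q < s%:R + 1 by rewrite natr1 truncnS_gt.
have s0 : (0 < s)%N by apply: le_truncn_nat; lra.
pose T := (Num.truncn (2 * r' + N%:R)).+1.
have r'E : r' = r + 2 * w by rewrite /r' /w; field; rewrite gt_eqF.
have w1 : 1 <= w.
  rewrite /w ler_pdivlMr; last by rewrite mulr_gt0.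
  rewrite mul1r; apply: le_trans rK.
  have -> : 40 * E * P * K%:R = (40 * (E * P)) * K%:R by ring.
  by rewrite ler_wpM2r //; lra.
have w0 : 0 < w by lra.
have r'2 : r' <= 2 * r.
  rewrite r'E; have : 2 * w <= r; last by lra.
  rewrite /w (_ : 2 * _ = r / K%:R); last by field; rewrite gt_eqF.
  by rewrite ler_pdivrMr // ler_peMr //; lra.
have hT : 2 * r' + N%:R <= T%:R by apply/ltW; rewrite truncnS_gt.
have TT : T%:R <= 2 * r' + N%:R + 1.
  rewrite /T -natr1 lerD2r; apply: truncn_le_self.
  have : 0 <= N%:R :> R by []. 
  lra.
pose n := (b0 * K)%N.
have ns : (2 * T + 1 <= n * s)%N.
  rewrite -(ler_nat R) natrD natrM.
  apply: (@le_trans _ _ (11 * r)); first by lra.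
  rewrite /n !natrM.
  have -> : 11 * r = (440 * E * P) * K%:R * (q / 2).
    by rewrite /q; field; rewrite Kne Pne Ene.
  apply: ler_pM; [|lra| |lra]; first by rewrite !mulr_ge0 //; lra.
  by rewrite ler_wpM2r //; lra.
apply: (det_le_codim (W := mean_matrix r w n s T) pA pB).
- by rewrite exprn_gt0 // invr_gt0; lra.
- by rewrite exprn_ile1 // ?invr_ge0 ?invf_le1; lra.
- by move=> x; apply: gram_le; rewrite r'E; lra.
move=> x /mean_matrix_kernel mean0; rewrite !gram_qform.
have rr : r + w + 1 <= r' by rewrite r'E; lra.
apply: le_trans (scale_step 0 s0 w0 rr hT ns (combination_harmonic x) mean0) _.
rewrite mulrA; apply: ler_wpM2r.
  by apply: (ballsum_ge0 cp cr) => y; exact: sqr_ge0.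
apply: (@le_trans _ _ (P * q ^+ 2 * (25%:R / w ^+ 2))).
  apply: ler_wpM2r; first by rewrite divr_ge0 ?exprn_ge0 // ltW.
  by rewrite ler_wpM2l ?ler_pXn2r ?nnegrE //; lra.
have -> : P * q ^+ 2 * (25%:R / w ^+ 2) = (2 * E)^-1 ^+ 2 * P^-1.
  by rewrite /q /w; field; rewrite rne Kne Pne Ene.
by rewrite ler_piMr ?sqr_ge0 // invf_le1 //; lra.
Qed.

End Family.
End HarmonicDimension.

Lemma half_power_small (R : realType) (c a : R) : 0 < a -> exists J : nat, c * (1 / 2) ^+ J < a.
Proof.
move=> a0; pose J := (Num.truncn (c / a)).+1; exists J.
have cJ : c / a < J%:R by rewrite truncnS_gt.
have J2 : J%:R <= 2 ^+ J :> R by rewrite -natrX ler_nat ltnW // ltn_expl.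
have p2 : 0 < 2 ^+ J :> R by rewrite exprn_gt0.
rewrite expr_div_n expr1n mul1r ltr_pdivrMr // mulrC -ltr_pdivrMr //.
exact: lt_le_trans cJ J2.
Qed.

Section GramGrowth.
Variables (R : realType) (e : rel nat) (N : nat) (cell : nat -> int * int)
  (site : int * int -> nat) (d : nat -> nat) (x0 : nat).
Hypotheses (cp : coarse_plane e N cell site) (cr : coarse_radius e cell d x0).
Variables (m : nat) (f : 'I_m -> nat -> R).

Lemma gram_entry_bound (K : nat) (C r : R) (i k : 'I_m) : 1 <= r ->
  (forall i x, `|f i x| <= C * (1 + (d x)%:R) ^+ (2 * K)) ->
  `|gram d f r i k| <= 25%:R * C ^+ 2 * 2 ^+ (4 * K) * r ^+ (4 * K + 2).
Proof.
move=> r1 hf.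
have [M hM] := ball_bound cp cr r.
rewrite mxE (ballsumE _ hM); apply: le_trans (ler_norm_sum _ _ _) _.
pose c := C ^+ 2 * (2 * r) ^+ (4 * K).
have c0 : 0 <= c by rewrite mulr_ge0 ?sqr_ge0 // exprn_ge0 //; lra.
apply: (@le_trans _ _ (ballsum d r (fun=> c))).
  rewrite (ballsumE _ hM); apply: ler_sum => x _; case: ifP => dx; last by rewrite normr0.
  rewrite normrM /c.
  have p0 : 0 <= (1 + (d x)%:R) ^+ (2 * K) :> R by rewrite exprn_ge0 // addr_ge0.
  apply: (@le_trans _ _ (C * (1 + (d x)%:R) ^+ (2 * K) * (C * (1 + (d x)%:R) ^+ (2 * K)))).
    exact: ler_pM.
  have -> : C * (1 + (d x)%:R) ^+ (2 * K) * (C * (1 + (d x)%:R) ^+ (2 * K)) =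
      C ^+ 2 * (1 + (d x)%:R) ^+ (4 * K) :> R.
    have -> : (4 * K = 2 * K + 2 * K)%N by lia.
    by rewrite exprD; move: ((1 + _) ^+ _) => u; ring.
  rewrite ler_wpM2l ?sqr_ge0 //; apply: lerXn2r; rewrite ?nnegrE ?addr_ge0 //; lra.
apply: le_trans (ballsum_card cp cr r1 c0) _.
rewrite /c exprMn exprD; move: (r ^+ (4 * K)) (2 ^+ (4 * K)) => u v.
by rewrite le_eqVlt; apply/orP; left; apply/eqP; ring.
Qed.

End GramGrowth.

(** If [m] exceeded [2 * n ^ 2] with [n = b0 * K], then [m <= 2 * (m - n * n)], so each scale gains
    a factor at most [(2 * E) ^ - m], while the upper bound on the determinant grows by [E ^ m]. The
    net factor is at most 1/2 per scale, against positivity of the initial determinant. *)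
Lemma harmonic_dim (R : realType) (N : nat) : exists b : nat,
  forall e cell site d x0, coarse_plane e N cell site -> coarse_radius e cell d x0 ->
  forall (K m : nat) (f : 'I_m -> nat -> R), (0 < K)%N ->
  (forall i x, glap e (f i) x = 0) ->
  (forall i, exists C, forall x, `|f i x| <= C * (1 + (d x)%:R) ^+ (2 * K)) ->
  (forall a : 'rV[R]_m, (forall x, \sum_i a 0 i * f i x = 0) -> a = 0) ->
  (m <= b * K ^ 2)%N.
Proof.
pose E : R := expR 6; pose P := poincare_const R N.
pose b0 := (Num.truncn (440 * E * P)).+1.
have hb0 : 440 * E * P <= b0%:R by apply/ltW; rewrite truncnS_gt.
exists (2 * (b0 * b0))%N => e cell site d x0 cp cr K m f K0 harm growth free.
rewrite leqNgt; apply/negP => big.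
have hK : (4 * K + 2 <= 6 * K)%N by clear -K0; lia.
pose n := (b0 * K)%N.
have big' : (2 * (n * n) < m)%N.
  by move: big; rewrite /n -mulnn; congr (_ < _)%N; ring.
have mn1 : (m <= 2 * (m - n * n))%N by move: (n * n)%N big' => q; clear; lia.
have m1 : (1 <= m)%N by move: big'; clear; case: (m).
have {}growth : exists2 C, 0 <= C & forall i x, `|f i x| <= C * (1 + (d x)%:R) ^+ (2 * K).
  have [C hC] := choice growth; exists (\sum_i `|C i|) => [|i x]; first exact: sumr_ge0.
  apply: le_trans (hC i x) _; apply: ler_wpM2r; first by rewrite exprn_ge0 // addr_ge0.
  apply: le_trans (ler_norm _) _; rewrite (bigD1 i) //= lerDl.
  by apply: sumr_ge0.
have [C C0 hC] := growth.
have [M hM] := free_on_finite_set free.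
have E1 : 1 <= E by rewrite /E; apply: le_trans (expR_ge1Dx _); lra.
pose r0 : R := 1 + (N%:R + 1) + `|40 * E * P * K%:R| + \sum_(x < M) (d x)%:R.
have s0 : 0 <= \sum_(x < M) (d x)%:R :> R by apply: sumr_ge0.
have N0 : 0 <= N%:R :> R by [].
have a0 := normr_ge0 (40 * E * P * K%:R).
have r01 : 1 <= r0 by rewrite /r0; lra.
have r0N : N%:R + 1 <= r0 by rewrite /r0; lra.
have r0K : 40 * E * P * K%:R <= r0 by have := ler_norm (40 * E * P * K%:R); rewrite /r0; lra.
have r0M x : (x < M)%N -> (d x)%:R <= r0.
  move=> xM; have : (d x)%:R <= \sum_(x < M) (d x)%:R :> R.
    by rewrite (bigD1 (Ordinal xM)) //= lerDl sumr_ge0.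
  rewrite /r0; lra.
pose be : R := 1 + K%:R^-1.
have K1 : 0 < K%:R :> R by rewrite ltr0n.
have be1 : 1 <= be by rewrite /be lerDl invr_ge0 ltW.
pose r j := r0 * be ^+ j.
have rr j : r0 <= r j by rewrite /r ler_peMr ?exprn_ege1 //; lra.
have pr j : posdef (gram d f (r j)).
  apply: (gram_posdef cp cr (M := M)).
    by move=> x /r0M h; apply: le_trans h (rr j).
  by move=> a ha; apply: hM.
pose eta : R := (2 * E)^-1 ^+ 2.
have step j : \det (gram d f (r j)) <= eta ^+ (m - n * n) * \det (gram d f (r j.+1)).
  have -> : r j.+1 = r j * (1 + K%:R^-1) by rewrite /r exprSr mulrA.
  have rj := rr j.
  apply: (gram_det_step cp cr harm K0 hb0 _ _ _ (pr j)); [lra|lra|exact: le_trans r0K rj|].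
  by have := pr j.+1; rewrite /r exprSr mulrA.
have iter J : \det (gram d f (r 0%N)) <= (eta ^+ (m - n * n)) ^+ J * \det (gram d f (r J)).
  elim: J => [|J IH]; first by rewrite expr0 mul1r.
  apply: le_trans IH _; rewrite exprSr -mulrA ler_wpM2l ?step //.
  by rewrite !exprn_ge0 // invr_ge0; lra.
pose c1 := 25%:R * C ^+ 2 * 2 ^+ (4 * K) * r0 ^+ (4 * K + 2).
have c10 : 0 <= c1.
  by rewrite /c1 !mulr_ge0 ?exprn_ge0 //; lra.
have beE : be ^+ (4 * K + 2) <= E.
  apply: (@le_trans _ _ (be ^+ (6 * K))).
    by apply: ler_weXn2l.
  apply: (@le_trans _ _ (expR (K%:R^-1) ^+ (6 * K))).
    apply: lerXn2r; rewrite ?nnegrE ?expR_ge0 //; first lra.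
    exact: expR_ge1Dx.
  rewrite -expRM_natr natrM mulrCA mulVf ?mulr1 // gt_eqF //.
have dJ J : \det (gram d f (r J)) <= (m`!)%:R * (c1 * E ^+ J) ^+ m.
  apply: det_upper_bound => i k.
  have rJ := rr J.
  apply: le_trans (gram_entry_bound cp cr i k _ hC) _; first lra.
  rewrite /c1 -[leRHS]mulrA; apply: ler_wpM2l.
    by rewrite !mulr_ge0 ?exprn_ge0.
  rewrite /r exprMn ler_wpM2l ?exprn_ge0 //; first lra.
  rewrite -exprM mulnC exprM; apply: lerXn2r; rewrite ?nnegrE ?exprn_ge0 //; lra.
have key : eta ^+ (m - n * n) * E ^+ m <= 1 / 2.
  have h : (2 * E)^-1 <= 1 by rewrite invf_le1; lra.
  have h0 : 0 <= (2 * E)^-1 by rewrite invr_ge0; lra.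
  apply: (@le_trans _ _ ((2 * E)^-1 ^+ m * E ^+ m)).
    apply: ler_wpM2r; first by rewrite exprn_ge0 //; lra.
    by rewrite /eta -exprM; apply: ler_wiXn2l.
  rewrite -exprMn (_ : (2 * E)^-1 * E = 1 / 2); last by field; rewrite gt_eqF //; lra.
  rewrite -[leRHS]expr1; by apply: ler_wiXn2l => //; lra.
have [J hJ] := half_power_small ((m`!)%:R * c1 ^+ m) (posdef_det (pr 0%N)).
have := lt_le_trans hJ (iter J); apply/negP; rewrite -leNgt.
apply: (@le_trans _ _ ((eta ^+ (m - n * n)) ^+ J * ((m`!)%:R * (c1 * E ^+ J) ^+ m))).
  apply: ler_wpM2l; last exact: dJ.
  by rewrite !exprn_ge0 // invr_ge0; lra.
have -> : (eta ^+ (m - n * n)) ^+ J * ((m`!)%:R * (c1 * E ^+ J) ^+ m) =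
    (m`!)%:R * c1 ^+ m * (eta ^+ (m - n * n) * E ^+ m) ^+ J.
  move: (eta ^+ (m - n * n)) => u; rewrite !exprMn -(exprM E) (mulnC J m) (exprM E).
  by move: (u ^+ J) (c1 ^+ m) ((E ^+ m) ^+ J) => u' v w; ring.
apply: ler_wpM2l; first by rewrite mulr_ge0 // exprn_ge0.
apply: lerXn2r => //; rewrite nnegrE; last lra.
by rewrite mulr_ge0 ?exprn_ge0 // ?invr_ge0; lra.
Qed.

(** * Ancient solutions of the heat equation *)

Section Derivatives.
Variable R : realType.
Implicit Types (f g : R -> R) (t df dg c : R).

Lemma is_derive_addf f g t df dg : is_derive t (1 : R) f df -> is_derive t (1 : R) g dg ->
  is_derive t (1 : R) (fun s => f s + g s) (df + dg).
Proof. exact: is_deriveD. Qed.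

Lemma is_derive_subf f g t df dg : is_derive t (1 : R) f df -> is_derive t (1 : R) g dg ->
  is_derive t (1 : R) (fun s => f s - g s) (df - dg).
Proof. exact: is_deriveB. Qed.

Lemma is_derive_mulf f g t df dg : is_derive t (1 : R) f df -> is_derive t (1 : R) g dg ->
  is_derive t (1 : R) (fun s => f s * g s) (f t * dg + g t * df).
Proof. exact: is_deriveM. Qed.

Lemma is_derive_constf c t : is_derive t (1 : R) (fun=> c) 0.
Proof. exact: is_derive_cst. Qed.

Lemma is_derive_scalef c f t df : is_derive t (1 : R) f df ->
  is_derive t (1 : R) (fun s => c * f s) (c * df).
Proof.
by move=> h; have := is_derive_mulf (is_derive_constf c t) h; rewrite mulr0 addr0.
Qed.

Lemma is_derive_sqrf f t df : is_derive t (1 : R) f df ->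
  is_derive t (1 : R) (fun s => f s ^+ 2) (2 * f t * df).
Proof.
move=> h; have -> : 2 * f t * df = f t * df + f t * df by ring.
exact: (is_derive_mulf h h).
Qed.

Lemma is_derive_sumf (n : nat) (F : nat -> R -> R) (dF : nat -> R) t :
  (forall i, is_derive t (1 : R) (F i) (dF i)) ->
  is_derive t (1 : R) (fun s => \sum_(i < n) F i s) (\sum_(i < n) dF i).
Proof.
move=> h; have -> : (fun s => \sum_(i < n) F i s) = \sum_(i < n) F i.
  by apply/funext => s; rewrite fct_sumE.
by apply: is_derive_sum.
Qed.

Lemma increment_le f f' (a b c : R) : a < b ->
  (forall t, a <= t <= b -> is_derive t (1 : R) f (f' t)) ->
  (forall t, a <= t <= b -> f' t <= c) -> f b - f a <= c * (b - a).
Proof.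
move=> ab df le.
have [||x xab ->] := @MVT R f f' a b ab.
- by move=> x; rewrite in_itv /= => /andP[/ltW h1 /ltW h2]; apply: df; rewrite h1.
- by apply: derivable_within_continuous => x; rewrite in_itv /= => /df [].
apply: ler_wpM2r; first by rewrite subr_ge0 ltW.
by move: xab; rewrite in_itv /= => /andP[/ltW h1 /ltW h2]; apply: le; rewrite h1.
Qed.

Lemma constant_of_derive0 f (b : R) : (forall t, t < b -> is_derive t (1 : R) f 0) ->
  forall s t, s < b -> t < b -> f s = f t.
Proof.
move=> df; suff lt s t : s < t -> t < b -> f s = f t.
  move=> s t sb tb; have [st|ts|->//] := ltgtP s t; first exact: lt.
  by rewrite (lt t s).
move=> st tb; have der x : s <= x <= t -> is_derive x (1 : R) f 0.
  by case/andP=> _ xt; apply: df; apply: le_lt_trans xt tb.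
have h1 := @increment_le f (fun=> 0) s t 0 st der (fun x _ => lexx 0).
have derN x : s <= x <= t -> is_derive x (1 : R) (fun y => -1 * f y) 0.
  by move=> /der h; have := is_derive_scalef (-1) h; rewrite mulr0.
have h2 := @increment_le _ (fun=> 0) s t 0 st derN (fun x _ => lexx 0).
by apply/le_anti; apply/andP; split; lra.
Qed.

End Derivatives.

Section HeatEquation.
Variables (R : realType) (e : rel nat) (N : nat) (cell : nat -> int * int)
  (site : int * int -> nat) (d : nat -> nat) (x0 : nat).
Hypotheses (cp : coarse_plane e N cell site) (cr : coarse_radius e cell d x0).
Implicit Types (x y M : nat) (r w t : R) (h : nat -> R) (u : nat -> R -> R).
Local Notation ballsum := (ballsum (R := R) d).

Definition heat u := forall x t, t < 0 -> is_derive t (1 : R) (u x) (glap e (u ^~ t) x).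

Definition lap_t u : nat -> R -> R := fun x t => glap e (u ^~ t) x.

Lemma heat_lap_t u : heat u -> heat (lap_t u).
Proof.
move=> hu x t t0; have [M hM] := neighbour_bound cp x.
have -> : lap_t u x = fun s => \sum_(y < M) (e x y)%:R * (u y s - u x s).
  by apply/funext => s; rewrite /lap_t /glap (nsumE _ hM).
rewrite /glap (nsumE _ hM).
apply: (@is_derive_sumf _ M (fun y s => (e x y)%:R * (u y s - u x s))
  (fun y => (e x y)%:R * (lap_t u y t - lap_t u x t))) => y.
by apply: is_derive_scalef; apply: is_derive_subf; exact: hu.
Qed.

Lemma glap_sqr_le h x : glap e h x ^+ 2 <= 25%:R * grad2 e h x.
Proof.
have [M hM] := neighbour_bound cp x.
rewrite /glap /grad2 !(nsumE _ hM).
pose a (y : 'I_M) := h y - h x; pose p (y : 'I_M) : R := (e x y)%:R.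
have h1 : (\sum_(y < M) p y * a y) ^+ 2 <=
    \sum_(y < M) \sum_(z < M) p y * p z * ((a y ^+ 2 + a z ^+ 2) / 2).
  rewrite expr2 mulr_suml; apply: ler_sum => y _; rewrite mulr_sumr; apply: ler_sum => z _.
  have -> : p y * a y * (p z * a z) = p y * p z * (a y * a z) by ring.
  apply: ler_wpM2l; first by rewrite mulr_ge0.
  by have := sqr_ge0 (a y - a z); lra.
apply: le_trans h1 _.
have -> : \sum_(y < M) \sum_(z < M) p y * p z * ((a y ^+ 2 + a z ^+ 2) / 2) =
    (\sum_z p z) * \sum_y p y * a y ^+ 2.
  have -> : \sum_(y < M) \sum_(z < M) p y * p z * ((a y ^+ 2 + a z ^+ 2) / 2) =
      2^-1 * (\sum_(y < M) \sum_(z < M) p y * p z * a y ^+ 2) +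
      2^-1 * (\sum_(y < M) \sum_(z < M) p y * p z * a z ^+ 2).
    rewrite !mulr_sumr -big_split; apply: eq_bigr => y _ /=.
    rewrite !mulr_sumr -big_split; apply: eq_bigr => z _ /=; by field.
  have -> : \sum_(y < M) \sum_(z < M) p y * p z * a y ^+ 2 =
      (\sum_z p z) * \sum_y p y * a y ^+ 2.
    rewrite mulr_sumr; apply: eq_bigr => y _; rewrite mulr_suml.
    apply: eq_bigr => z _; ring.
  have -> : \sum_(y < M) \sum_(z < M) p y * p z * a z ^+ 2 =
      (\sum_z p z) * \sum_y p y * a y ^+ 2.
    rewrite exchange_big /= mulr_sumr; apply: eq_bigr => y _; rewrite mulr_suml.
    apply: eq_bigr => z _; ring.
  by field.
have -> : \sum_(y < M) (e x y)%:R * (h x - h y) ^+ 2 = \sum_y p y * a y ^+ 2.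
  by apply: eq_bigr => y _; rewrite /a /p -(opprB (h y)) sqrrN.
apply: ler_wpM2r; first by apply: sumr_ge0 => y _; rewrite mulr_ge0 ?sqr_ge0.
exact: (degree_sum_le R cp x M).
Qed.


Lemma is_derive_esum2 M (F : nat -> nat -> R -> R) (dF : nat -> nat -> R) t :
  (forall x y, is_derive t (1 : R) (F x y) (dF x y)) ->
  is_derive t (1 : R) (fun s => esum2 e M (fun x y => F x y s)) (esum2 e M dF).
Proof.
move=> h; apply: (@is_derive_sumf _ M (fun x s => \sum_(y < M) (e x y)%:R * F x y s)
  (fun x => \sum_(y < M) (e x y)%:R * dF x y)) => x.
apply: (@is_derive_sumf _ M (fun y s => (e x y)%:R * F x y s)
  (fun y => (e x y)%:R * dF x y)) => y.
Qed.

(* Weights phi^2 with phi a cutoff: up to boundary terms, the rate of change of the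
   energy of u is bounded by minus the weighted square sum of v = lap u. *)
Lemma energy_rate M (phi h v : nat -> R) : (forall x, glap e h x = v x) ->
  (forall x y, phi x != 0 -> e x y -> (y < M)%N) ->
  esum2 e M (fun x y => phi x ^+ 2 * (2 * (h x - h y) * (v x - v y))) <=
  - 2 * (\sum_(x < M) phi x ^+ 2 * v x ^+ 2) +
  51%:R * esum2 e M (fun x y => (phi x - phi y) ^+ 2 * (h x - h y) ^+ 2) +
  esum2 e M (fun x y => (phi x - phi y) ^+ 2 * v x ^+ 2).
Proof.
move=> hv hM; set S := \sum_(x < M) _.
have e1 : S = esum2 e M (fun x y => phi x ^+ 2 * v x * (h y - h x)).
  rewrite /S -(@glap_sum R e M (fun x => phi x ^+ 2 * v x)).
    by apply: eq_bigr => x _; rewrite hv -mulrA -expr2.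
  by move=> x y h0; apply: hM; apply: contraNneq h0 => ->; rewrite expr0n mul0r.
have e2 : esum2 e M (fun x y => phi x ^+ 2 * (2 * (h x - h y) * (v x - v y))) =
    esum2 e M (fun x y => 2 * (phi x ^+ 2 + phi y ^+ 2) * (h x - h y) * v x).
  have -> : esum2 e M (fun x y => phi x ^+ 2 * (2 * (h x - h y) * (v x - v y))) =
      esum2 e M (fun x y => 2 * phi x ^+ 2 * (h x - h y) * v x) +
      esum2 e M (fun x y => 2 * phi x ^+ 2 * (h y - h x) * v y).
    by rewrite -esum2D; apply: esum2_eq => x y _; ring.
  rewrite [X in _ + X](esum2_sym cp) -esum2D; apply: esum2_eq => x y _; ring.
have e3 : esum2 e M (fun x y => 2 * (phi x ^+ 2 + phi y ^+ 2) * (h x - h y) * v x) =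
    - 4 * S + esum2 e M (fun x y => 2 * (phi y ^+ 2 - phi x ^+ 2) * (h x - h y) * v x).
  rewrite e1 -esum2Z -esum2D; apply: esum2_eq => x y _; ring.
(* The weight 2/25 lets the degree bound turn the first term into [2 * S], half of the available
   [4 * S]. Completing squares then gives 51 = (2 / 25) * 25 ^ 2 + 1. *)
have e4 : esum2 e M (fun x y => 2 * (phi y ^+ 2 - phi x ^+ 2) * (h x - h y) * v x) <=
    esum2 e M (fun x y => 2 / 25%:R * (phi x ^+ 2 * v x ^+ 2)) +
    51%:R * esum2 e M (fun x y => (phi x - phi y) ^+ 2 * (h x - h y) ^+ 2) +
    esum2 e M (fun x y => (phi x - phi y) ^+ 2 * v x ^+ 2).
  rewrite -esum2Z -!esum2D; apply: esum2_le => x y _ _ _.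
  set p := phi x; set q := phi y; set D := h x - h y; set V := v x.
  have s1 := sqr_ge0 (p * V - 25%:R * (q - p) * D).
  have s2 := sqr_ge0 ((q - p) * D - (q - p) * V).
  have : 2 / 25%:R * (p ^+ 2 * V ^+ 2) + 51%:R * ((p - q) ^+ 2 * D ^+ 2) +
    (p - q) ^+ 2 * V ^+ 2 - 2 * (q ^+ 2 - p ^+ 2) * D * V =
    2 / 25%:R * (p * V - 25%:R * (q - p) * D) ^+ 2 + ((q - p) * D - (q - p) * V) ^+ 2.
    by field.
  lra.
have e5 : esum2 e M (fun x y => 2 / 25%:R * (phi x ^+ 2 * v x ^+ 2)) <= 2 * S.
  rewrite esum2Z.
  have := @esum2_left_le R e N cell site cp M (fun x => phi x ^+ 2 * v x ^+ 2).
  move=> /(_ (fun x => mulr_ge0 (sqr_ge0 _) (sqr_ge0 _))); rewrite -/S; lra.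
rewrite e2 e3; lra.
Qed.

End HeatEquation.

(** * Local estimate for the Laplacian of a solution *)

Section CaloricStep.
Variables (R : realType) (e : rel nat) (N : nat) (cell : nat -> int * int)
  (site : int * int -> nat) (d : nat -> nat) (x0 : nat).
Hypotheses (cp : coarse_plane e N cell site) (cr : coarse_radius e cell d x0).
Implicit Types (x y M : nat) (r w t : R) (h F : nat -> R) (u : nat -> R -> R).
Local Notation ballsum := (ballsum (R := R) d).

Lemma cutoff_sum_le M r w r' F : 0 < w -> r + w <= r' -> (forall x, 0 <= F x) ->
  (forall x, (d x)%:R <= r' -> (x < M)%N) ->
  \sum_(x < M) cutoff d r w x ^+ 2 * F x <= ballsum r' F.
Proof.
move=> w0 rr F0 hM; rewrite (ballsumE _ hM); apply: ler_sum => x _.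
case: ifP => [_|/negbT]; last first.
  by rewrite -ltNge => dx; rewrite cutoff_out ?expr0n ?mul0r //; lra.
by rewrite ler_piMl // exprn_ile1 ?cutoff_ge0 ?cutoff_le1.
Qed.

Lemma cutoff_sum_ge M r w F : 0 < w -> (forall x, 0 <= F x) ->
  (forall x, (d x)%:R <= r -> (x < M)%N) ->
  ballsum r F <= \sum_(x < M) cutoff d r w x ^+ 2 * F x.
Proof.
move=> w0 F0 hM; rewrite (ballsumE _ hM); apply: ler_sum => x _.
case: ifP => [dx|_]; first by rewrite cutoff_in // expr1n mul1r.
by rewrite mulr_ge0 ?sqr_ge0.
Qed.

Lemma ballsumZ r a F : ballsum r (fun x => a * F x) = a * ballsum r F.
Proof.
have [M hM] := ball_bound cp cr r; rewrite !(ballsumE _ hM) mulr_sumr.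
by apply: eq_bigr => x _; case: ifP; rewrite ?mulr0.
Qed.

(* Rows of the double sum outside the ball of radius r' vanish. *)
Lemma esum2_ball_le M r' a h (p : nat -> nat -> R) :
  (forall x, (d x)%:R <= r' + 1 -> (x < M)%N) ->
  (forall x y, e x y -> p x y <= if (d x)%:R <= r' then a else 0) ->
  esum2 e M (fun x y => p x y * (h x - h y) ^+ 2) <= a * ballsum r' (grad2 e h).
Proof.
move=> hM hp; have hM' x : (d x)%:R <= r' -> (x < M)%N by move=> dx; apply: hM; lra.
rewrite (ballsumE _ hM') mulr_sumr; apply: ler_sum => x _; case: ifP => dx.
  rewrite /grad2 (@nsumE _ _ _ _ M) => [|y exy]; last first.
    apply: hM; have : (d y)%:R <= (d x)%:R + 1 :> R.
      by apply: (edge_radius R cr); rewrite (edge_sym cp).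
    lra.
  rewrite mulr_sumr; apply: ler_sum => y _; case: (boolP (e x y)) => [exy|_].
    rewrite !mul1r; apply: ler_wpM2r; first exact: sqr_ge0.
    by have := hp _ _ exy; rewrite dx.
  by rewrite !mul0r mulr0.
rewrite mulr0; apply: sumr_le0 => y _; case: (boolP (e x y)) => [exy|_]; last by rewrite mul0r.
rewrite mul1r; apply: mulr_le0_ge0; last exact: sqr_ge0.
by have := hp _ _ exy; rewrite dx.
Qed.

(** The dissipation at each level pays for the next: [- G] from [E0] controls the boundary terms of
    [E1], and [- H] from [E1] those of [E2]. The nested cutoffs leave room for each pair of levels.
    Time weights vanishing at [t1 = t0 - r ^+ 2] remove the unknown initial values of [E1] and [E2];
    that of [E0] is at most [A]. *)
Lemma caloric_step u r t0 A : heat e u -> 1 <= r -> t0 < 0 ->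
  (forall t, t0 - r ^+ 2 <= t <= t0 -> ballsum (8%:R * r) (fun x => u x t ^+ 2) <= A) ->
  r ^+ 4 * ballsum r (fun x => lap_t e u x t0 ^+ 2) <= 246428%:R * A.
Proof.
move=> hu r1 t00 hA; set v := lap_t e u.
have hv : heat e v := heat_lap_t cp hu.
have r0 : 0 < r by lra.
have [M hM9] := ball_bound cp cr (9%:R * r).
have hM c : c <= 9%:R * r -> forall x, (d x)%:R <= c -> (x < M)%N.
  by move=> c9 x dx; apply: hM9; lra.
pose phi2 := cutoff d r r; pose phi1 := cutoff d (3%:R * r) r; pose phi0 := cutoff d (6%:R * r) r.
have sup c : c + r + 1 <= 9%:R * r -> forall x y, cutoff d c r x != 0 -> e x y -> (y < M)%N.
  by move=> c9 x y; exact: (cutoff_support cp cr r0 (lexx _) (hM _ c9)).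
pose E2 s := \sum_(x < M) phi2 x ^+ 2 * v x s ^+ 2.
pose E1 s := esum2 e M (fun x y => phi1 x ^+ 2 * (u x s - u y s) ^+ 2).
pose E0 s := \sum_(x < M) phi0 x ^+ 2 * u x s ^+ 2.
pose H s := ballsum (3%:R * r) (fun x => v x s ^+ 2).
pose G s := ballsum (5%:R * r) (grad2 e (u ^~ s)).
pose dE2 s := \sum_(x < M) phi2 x ^+ 2 * (2 * v x s * glap e (v ^~ s) x).
pose dE1 s := esum2 e M (fun x y => phi1 x ^+ 2 * (2 * (u x s - u y s) * (v x s - v y s))).
pose dE0 s := \sum_(x < M) phi0 x ^+ 2 * (2 * u x s * v x s).
have der2 (s : R) : s < 0 -> is_derive s (1 : R) E2 (dE2 s).
  move=> s0; apply: (@is_derive_sumf R M (fun x s => phi2 x ^+ 2 * v x s ^+ 2)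
    (fun x => phi2 x ^+ 2 * (2 * v x s * glap e (v ^~ s) x))) => x.
  by apply: is_derive_scalef; apply: is_derive_sqrf; exact: hv.
have der0 (s : R) : s < 0 -> is_derive s (1 : R) E0 (dE0 s).
  move=> s0; apply: (@is_derive_sumf R M (fun x s => phi0 x ^+ 2 * u x s ^+ 2)
    (fun x => phi0 x ^+ 2 * (2 * u x s * v x s))) => x.
  by apply: is_derive_scalef; apply: is_derive_sqrf; exact: hu.
have der1 (s : R) : s < 0 -> is_derive s (1 : R) E1 (dE1 s).
  move=> s0; apply: is_derive_esum2 => x y.
  apply: is_derive_scalef; apply: (@is_derive_sqrf _ (fun s => u x s - u y s)).
  by apply: is_derive_subf; exact: hu.
have ri : 0 <= (r ^+ 2)^-1 by rewrite invr_ge0 exprn_ge0 // ltW.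
have sq (a b : R) : 0 <= (a - b) ^+ 2 by exact: sqr_ge0.
have H0 s : 0 <= H s by apply: (ballsum_ge0 cp cr) => x; exact: sqr_ge0.
have G0 s : 0 <= G s by apply: (ballsum_ge0 cp cr) => x; exact: grad2_ge0 cp _ _.
have bE2 s : 0 <= E2 s <= H s.
  apply/andP; split; first by apply: sumr_ge0 => x _; rewrite mulr_ge0 ?sqr_ge0.
  apply: cutoff_sum_le => //; [lra|by move=> x; exact: sqr_ge0|apply: hM; lra].
have bE1 s : 0 <= E1 s <= G s.
  apply/andP; split.
    by apply: esum2_ge0 => x y; rewrite mulr_ge0 ?sqr_ge0.
  rewrite -[G s]mul1r; apply: (@esum2_ball_le M (5%:R * r) 1 (u ^~ s) (fun x y => phi1 x ^+ 2)).
    by apply: hM; lra.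
  move=> x y _; case: ifP => [_|/negbT]; last first.
    by rewrite -ltNge => dx; rewrite /phi1 cutoff_out ?expr0n //; lra.
  by rewrite exprn_ile1 ?cutoff_ge0 ?cutoff_le1.
have bdE2 s : dE2 s <= 25%:R / r ^+ 2 * H s.
  have -> : dE2 s = 2 * \sum_(x < M) phi2 x ^+ 2 * v x s * glap e (v ^~ s) x.
    by rewrite mulr_sumr; apply: eq_bigr => x _; ring.
  rewrite (energy_identity cp) //; last by apply: sup; lra.
  apply: (@le_trans _ _ (esum2 e M (fun x y => v x s * v y s * (phi2 x - phi2 y) ^+ 2))).
    by rewrite gerBl esum2_ge0.
  apply: le_trans (energy_le cp _ _ _) _.
  by apply: (grad_ballsum_le cp cr) => //; [lra|apply: hM; lra].
have bdE0 s : t0 - r ^+ 2 <= s <= t0 -> dE0 s <= 25%:R / r ^+ 2 * A - G s.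
  move=> st; have -> : dE0 s = 2 * \sum_(x < M) phi0 x ^+ 2 * u x s * glap e (u ^~ s) x.
    by rewrite mulr_sumr; apply: eq_bigr => x _; rewrite /v /lap_t; ring.
  rewrite (energy_identity cp); last by apply: sup; lra.
  apply: lerB.
    apply: le_trans (energy_le cp _ _ _) _.
    apply: (@le_trans _ _ (25%:R / r ^+ 2 * ballsum (8%:R * r) (fun x => u x s ^+ 2))).
      by apply: (grad_ballsum_le cp cr) => //; [lra|apply: hM; lra].
    by apply: ler_wpM2l; [rewrite mulr_ge0|exact: hA].
  have hM5 : forall x, (d x)%:R <= 5%:R * r -> (x < M)%N by apply: hM; lra.
  rewrite /G (ballsumE _ hM5); apply: ler_sum => x _; case: ifP => dx; last first.
    by apply: sumr_ge0 => y _; rewrite mulr_ge0.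
  have near y : e x y -> (d y)%:R <= 6%:R * r.
    move=> exy; have : (d y)%:R <= (d x)%:R + 1 :> R.
      by apply: (edge_radius R cr); rewrite (edge_sym cp).
    lra.
  rewrite /grad2 (@nsumE _ _ _ _ M); last first.
    by move=> y /near dy; apply: (hM (6%:R * r)) => //; lra.
  apply: ler_sum => y _; case: (boolP (e x y)) => [/near dy|_]; last by rewrite !mul0r.
  by rewrite /phi0 !cutoff_in ?mul1r //; lra.
have bdE1 s : dE1 s <= - 2 * H s + 676%:R / r ^+ 2 * G s.
  apply: le_trans (energy_rate cp (h := u ^~ s) (v := v ^~ s) _ _) _ => //.
    by apply: sup; lra.
  have k1 : H s <= \sum_(x < M) phi1 x ^+ 2 * v x s ^+ 2.
    by apply: cutoff_sum_ge => //; [move=> x; exact: sqr_ge0|apply: hM; lra].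
  have k2 : esum2 e M (fun x y => (phi1 x - phi1 y) ^+ 2 * (u x s - u y s) ^+ 2) <=
      (r ^+ 2)^-1 * G s.
    apply: (@esum2_ball_le M (5%:R * r) _ (u ^~ s) (fun x y => (phi1 x - phi1 y) ^+ 2)).
      by apply: hM; lra.
    by move=> x y exy; apply: (cutoff_grad_le cp cr) => //; lra.
  have k3 : esum2 e M (fun x y => (phi1 x - phi1 y) ^+ 2 * v x s ^+ 2) <=
      25%:R / r ^+ 2 * (25%:R * G s).
    rewrite (@esum2_eq _ _ M _ (fun x y => v x s ^+ 2 * (phi1 x - phi1 y) ^+ 2)); last first.
      by move=> x y _; rewrite mulrC.
    apply: le_trans (grad_ballsum_le cp cr (r' := 5%:R * r) (v ^~ s) r0 _ _) _.
    - lra.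
    - by apply: hM; lra.
    apply: ler_wpM2l; first by rewrite mulr_ge0.
    rewrite /G -ballsumZ; apply: (ballsum_le cp cr) => // x.
      by rewrite mulr_ge0 //; exact: grad2_ge0 cp _ _.
    by move=> _; exact: glap_sqr_le cp _ _.
  have -> : 676%:R / r ^+ 2 * G s = 51%:R * ((r ^+ 2)^-1 * G s) +
      25%:R / r ^+ 2 * (25%:R * G s) by ring.
  lra.
set t1 := t0 - r ^+ 2.
have rr : 0 < r ^+ 2 by rewrite exprn_gt0.
have t10 : t1 < t0 by rewrite /t1; lra.
(* The weight 14 gives [- 28] against 25 + 2 in front of [l * H]. Since 676 = 51 + 25 ^ 2, the
   coefficient of [G] is 14 * 676 + 14 = 9478, cancelled by the weight of [E0]. What remains is 25 *
   9478 = 236950, and adding the initial 9478 gives 246428. *)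
pose Phi s := (s - t1) ^+ 2 * E2 s + (14%:R * (s - t1) * E1 s + 9478%:R * E0 s).
pose dPhi s := (s - t1) ^+ 2 * dE2 s + E2 s * (2 * (s - t1) * 1) +
  (14%:R * (s - t1) * dE1 s + E1 s * (14%:R * 1) + 9478%:R * dE0 s).
have lin (s : R) : is_derive s (1 : R) (fun s => s - t1) 1.
  have := is_derive_subf (is_derive_id s 1) (is_derive_constf t1 s).
  by rewrite subr0.
have dP (s : R) : t1 <= s <= t0 -> is_derive s (1 : R) Phi (dPhi s).
  case/andP=> _ st; have s0 : s < 0 by lra.
  apply: is_derive_addf.
    exact: (is_derive_mulf (is_derive_sqrf (lin s)) (der2 s s0)).
  apply: is_derive_addf; last exact: is_derive_scalef (der0 s s0).
  exact: (is_derive_mulf (is_derive_scalef 14%:R (lin s)) (der1 s s0)).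
have A0 : 0 <= A.
  apply: le_trans (hA t0 _); last by rewrite lexx andbT; lra.
  by apply: (ballsum_ge0 cp cr) => x; exact: sqr_ge0.
have dPle s : t1 <= s <= t0 -> dPhi s <= 236950%:R / r ^+ 2 * A.
  move=> st; have h0 := bdE0 s st; have h1 := bdE1 s; have h2 := bdE2 s.
  have /andP[_ h3] := bE2 s; have /andP[_ h4] := bE1 s.
  have HH := H0 s; have GG := G0 s.
  case/andP: st => st1 st0; set l := s - t1.
  have l0 : 0 <= l by rewrite /l; lra.
  have lr : l <= r ^+ 2 by rewrite /l /t1; lra.
  have g1 : l ^+ 2 * dE2 s <= 25%:R * (l * H s).
    apply: (@le_trans _ _ (l ^+ 2 * (25%:R / r ^+ 2 * H s))).
      by rewrite ler_wpM2l ?sqr_ge0.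
    have -> : l ^+ 2 * (25%:R / r ^+ 2 * H s) = (l / r ^+ 2) * (25%:R * (l * H s)) by ring.
    rewrite ler_piMl ?mulr_ge0 // ler_pdivrMr // mul1r //.
  have g2 : E2 s * (2 * l * 1) <= 2 * (l * H s).
    have -> : E2 s * (2 * l * 1) = 2 * (l * E2 s) by ring.
    by rewrite ler_pM2l // ler_wpM2l.
  have g3 : 14%:R * l * dE1 s <= - 28%:R * (l * H s) + 9464%:R * G s.
    apply: (@le_trans _ _ (14%:R * l * (- 2 * H s + 676%:R / r ^+ 2 * G s))).
      by rewrite ler_wpM2l ?mulr_ge0.
    have -> : 14%:R * l * (- 2 * H s + 676%:R / r ^+ 2 * G s) =
      - 28%:R * (l * H s) + (l / r ^+ 2) * (9464%:R * G s) by ring.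
    rewrite lerD2l ler_piMl ?mulr_ge0 // ler_pdivrMr // mul1r //.
  have g4 : 9478%:R * dE0 s <= 236950%:R / r ^+ 2 * A - 9478%:R * G s.
    apply: (@le_trans _ _ (9478%:R * (25%:R / r ^+ 2 * A - G s))).
      by rewrite ler_pM2l.
    by rewrite le_eqVlt; apply/orP; left; apply/eqP; ring.
  have lH : 0 <= l * H s by rewrite mulr_ge0.
  rewrite /dPhi -/l; lra.
have := increment_le t10 dP dPle.
have -> : 236950%:R / r ^+ 2 * A * (t0 - t1) = 236950%:R * A.
  by rewrite /t1; field; rewrite gt_eqF.
rewrite /Phi subrr expr0n !mul0r mulr0 mul0r !add0r.
have -> : t0 - t1 = r ^+ 2 by rewrite /t1; ring.
have E0le : E0 t1 <= A.
  apply: le_trans (hA t1 _); last by rewrite lexx ltW.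
  apply: cutoff_sum_le => //; [lra|by move=> x; exact: sqr_ge0|apply: hM; lra].
have E00 : 0 <= E0 t0 by apply: sumr_ge0 => x _; rewrite mulr_ge0 ?sqr_ge0.
have /andP[E10 _] := bE1 t0.
have vE2 : ballsum r (fun x => v x t0 ^+ 2) <= E2 t0.
  by apply: cutoff_sum_ge => //; [move=> x; exact: sqr_ge0|apply: hM; lra].
have : r ^+ 4 * ballsum r (fun x => v x t0 ^+ 2) <= r ^+ 4 * E2 t0.
  by rewrite ler_wpM2l ?exprn_ge0 // ltW.
have E1' : 0 <= 14%:R * r ^+ 2 * E1 t0 by rewrite !mulr_ge0 // ltW.
rewrite -exprM; lra.
Qed.

End CaloricStep.

(** * Ancient solutions of polynomial growth *)

Section PolynomialGrowth.
Variables (R : realType) (e : rel nat) (N : nat) (cell : nat -> int * int)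
  (site : int * int -> nat) (d : nat -> nat) (x0 : nat).
Hypotheses (cp : coarse_plane e N cell site) (cr : coarse_radius e cell d x0).
Implicit Types (x y M : nat) (r t : R) (h : nat -> R) (u : nat -> R -> R).
Local Notation ballsum := (ballsum (R := R) d).

Definition lap_iter j u : nat -> R -> R := fun x t => iter j (glap e) (u ^~ t) x.

Lemma heat_lap_iter j u : heat e u -> heat e (lap_iter j u).
Proof. by move=> hu; elim: j => // j IH; exact: (heat_lap_t cp IH). Qed.

Definition caloric_growth (K : nat) (C : R) u := forall x t, t < 0 ->
  `|u x t| <= C * (1 + (d x)%:R + Num.sqrt `|t|) ^+ (2 * K).

(** Each Laplacian gains [r ^ 4] at the price of a cylinder of radius [8 * r], whose depth suffices
    since [2 * r ^ 2 <= (8 * r) ^ 2]. On the right, [4 K] is the squared growth and 2 the volume. *)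
Lemma lap_iter_decay (K : nat) (C : R) u j : 0 <= C -> heat e u -> caloric_growth K C u ->
  exists2 c, 0 <= c & forall r t, 1 <= r -> - r ^+ 2 <= t < 0 ->
    r ^+ (4 * j) * ballsum r (fun x => lap_iter j u x t ^+ 2) <= c * r ^+ (4 * K + 2).
Proof.
move=> C0 hu gr; elim: j => [|j [c c0 IH]].
  exists (25%:R * C ^+ 2 * 3%:R ^+ (4 * K)).
    by rewrite !mulr_ge0 ?exprn_ge0.
  move=> r t r1 /andP[rt t0]; rewrite mul1r.
  pose b := C ^+ 2 * (3%:R * r) ^+ (4 * K).
  have b0 : 0 <= b by rewrite mulr_ge0 ?sqr_ge0 // exprn_ge0 //; lra.
  apply: (@le_trans _ _ (ballsum r (fun=> b))).
    apply: (ballsum_le cp cr) => // x dx.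
    rewrite -[lap_iter 0 u x t]/(u x t) -real_normK ?num_real //.
    have st : Num.sqrt `|t| <= r.
      rewrite (_ : r = Num.sqrt (r ^+ 2)); last by rewrite sqrtr_sqr ger0_norm //; lra.
      by apply: ler_wsqrtr; rewrite ltr0_norm //; lra.
    have p0 := sqrtr_ge0 `|t|.
    have q0 : 0 <= 1 + (d x)%:R + Num.sqrt `|t| by rewrite !addr_ge0.
    have h := gr x t t0.
    apply: (@le_trans _ _ ((C * (3%:R * r) ^+ (2 * K)) ^+ 2)).
      apply: lerXn2r; rewrite ?nnegrE ?mulr_ge0 ?exprn_ge0 //; first lra.
      apply: le_trans h _; apply: ler_wpM2l => //.
      by apply: lerXn2r; rewrite ?nnegrE //; lra.
    by rewrite /b exprMn -exprM (_ : (2 * K * 2 = 4 * K)%N) //; lia.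
  apply: le_trans (ballsum_card cp cr r1 b0) _.
  rewrite /b exprMn exprD; move: (r ^+ (4 * K)) (3%:R ^+ (4 * K)) => p q.
  by rewrite le_eqVlt; apply/orP; left; apply/eqP; ring.
exists (246428%:R * c * 8%:R ^+ (4 * K + 2)).
  by rewrite !mulr_ge0 ?exprn_ge0.
move=> r t r1 /andP[rt t0].
have r0 : 0 < r by lra.
pose A := c * (8%:R * r) ^+ (4 * K + 2) / (8%:R * r) ^+ (4 * j).
have p8 : 0 < (8%:R * r) ^+ (4 * j) by rewrite exprn_gt0 // mulr_gt0.
have := caloric_step cp cr (A := A) (heat_lap_iter j hu) r1 t0.
have r2 : 0 <= r ^+ 2 by rewrite sqr_ge0.
have hA s : t - r ^+ 2 <= s <= t -> ballsum (8%:R * r) (fun x => lap_iter j u x s ^+ 2) <= A.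
  case/andP=> s1 s2; rewrite /A ler_pdivlMr // mulrC; apply: IH; first lra.
  by apply/andP; split; [rewrite exprMn; lra|lra].
move=> /(_ hA); rewrite -[lap_t e (lap_iter j u)]/(lap_iter j.+1 u) => hs.
have -> : r ^+ (4 * j.+1) = r ^+ (4 * j) * r ^+ 4 by rewrite -exprD mulnS addnC.
rewrite -mulrA; apply: (@le_trans _ _ (r ^+ (4 * j) * (246428%:R * A))).
  by apply: ler_wpM2l hs; rewrite exprn_ge0 // ltW.
have -> : r ^+ (4 * j) * (246428%:R * A) =
   246428%:R * c * 8%:R ^+ (4 * K + 2) * r ^+ (4 * K + 2) *
     (r ^+ (4 * j) / (8%:R * r) ^+ (4 * j)).
  rewrite /A exprMn; move: (8%:R ^+ (4 * K + 2)) (r ^+ (4 * K + 2)) => p q; ring.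
rewrite ler_piMr //.
  by rewrite !mulr_ge0 ?exprn_ge0 // ltW.
rewrite ler_pdivrMr // mul1r; apply: lerXn2r; rewrite ?nnegrE //; lra.
Qed.

(** At [j = K.+1] the exponent on the left exceeds that on the right by 2, so [r ^ 2 * v x t ^ 2]
    stays bounded as [r] grows. *)
Lemma lap_iter_vanishes (K : nat) (C : R) u : 0 <= C -> heat e u -> caloric_growth K C u ->
  forall x t, t < 0 -> lap_iter K.+1 u x t = 0.
Proof.
move=> C0 hu gr x t t0; have [c c0 hc] := lap_iter_decay K.+1 C0 hu gr.
set v := lap_iter K.+1 u in hc *; apply: contrapT => /eqP v0.
have w0 : 0 < v x t ^+ 2 by rewrite lt_neqAle sqr_ge0 andbT eq_sym sqrf_eq0.
pose q := c / v x t ^+ 2.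
have q0 : 0 <= q by rewrite divr_ge0 // ltW.
(* [d x] puts [x] in the ball, [|t|] puts [t] in the time window as [r <= r ^+ 2], and [q] makes
   [r * v x t ^+ 2] exceed [c]. *)
pose r : R := 1 + (d x)%:R + `|t| + q.
have d0 : 0 <= (d x)%:R :> R by [].
have nt := normr_ge0 t.
have r1 : 1 <= r by rewrite /r; lra.
have rr : r <= r ^+ 2 by rewrite expr2 ler_peMl //; lra.
have tr : - r ^+ 2 <= t < 0.
  by rewrite t0 andbT; have := ltr0_norm t0; rewrite /r in rr *; lra.
have := hc r t r1 tr.
have -> : (4 * K.+1 = (4 * K + 2) + 2)%N by lia.
have pr : 0 < r ^+ (4 * K + 2) by rewrite exprn_gt0 //; lra.
rewrite exprD -mulrA [leLHS]mulrC ler_pM2r //.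
have vb : v x t ^+ 2 <= ballsum r (fun x => v x t ^+ 2).
  have [M hM] := ball_bound cp cr r; rewrite (ballsumE _ hM).
  have dx : (d x)%:R <= r by rewrite /r; lra.
  rewrite (bigD1 (Ordinal (hM _ dx))) //= dx lerDl; apply: sumr_ge0 => y _.
  by case: ifP => _ //; exact: sqr_ge0.
apply/negP; rewrite -ltNge.
apply: (@lt_le_trans _ _ (r * v x t ^+ 2)).
  have -> : c = q * v x t ^+ 2 by rewrite /q divfK // gt_eqF.
  by rewrite ltr_pM2r // /r; lra.
by apply: ler_pM => //; [lra|exact: ltW].
Qed.

Lemma glap_growth (k : nat) (C : R) h : 0 <= C ->
  (forall x, `|h x| <= C * (1 + (d x)%:R) ^+ k) ->
  forall x, `|glap e h x| <= 25%:R * (2 ^+ k + 1) * C * (1 + (d x)%:R) ^+ k.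
Proof.
move=> C0 hh x; have [M hM] := neighbour_bound cp x.
pose p := C * (1 + (d x)%:R) ^+ k.
have p0 : 0 <= p by rewrite mulr_ge0 // exprn_ge0 // addr_ge0.
have pe : 0 <= 2 ^+ k + 1 :> R by rewrite addr_ge0 ?exprn_ge0.
rewrite /glap (nsumE _ hM); apply: le_trans (ler_norm_sum _ _ _) _.
apply: (@le_trans _ _ (\sum_(y < M) (e x y)%:R * ((2 ^+ k + 1) * p))).
  apply: ler_sum => y _; rewrite normrM normr_nat.
  case: (boolP (e x y)) => [exy|_]; last by rewrite !mul0r.
  rewrite !mul1r; apply: le_trans (ler_normB _ _) _; rewrite mulrDl mul1r.
  apply: lerD; last exact: hh.
  apply: le_trans (hh y) _; rewrite /p mulrCA -exprMn; apply: ler_wpM2l => //.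
  apply: lerXn2r; rewrite ?nnegrE ?mulr_ge0 ?addr_ge0 //.
  have : (d y)%:R <= (d x)%:R + 1 :> R.
    by apply: (edge_radius R cr); rewrite (edge_sym cp).
  have : 0 <= (d x)%:R :> R by [].
  lra.
rewrite -mulr_suml.
have -> : 25%:R * (2 ^+ k + 1) * C * (1 + (d x)%:R) ^+ k = 25%:R * ((2 ^+ k + 1) * p).
  by rewrite /p !mulrA.
by apply: ler_wpM2r; [rewrite mulr_ge0|exact: (degree_sum_le R cp x M)].
Qed.

Lemma iter_glap_growth (k j : nat) h :
  (exists2 C, 0 <= C & forall x, `|h x| <= C * (1 + (d x)%:R) ^+ k) ->
  exists2 C, 0 <= C & forall x, `|iter j (glap e) h x| <= C * (1 + (d x)%:R) ^+ k.
Proof.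
move=> hh; elim: j => //= j [C C0 hC]; exists (25%:R * (2 ^+ k + 1) * C).
  by rewrite !mulr_ge0 ?addr_ge0 ?exprn_ge0.
exact: glap_growth.
Qed.

Lemma glap_sum_linear (m : nat) (a : 'I_m -> R) (h : 'I_m -> nat -> R) x :
  glap e (fun y => \sum_i a i * h i y) x = \sum_i a i * glap e (h i) x.
Proof.
have [M hM] := neighbour_bound cp x.
rewrite /glap (nsumE _ hM).
under [RHS]eq_bigr do rewrite (nsumE _ hM) mulr_sumr.
rewrite exchange_big /=; apply: eq_bigr => y _.
by rewrite -sumrB mulr_sumr; apply: eq_bigr => i _; ring.
Qed.

Lemma iter_glap_sum_linear j (m : nat) (a : 'I_m -> R) (h : 'I_m -> nat -> R) x :
  iter j (glap e) (fun y => \sum_i a i * h i y) x = \sum_i a i * iter j (glap e) (h i) x.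
Proof.
elim: j x => //= j IH x; rewrite -glap_sum_linear; congr (glap e _ x).
by apply/funext => y; exact: IH.
Qed.

End PolynomialGrowth.

(* Filtration by the kernels of the powers of the Laplacian: the j-th power maps
   the kernel of the next one to time-independent harmonic functions. *)
Lemma ancient_dim (R : realType) (N : nat) : exists b : nat,
  forall e cell site d x0, coarse_plane e N cell site -> coarse_radius e cell d x0 ->
  forall (K m : nat) (u : 'I_m -> nat -> R -> R), (0 < K)%N ->
  (forall i, heat e (u i)) ->
  (forall i, exists2 C, 0 <= C & caloric_growth d K C (u i)) ->
  (forall a : 'rV[R]_m, (forall x t, t < 0 -> \sum_i a 0 i * u i x t = 0) -> a = 0) ->
  (m <= K.+1 * (b * K ^ 2))%N.
Proof.
have [b hb] := harmonic_dim R N; exists b.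
move=> e cell site d x0 cp cr K m u K0 hu gr free.
pose U (a : 'rV[R]_m) x t := \sum_i a 0 i * u i x t.
have lin j a x t : lap_iter e j (U a) x t = \sum_i a 0 i * lap_iter e j (u i) x t.
  exact: (iter_glap_sum_linear cp j (fun i => a 0 i) (fun i => u i ^~ t)).
pose P j a := forall x t, t < 0 -> lap_iter e j (U a) x t = 0.
have /choice[A hA] : forall j, exists A : 'M[R]_m, forall a, (a <= A)%MS <-> P j a.
  move=> j; apply: subspace_matrix.
    by move=> x t _; rewrite lin big1 // => i _; rewrite mxE mul0r.
  move=> c v w Pv Pw x t t0.
  have -> : lap_iter e j (U (c *: v + w)) x t =
      c * lap_iter e j (U v) x t + lap_iter e j (U w) x t.
    by rewrite !lin mulr_sumr -big_split; apply: eq_bigr => i _ /=; rewrite !mxE; ring.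
  by rewrite Pv // Pw // mulr0 addr0.
have heatU a : heat e (U a).
  move=> x t t0.
  have -> : glap e (U a ^~ t) x = \sum_i a 0 i * glap e (u i ^~ t) x.
    exact: (glap_sum_linear cp (fun i => a 0 i) (fun i => u i ^~ t)).
  have -> : U a x = \sum_i (fun s => a 0 i * u i x s).
    by apply/funext => s; rewrite fct_sumE.
  by apply: is_derive_sum => i; apply: is_derive_scalef; exact: hu.
have m10 : (- 1 : R) < 0 by rewrite oppr_lt0.
have rank_step j : (\rank (A j.+1) <= \rank (A j) + b * K ^ 2)%N.
  pose D := (A j.+1 :\: A j)%MS.
  have rD : (\rank D <= b * K ^ 2)%N.
    (* On the kernel of the next power, the [j]-th power is harmonic in space, and by the heat
       equation its time derivative is 0. Its values at the single time -1 therefore determine it at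
       all negative times. *)
    pose B := row_base D; pose f (i : 'I_(\rank D)) x := lap_iter e j (U (row i B)) x (- 1).
    have BD : (B <= D)%MS by rewrite /B eq_row_base.
    have BP i : P j.+1 (row i B).
      apply/hA; apply: submx_trans (row_sub i B) _.
      exact: submx_trans BD (diffmxSl _ _).
    apply: (hb e cell site d x0 cp cr K _ f K0).
    - by move=> i x; exact: (BP i x (- 1) m10).
    - move=> i.
      have [|C C0 hC] := @iter_glap_growth R e N cell site d x0 cp cr (2 * K) j
          (U (row i B) ^~ (- 1)); last by exists C.
      have [C hC] := choice (fun i => (let: ex_intro2 C p q := gr i in ex_intro _ C (conj p q))).
      pose c := \sum_k `|row i B 0 k| * C k.
      have c0 : 0 <= c by apply: sumr_ge0 => k _; rewrite mulr_ge0 //; case: (hC k).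
      exists (c * 2 ^+ (2 * K)); first by rewrite mulr_ge0 ?exprn_ge0.
      move=> x; apply: le_trans (ler_norm_sum _ _ _) _.
      rewrite /c !mulr_suml; apply: ler_sum => k _; rewrite normrM -!mulrA.
      apply: ler_wpM2l => //; have [Ck0 hCk] := hC k.
      apply: le_trans (hCk x (- 1) m10) _; rewrite ler_wpM2l // -exprMn.
      rewrite normrN1 sqrtr1; apply: lerXn2r; rewrite ?nnegrE ?mulr_ge0 ?addr_ge0 //.
      have : 0 <= (d x)%:R :> R by [].
      lra.
    move=> a ha; pose w := a *m B.
    have wlin x t : lap_iter e j (U w) x t = \sum_i a 0 i * lap_iter e j (U (row i B)) x t.
      rewrite lin; under [RHS]eq_bigr do rewrite lin mulr_sumr.
      rewrite exchange_big /=; apply: eq_bigr => k _.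
      rewrite /w mxE mulr_suml; apply: eq_bigr => i _.
      by rewrite [row i B 0 k]mxE mulrA.
    have wD : (w <= D)%MS by exact: submx_trans (submxMl _ _) BD.
    have wA : (w <= A j.+1)%MS by exact: submx_trans wD (diffmxSl _ _).
    have wA' : (w <= A j)%MS.
      apply/hA => x t t0; have Pw := (hA j.+1 w).1 wA.
      have <- : lap_iter e j (U w) x (- 1) = 0 by rewrite wlin; exact: ha.
      apply: (@constant_of_derive0 R (lap_iter e j (U w) x) 0) => // s s0.
      by have := heat_lap_iter cp j (heatU w) x s0; rewrite -[glap e _ x]/(lap_iter e j.+1 (U w) x s) Pw.
    have w0 : w = 0.
      by apply/eqP; rewrite -submx0 -(capmx_diff (A j.+1) (A j)) sub_capmx wD wA'.
    have := row_base_free D; rewrite -kermx_eq0 -submx0 => /rV_subP/(_ a) h.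
    apply/eqP; rewrite -submx0; apply: h; exact/sub_kermxP.
  rewrite -(mxrank_cap_compl (A j.+1) (A j)) leq_add // mxrankS //.
  exact: capmxSr.
have rank_le j : (\rank (A j) <= j * (b * K ^ 2))%N.
  elim: j => [|j IH]; last by apply: leq_trans (rank_step j) _; rewrite mulSn addnC leq_add2l.
  rewrite mul0n leqn0 mxrank_eq0 -submx0; apply/rV_subP => a /hA Pa.
  by rewrite (free a Pa) sub0mx.
apply: leq_trans (rank_le K.+1).
have full : (1%:M <= A K.+1)%MS.
  apply/row_subP => i; apply/hA => x t t0; rewrite lin big1 // => k _.
  have [C C0 hC] := gr k.
  by rewrite (lap_iter_vanishes cp cr C0 (hu k) hC) // mulr0.
by have := mxrankS full; rewrite mxrank1.
Qed.

(** * Application to penny graphs *)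

Section GraphDistance.
Variables (R : realType) (G : penny_graph R).
Hypothesis conn : graph_connected G.

Lemma gdist_le_size x y p : is_walk G x y p -> (gdist G x y <= size p)%N.
Proof.
move=> w; rewrite /gdist; case: pselect => [h|//].
by case: ex_minnP => n _; apply; apply/asboolP; exists p.
Qed.

Lemma gdist_walk x y : exists2 p, is_walk G x y p & size p = gdist G x y.
Proof.
rewrite /gdist; case: pselect => [h|h]; last first.
  exfalso; apply: h; have [p w] := conn x y.
  by exists (size p); apply/asboolP; exists p.
by case: ex_minnP => n /asboolP[p w sp] _; exists p.
Qed.

Lemma gdist_coarse_radius N cell site x0 : coarse_plane (adj G) N cell site ->
  coarse_radius (adj G) cell (fun x => gdist G x x0) x0.
Proof.
move=> cp; split=> [x y xy|x].
  have [p [pp lp] <-] := gdist_walk y x0.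
  by apply: (@gdist_le_size x x0 (y :: p)); split; rewrite /= ?xy.
have [p [pp <-] <-] := gdist_walk x x0.
elim: p x pp => [|y p IH] x /=; first by rewrite !subrr.
case/andP=> /(cell_edge cp) [h1 h2] /IH [h3 h4].
split; lia.
Qed.

End GraphDistance.

(** * From negative times to the final time *)

Section AncientSolutions.
Variables (R : realType) (G : penny_graph R).

(** The estimates see only negative times. The one-sided derivative at 0 gives left continuity,
    through which a relation at negative times extends to [t = 0]. *)
Lemma ancient_left_continuous u x : ancient_solution G u ->
  u x h @[h --> (0 : R)^'-] --> u x 0.
Proof.
case=> _ _ /(_ x) h.
have id0 : (h : R) @[h --> (0 : R)^'-] --> (0 : R) by exact: cvg_within.
have : u x 0 + h * (h^-1 * (u x h - u x 0)) @[h --> (0 : R)^'-] -->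
    u x 0 + 0 * laplacian G u x 0.
  by apply: cvgD; [exact: cvg_cst|exact: cvgM].
rewrite mul0r addr0; apply: cvg_trans; apply: near_eq_cvg.
near=> t.
have t0 : t != 0 by rewrite lt_eqF //; near: t; exact: nbhs_left_lt.
by rewrite mulrA divff // mul1r addrC subrK.
Unshelve. all: by end_near. Qed.

Lemma ancient_combination_zero (n : nat) (v : 'I_n -> nat -> R -> R^o) (a : 'I_n -> R) :
  (forall i, ancient_solution G (v i)) ->
  (forall x t, t < 0 -> \sum_i a i * v i x t = 0) ->
  \sum_i a i *: v i = 0.
Proof.
move=> anc neg.
have ev x t : (\sum_i a i *: v i) x t = \sum_i a i * v i x t.
  by rewrite fct_sumE fct_sumE.
apply/funext => x; apply/funext => t; rewrite ev.
have [t0|t0|->] := ltgtP t 0; first exact: neg.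
  by apply: big1 => i _; have [h _ _] := anc i; rewrite h // mulr0.
have lim : (fun h => \sum_i a i * v i x h) h @[h --> (0 : R)^'-] --> \sum_i a i * v i x 0.
  have -> : (fun h => \sum_i a i * v i x h) = \sum_i (fun h => a i * v i x h).
    by apply/funext => h; rewrite fct_sumE.
  elim/big_ind2: _ => [|f l g m hf hg|i _]; [exact: cvg_cst|exact: cvgD|].
  by apply: cvgM; [exact: cvg_cst|exact: ancient_left_continuous (anc i)].
have lim0 : (fun h => \sum_i a i * v i x h) h @[h --> (0 : R)^'-] --> (0 : R).
  apply: (@cvg_trans _ ((fun=> 0 : R) h @[h --> (0 : R)^'-])); last exact: cvg_cst.
  apply: near_eq_cvg; near=> h; rewrite neg //; near: h; exact: nbhs_left_lt.
exact: (cvg_unique _ lim lim0).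
Unshelve. all: by end_near. Qed.

End AncientSolutions.

Theorem corollary3p14 (R : realType) (D : R) :
  exists C : R, forall (G : penny_graph R),
    graph_connected G ->
    (forall S : set (R * R), faces G S -> (facial_degree G S <= D%:E)%E) ->
    forall (x0 : nat) (k : R), 1 <= k ->
      (dimension (ancient_poly G x0 (2 * k)) <= (C * k ^+ 3)%:E)%E.
Proof.
pose D' := (Num.truncn D).+1.
have [N hN] := penny_coarse_plane R D'.
have [b hb] := ancient_dim R N.
(* With [k <= K <= 2 * k] and [K.+1 <= 3 * k], both using [1 <= k], the count [K.+1 * (b * K ^ 2)]
   is at most [3 * k * b * (2 * k) ^ 2]. *)
exists (12 * b%:R) => G conn bounded x0 k k1.
have bounded' S : faces G S -> (facial_degree G S <= D'%:R%:E)%E.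
  move/bounded => h; apply: le_trans h _; rewrite lee_fin.
  by apply/ltW; rewrite truncnS_gt.
have [cell [site cp]] := hN G conn bounded'.
have cr := gdist_coarse_radius conn x0 cp.
pose K := (Num.truncn k).+1.
have kK : k <= K%:R by apply/ltW; rewrite truncnS_gt.
have K2 : K%:R <= 2 * k.
  have : (Num.truncn k)%:R <= k by apply: truncn_le_self; lra.
  by rewrite /K -natr1; lra.
apply: ge_ereal_sup => _ [n [v [vP free]] <-]; rewrite lee_fin.
have anc i : ancient_solution G (v i) by have [] := vP i.
have := hb (adj G) cell site (fun x => gdist G x x0) x0 cp cr K n v isT.
have heatv i : heat (adj G) (v i).
  by move=> x t t0; have [_ h _] := anc i; exact: h.
move=> /(_ heatv) {heatv} h.
have nK : (n <= K.+1 * (b * K ^ 2))%N.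
  apply: h => [i|a ha].
    have [_ [C hC]] := vP i; exists `|C| => // x t t0.
    apply: le_trans (hC x t (ltW t0)) _.
    set B := 1 + _ + _.
    have B1 : 1 <= B by rewrite /B -addrA lerDl addr_ge0 ?sqrtr_ge0.
    apply: (@le_trans _ _ (`|C| * B `^ (2 * k))).
      by apply: ler_wpM2r; [exact: powR_ge0|exact: ler_norm].
    apply: ler_wpM2l => //; rewrite -powR_mulrn; last lra.
    by apply: ler_powR => //; rewrite natrM ler_pM2l.
  apply/rowP => i; rewrite mxE; apply: (free (fun i => a 0 i)).
  exact: ancient_combination_zero ha.
have : n%:R <= (K.+1 * (b * K ^ 2))%:R :> R by rewrite ler_nat.
move/le_trans; apply; rewrite !natrM -expr2.
have K3 : K.+1%:R <= 3 * k by rewrite -natr1; lra.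
have K4 : K%:R ^+ 2 <= (2 * k) ^+ 2 by rewrite ler_pXn2r ?nnegrE //; lra.
apply: (@le_trans _ _ (3 * k * (b%:R * (2 * k) ^+ 2))).
  by apply: ler_pM; rewrite ?mulr_ge0 ?sqr_ge0 // ler_wpM2l.
by rewrite le_eqVlt; apply/orP; left; apply/eqP; ring.
Qed.
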